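(* Let $d\ge 1$, let $\gamma,p\in\mathbb{R}$ with $\gamma+2p<1$, and let $0<c_1\le c_2<\infty$. Suppose that $K:\mathbb{R}^d_*\times\mathbb{R}^d_*\to\mathbb{R}_+$ is a continuous symmetric function satisfying $$c_1(|x|+|y|)^{\gamma}\,\Phi\!\left(\tfrac{|x|}{|x|+|y|}\right)\le K(x,y)\le c_2(|x|+|y|)^{\gamma}\,\Phi\!\left(\tfrac{|x|}{|x|+|y|}\right),\qquad x,y\in\mathbb{R}^d_*,$$ where $\Phi(s)=s^{-p}(1-s)^{-p}$ for $0<s<1$. Suppose that $\eta\in\mathcal{M}_{+,b}(\mathbb{R}^d_* )$ has its support in the set $\{x\in\mathbb{R}^d_*: 1\le |x|\le L\}$ for some $L>1$. Then there exists a stationary injection solution $f\in\mathcal{M}_+(\mathbb{R}^d_* )$ (with kernel $K$, parameters $(\gamma,p)$ and source $\eta$).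
   Context: Notation: $\mathbb{R}_+=[0,\infty)$, $O=(0,\dots,0)$, $\mathbb{R}^d_*=\mathbb{R}_+^d\setminus\{O\}$, and $|x|=\sum_{j=1}^d x_j$ is the $\ell^1$-norm. For a locally compact Hausdorff space $X$, $\mathcal{M}_+(X)$ denotes the non-negative Radon measures on $X$ (not necessarily bounded) and $\mathcal{M}_{+,b}(X)$ the bounded ones. $C^1_c(\mathbb{R}^d_* )$ denotes the $C^1$ functions with compact support in $\mathbb{R}^d_*$. Definition (stationary injection solution with kernel $K$, parameters $(\gamma,p)$, source $\eta$). A measure $f\in\mathcal{M}_+(\mathbb{R}^d_* )$ is a stationary injection solution if the support of $f$ is contained in $\{x\in\mathbb{R}^d_*:|x|\ge 1\}$, $\int_{\mathbb{R}^d_*}|x|^{\gamma+p}f(dx)<\infty$, and for every $\varphi\in C^1_c(\mathbb{R}^d_* )$ $$0=\frac12\int_{\mathbb{R}^d_*}\int_{\mathbb{R}^d_*}K(x,y)\,[\varphi(x+y)-\varphi(x)-\varphi(y)]\,f(dx)f(dy)+\int_{\mathbb{R}^d_*}\varphi(x)\,\eta(dx).$$ *)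

(* Defs.v *)
From HB Require Import structures.
From mathcomp Require Import all_boot all_order all_algebra.
From mathcomp Require Import all_classical all_reals all_analysis.

Set Implicit Arguments.
Unset Strict Implicit.
Unset Printing Implicit Defensive.

Import Order.TTheory GRing.Theory Num.Theory.
Import numFieldNormedType.Exports.

Local Open Scope classical_set_scope.
Local Open Scope ring_scope.

Definition orthant_star (R : realType) (d : nat) : set 'rV[R]_d :=
  [set x : 'rV[R]_d | (forall j, 0 <= x ord0 j) /\ x != 0].
Arguments orthant_star : clear implicits.

(* The space R^d_* for d = n.+1, with the subspace topology.  The dimension is
   written n.+1 because measurable types are pointed and R^0_* is empty. *)
Definition Rstar (R : realType) (n : nat) : Type :=
  set_type (orthant_star R n.+1).

Lemma orthant_star_const1 (R : realType) (n : nat) :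
  (const_mx 1 : 'rV[R]_n.+1) \in orthant_star R n.+1.
Proof.
apply/mem_set; split=> [j|]; first by rewrite mxE.
apply/eqP => /(congr1 (fun v : 'rV[R]_n.+1 => v ord0 ord0))/eqP.
by rewrite !mxE oner_eq0.
Qed.

Lemma orthant_star_add (R : realType) (d : nat) (x y : 'rV[R]_d) :
  x \in orthant_star R d -> y \in orthant_star R d ->
  x + y \in orthant_star R d.
Proof.
move=> /set_mem[x0 xN0] /set_mem[y0 _]; apply/mem_set; split=> [j|].
  by rewrite mxE addr_ge0.
apply: contra xN0 => /eqP xy0; apply/eqP/rowP => j.
have /(congr1 (fun v : 'rV[R]_d => v ord0 j)) := xy0; rewrite !mxE => xyj0.
by apply/eqP; rewrite eq_le x0 andbT -xyj0 lerDl.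
Qed.

HB.instance Definition _ (R : realType) (n : nat) :=
  PseudoMetric.copy (Rstar R n) (set_type (orthant_star R n.+1)).
HB.instance Definition _ (R : realType) (n : nat) :=
  isPointed.Build (Rstar R n) (exist _ (const_mx 1) (orthant_star_const1 R n)).

Definition Rstar_add (R : realType) (n : nat) (x y : Rstar R n) : Rstar R n :=
  exist _ (\val x + \val y) (orthant_star_add (valP x) (valP y)).

(* The l^1-norm: the coordinates are nonnegative. *)
Definition l1norm (R : realType) (n : nat) (x : Rstar R n) : R :=
  \sum_(j < n.+1) (\val x) ord0 j.

Notation borel T := (g_sigma_algebraType (@open T)).

Section radon.
Context (R : realType) (T : ptopologicalType).
Implicit Type mu : {measure set (borel T) -> \bar R}.
Local Open Scope ereal_scope.

(* Radon measures on a locally compact Hausdorff space T, as Borel measures. *)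
Definition radon mu : Prop :=
  [/\ forall C : set T, compact C -> mu C < +oo,
      forall A : set (borel T), measurable A ->
        mu A = ereal_inf [set mu U | U in [set U : set T | open U /\ A `<=` U]]
    & forall U : set T, open U ->
        mu U = ereal_sup [set mu C | C in [set C : set T | compact C /\ C `<=` U]]].

Definition bounded_radon mu : Prop := radon mu /\ mu [set: T] < +oo.

Definition support_measure mu : set T :=
  [set x | forall U : set T, open U -> U x -> 0 < mu U].

End radon.

Definition C1_on (R : realType) (d : nat) (U : set 'rV[R]_d)
    (g : 'rV[R]_d -> R) : Prop :=
  forall x, U x ->
    differentiable g x /\ forall v, {for x, continuous ('D_v g)}.

(* R^d_* contains boundary points of the orthant: a function on it is C^1 when
   it extends to a C^1 function on an open neighbourhood of R^d_* in R^d.  The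
   support is taken, and compact, in R^d_*, hence stays away from the origin. *)
Definition C1c (R : realType) (n : nat) (phi : Rstar R n -> R) : Prop :=
  (exists U g, [/\ open U, orthant_star R n.+1 `<=` U, C1_on U g
                 & forall x, phi x = g (\val x)]) /\
  compact (closure [set x | phi x != 0]).

Definition Phi (R : realType) (p s : R) : R := s `^ (- p) * (1 - s) `^ (- p).

(* The integrals are extended-real valued and +oo - +oo = -oo, so the weak
   equation forces the outer double integral and its positive and negative
   parts to be finite. *)
Definition stationary_injection_solution (R : realType) (n : nat)
    (K : Rstar R n -> Rstar R n -> R) (gamma p : R)
    (eta f : {measure set (borel (Rstar R n)) -> \bar R}) : Prop :=
  [/\ radon f,
      support_measure f `<=` [set x | 1 <= l1norm x],
      (\int[f]_x (l1norm x `^ (gamma + p))%:E < +oo)%E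
    & forall phi : Rstar R n -> R, C1c phi ->
        (0 = 2^-1%:E *
             \int[f]_y \int[f]_x
               (K x y * (phi (Rstar_add x y) - phi x - phi y))%:E
             + \int[eta]_x (phi x)%:E)%E].

(* Main.v *)
(** The coagulation equation is discretised on the lattice points [x] of
    [2^-N N^d] with [1 <= |x| <= 2^N], where mergers leaving this range are lost.
    The unknown is the measure [h = |x|^(gamma+p) f], whose kernel
    [|x|^-(gamma+p) |y|^-(gamma+p) K(x,y)] is comparable to [(1/|x| + 1/|y|)^a]
    with [a = gamma + 2 p < 1].  The truncated system has a nonnegative stationary
    solution because a vector field on a simplex pointing inwards has a zero;
    this form of Brouwer's theorem is deduced from Scarf's combinatorial lemma
    by counting rooms and doors.

    In a stationary state the flux of mass through any size is at most the first
    moment of the source.  Any two particles with sizes in [(z/2, z]] merge into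
    one of size greater than [z], so the flux controls the square of the [h]-mass
    of this range, and this mass is [O(z^((a-1)/2))].  Summing over dyadic [z]
    bounds the mass and the tails of [h] uniformly in [N].

    To pass to the limit, each discrete measure is written as the image of Lebesgue
    measure on an interval under a quantile function.  The atoms are ordered so
    that the dyadic cells of every level are intervals of the order; after
    extraction of a diagonal subsequence, the masses preceding every cell converge
    and the quantile functions converge outside a countable set.  The weak equation
    then passes to the limit by dominated convergence, as its integrand is continuous
    and bounded for [|x|, |y| >= 1]: it vanishes when both sizes are large. *)

(* The weight in [h] turns the moment required of a solution into a total mass, so a mass bound
   uniform in N is all that this moment needs. The bound that makes the system solvable at fixed N
   rests on the minimum of the kernel over finitely many pairs; it may degenerate as N grows and
   says nothing about tails, so the flux estimate is needed besides it. The lower cut-off does no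
   harm, since sums of sizes at least 1 are again at least 1; the upper one is invisible to a test
   function supported below 2^N. Ranking the integer points of a simplex by their coordinates
   replaces a triangulation. Quantile functions live on one fixed interval and reduce the
   compactness of measures to that of numerical sequences; the double integral, quadratic in the
   unknown, then takes dominated convergence twice. What remains is tied to the form of the
   statement: the weak equation has iterated integrals against [f], so the inner one must be
   measurable, and the Borel measure found must be shown to be Radon. *)
Require Import Defs.
From HB Require Import structures.
From mathcomp Require Import finmap.
From mathcomp Require Import all_boot all_order all_algebra.
From mathcomp Require Import zify.
Set Implicit Arguments.
Unset Strict Implicit.
Unset Printing Implicit Defensive.

(** * Rooms and doors for a finite family of linear orders *)

Section dominance.
Variables (V C : finType) (key : C -> V -> nat).
Hypothesis key_inj : forall i, injective (key i).
Implicit Types (S : {set V}) (I : {set C}).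

(** No vertex lies strictly above the minimum of [S] in all the orders of [I] at once. Such pairs
    play the part of the simplices of a triangulation. *)
Definition dominant S I : bool :=
  [forall v, exists i in I, forall s in S, key i v <= key i s].

Lemma dominantP S I :
  reflect (forall v, exists2 i, i \in I & {in S, forall s, key i v <= key i s})
          (dominant S I).
Proof.
apply: (iffP forallP) => H v; have := H v.
  by move=> /exists_inP[i iI /forall_inP Hi]; exists i.
by move=> [i iI Hi]; apply/exists_inP; exists i => //; apply/forall_inP.
Qed.

Lemma dominant_sub S S' I I' :
  S' \subset S -> I \subset I' -> dominant S I -> dominant S' I'.
Proof.
move=> /fintype.subsetP S'S /fintype.subsetP II' /dominantP D; apply/dominantP => v.
by have [i iI Hi] := D v; exists i; [exact: II'|move=> s /S'S; exact: Hi].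
Qed.

Definition keymin S (i : C) (s : V) :=
  (s \in S) && [forall t in S, key i s <= key i t].

Lemma keymin_ex S i : S != set0 -> exists s, keymin S i s.
Proof.
case/set0Pn => s0 s0S; case: (arg_minnP (key i) s0S) => s sS sm.
by exists s; apply/andP; split=> //; apply/forall_inP.
Qed.

Lemma keymin_uniq S i s t : keymin S i s -> keymin S i t -> s = t.
Proof.
move=> /andP[sS /forall_inP sm] /andP[tS /forall_inP tm].
by apply: (@key_inj i); apply/eqP; rewrite eqn_leq sm// tm.
Qed.

Lemma dominant_keymin S I s : dominant S I -> s \in S ->
  exists2 i, i \in I & keymin S i s.
Proof.
move=> /dominantP /(_ s)[i iI Hi] sS; exists i => //.
by rewrite /keymin sS; apply/forall_inP.
Qed.

Lemma keymin_injP S I (a : C -> V) : dominant S I -> #|I| <= #|S| ->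
  (forall i, keymin S i (a i)) -> {in I &, injective a}.
Proof.
move=> D le_IS am; apply/imset_injP; rewrite eqn_leq leq_imset_card /=.
apply: leq_trans le_IS _; apply: subset_leq_card; apply/fintype.subsetP => s sS.
have [i iI smin] := dominant_keymin D sS.
by apply/imsetP; exists i => //; exact: keymin_uniq smin (am i).
Qed.

Definition room (r : {set V} * {set C}) := dominant r.1 r.2 && (#|r.1| == #|r.2|).

Definition adjacent (d r : {set V} * {set C}) :=
  ((r.2 == d.2) && (d.1 \subset r.1)) || ((r.1 == d.1) && (r.2 \subset d.2)).

(* A door with nonempty first component opens on exactly two rooms: two indices
   [i], [j] share their minimiser, and either one is released. *)
Lemma door_rooms S I : dominant S I -> #|I| = #|S|.+1 -> S != set0 ->
  #|[set r | room r && adjacent (S, I) r]| = 2.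
Proof.
move=> D cI S0.
pose a i := xchoose (keymin_ex i S0).
have am i : keymin S i (a i) by exact: xchooseP.
have aS i : a i \in S by case/andP: (am i).
have amin i s : s \in S -> key i (a i) <= key i s.
  by move=> sS; case/andP: (am i) => _ /forall_inP; apply.
have surj s : s \in S -> exists2 i, i \in I & s = a i.
  move=> sS; have [i iI smin] := dominant_keymin D sS.
  by exists i => //; exact: keymin_uniq smin (am i).
have [/dinjectiveP/card_in_imset aI|] := boolP (dinjectiveb a I).
  have : #|a @: I| <= #|S|.
    by apply: subset_leq_card; apply/fintype.subsetP => _ /imsetP[i _ ->].
  by rewrite aI cI ltnn.
move=> /dinjectivePn[i iI [j /andP[/= ji jI] aij]].
have surjD k s : (k == i) || (k == j) -> s \in S ->
    exists2 l, l \in I :\ k & s = a l.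
  move=> kij /surj[l lI ->]; have [lk|lk] := eqVneq l k; last first.
    by exists l => //; rewrite !inE lk.
  move: kij; rewrite -lk => /orP[]/eqP->.
    by exists j => //; rewrite !inE ji.
  by exists i => //; rewrite !inE eq_sym ji.
have surjDN k : k \in I -> (forall s, s \in S -> exists2 l, l \in I :\ k & s = a l) ->
    (k == i) || (k == j).
  move=> kI sk; apply/negPn/negP; rewrite negb_or => /andP[ki kj].
  have /imset_injP/(_ i j) : #|a @: (I :\ k)| == #|I :\ k|.
    rewrite eqn_leq leq_imset_card /=.
    have -> : #|I :\ k| = #|S| by move: cI; rewrite (cardsD1 k) kI => -[].
    apply: subset_leq_card; apply/fintype.subsetP => s /sk[l lI ->].
    exact: imset_f.
  rewrite !inE iI jI eq_sym ki eq_sym kj => /(_ isT isT aij) /eqP.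
  by rewrite eq_sym (negPf ji).
have card_D k : k \in I -> #|I :\ k| = #|S|.
  by move=> kI; move: cI; rewrite (cardsD1 k) kI => -[].
(* Once the index [k] is released, a vertex matters only if it exceeds the minimum of [S] in every
   other order of [I]. *)
pose W k := [pred v | [forall l in I :\ k, key l (a l) < key l v]].
have WP k v : reflect {in I :\ k, forall l, key l (a l) < key l v} (W k v).
  exact: forall_inP.
have WnS k v : (k == i) || (k == j) -> W k v -> v \notin S.
  move=> kij /WP Wv; apply/negP => /(surjD _ _ kij)[l lI vE].
  by have := Wv l lI; rewrite vE ltnn.
have Wlow k v s : k \in I -> W k v -> s \in S -> key k v <= key k s.
  move=> kI /WP Wv sS; have /dominantP/(_ v)[l lI lv] := D.
  have [<-|lk] := eqVneq l k; first exact: lv.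
  have /Wv : l \in I :\ k by rewrite !inE lk.
  by rewrite ltnNge lv.
(* If such vertices exist, the highest one in the order [k] joins [S]; if there is none,
   [(S, I :\ k)] is already dominant. Thus [i] and [j] yield one room each. *)
pose R k := if [pick v | W k v && [forall u, W k u ==> (key k u <= key k v)]]
            is Some v then (v |: S, I) else (S, I :\ k).
have RP k : (exists v, [/\ W k v, forall u, W k u -> key k u <= key k v &
                            R k = (v |: S, I)]) \/
            ((forall v, ~~ W k v) /\ R k = (S, I :\ k)).
  rewrite /R; case: pickP => [v /andP[Wv /forallP vm]|nW].
    by left; exists v; split=> // u Wu; have := vm u; rewrite Wu.
  right; split=> // v; apply/negP => Wv.
  case: (arg_maxnP (key k) Wv) => u Wu um.
  have := nW u; rewrite Wu /= => /negbT/forallPn[t].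
  by rewrite negb_imply => /andP[/um]; rewrite /geq /= => ->.
have Rroom k : k \in I -> (k == i) || (k == j) ->
    room (R k) && adjacent (S, I) (R k).
  move=> kI kij; have [[v [Wv vm ->]]|[nW ->]] := RP k.
    rewrite /adjacent /= eqxx finset.subsetUr /= andbT /room /=.
    apply/andP; split; last by rewrite cardsU1 (WnS k) // cI.
    apply/dominantP => u.
    have [Wu|] := boolP (W k u).
      exists k => // s; rewrite !inE => /orP[/eqP->|sS]; first exact: vm.
      exact: leq_trans (vm _ Wu) (Wlow _ _ _ kI Wv sS).
    move/forall_inPn => [l lI]; rewrite -leqNgt => ul.
    exists l; first by move: lI; rewrite !inE => /andP[].
    move=> s; rewrite !inE => /orP[/eqP->|sS].
      by apply: leq_trans ul _; apply: ltnW; move/WP: Wv; apply.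
    exact: leq_trans ul (amin _ _ sS).
  rewrite /adjacent /= eqxx subD1set orbT /= andbT /room /= card_D // eqxx andbT.
  apply/dominantP => v; have := nW v => /forall_inPn[l lI]; rewrite -leqNgt => vl.
  by exists l => // s sS; apply: leq_trans vl (amin _ _ sS).
(* Conversely, an adjacent room determines the released index: it is the one whose minimiser is the
   added vertex, or the one that was dropped. *)
have RE r : room r -> adjacent (S, I) r ->
    exists2 k, k \in I & ((k == i) || (k == j)) && (r == R k).
  case: r => S' I' /andP[/= D' /eqP c']; rewrite /adjacent /=; rewrite /= in c'.
  case/orP=> /andP[/eqP ? sub]; [subst I'|subst S'].
    have /eqP/cards1P[v vE] : #|S' :\: S| = 1.
      by rewrite cardsD (finset.setIidPr sub) c' cI subSnn.
    have S'E x : (x \in S') = (x \in S) || (x == v).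
      have [xS|xS] /= := boolP (x \in S); first exact: (fintype.subsetP sub).
      by have := in_set1 x v; rewrite -vE !inE xS.
    have vS : v \notin S by have := set11 v; rewrite -vE !inE => /andP[].
    have vS' : v \in S' by rewrite S'E eqxx orbT.
    have S'0 : S' != set0 by apply/set0Pn; exists v.
    pose b l := xchoose (keymin_ex l S'0).
    have bm l : keymin S' l (b l) by exact: xchooseP.
    have bI : {in I &, injective b} by apply: (keymin_injP D') => //; rewrite c'.
    have [k kI vk] := dominant_keymin D' vS'.
    have vb : v = b k by exact: keymin_uniq vk (bm k).
    have ba l : l \in I -> l != k -> b l = a l.
      move=> lI lk; have /andP[blS' /forall_inP blm] := bm l.
      apply: (@keymin_uniq S l) => //; apply/andP; split.
        move: blS'; rewrite S'E => /orP[//|/eqP]; rewrite vb => /bI.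
        by move=> /(_ lI kI) /eqP; rewrite (negPf lk).
      by apply/forall_inP => t tS; apply: blm; rewrite S'E tS.
    have Wv : W k v.
      apply/WP => l; rewrite !inE => /andP[lk lI]; rewrite -ba //.
      have /andP[_ /forall_inP/(_ v vS')] := bm l.
      rewrite leq_eqVlt => /orP[/eqP /key_inj|//] bv.
      by move: vS; rewrite -bv ba // aS.
    have kij : (k == i) || (k == j).
      apply: surjDN => // s sS.
      have [|l lI sl] := @dominant_keymin _ _ s D'; first by rewrite S'E sS.
      have sb : s = b l by exact: keymin_uniq sl (bm l).
      have lk : l != k.
        by apply: contra vS => /eqP lk; rewrite vb -lk -sb.
      by exists l; [rewrite !inE lk|rewrite sb ba].
    exists k => //; rewrite kij /=.
    have [[u [Wu um ->]]|[/(_ v)]] := RP k; last by rewrite Wv.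
    apply/eqP; congr (_, _); suff -> : u = v.
      by apply/setP => x; rewrite S'E !inE orbC.
    apply: (@key_inj k); apply/eqP; rewrite eqn_leq um // andbT.
    have /dominantP/(_ u)[l lI lu] := D'.
    have [lk|lk] := eqVneq l k; first by rewrite -lk; exact: lu.
    have /(WP _ _ Wu) : l \in I :\ k by rewrite !inE lk.
    by rewrite ltnNge lu // S'E aS.
  have /eqP/cards1P[k kE] : #|I :\: I'| = 1.
    by rewrite cardsD (finset.setIidPr sub) -c' cI subSnn.
  have /setDP[kI kI'] : k \in I :\: I' by rewrite kE set11.
  have I'E : I' = I :\ k.
    apply/setP => x; rewrite !inE.
    have := in_set1 x k; rewrite -kE !inE => <-.
    by case: (boolP (x \in I')) => //= [/(fintype.subsetP sub)|_]; case: (x \in I).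
  have kij : (k == i) || (k == j).
    apply: surjDN => // s sS; have [l lI' sl] := dominant_keymin D' sS.
    by exists l; [rewrite -I'E|exact: keymin_uniq sl (am l)].
  exists k => //; rewrite kij /=.
  have [[v [/WP Wv _ _]]|[_ ->]] := RP k; last by rewrite I'E.
  have /dominantP/(_ v)[l] := D'.
  by rewrite I'E => /Wv lv /(_ _ (aS l)); rewrite leqNgt lv.
have -> : [set r | room r && adjacent (S, I) r] = [set R i; R j].
  apply/setP => r; rewrite !inE; apply/idP/idP.
    by move=> /andP[/RE H /H[k _ /andP[/orP[]/eqP-> ->]]]; rewrite ?orbT.
  by case/orP => /eqP->; apply: Rroom; rewrite ?eqxx ?orbT.
rewrite cards2; suff -> : R i != R j by [].
have [[v [/WP Wv _ Riv]]|[_ Ri]] := RP i; have [[u [Wu _ ->]]|[_ Rj]] := RP j.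
- rewrite Riv; apply/eqP => -[E]; have vu : v = u.
    have : v \in u |: S by rewrite -E !inE eqxx.
    rewrite !inE => /orP[/eqP//|vS].
    have : W i v by apply/WP.
    by move=> /WnS; rewrite eqxx vS => /(_ isT).
  have /dominantP/(_ v)[l lI lv] := D.
  have [li|li] := eqVneq l i; last first.
    by have := Wv l; rewrite !inE li lI => /(_ isT); rewrite ltnNge lv // aS.
  move/WP: Wu => /(_ l); rewrite !inE lI li eq_sym ji => /(_ isT).
  by rewrite -vu ltnNge -li lv // aS.
- by rewrite Riv Rj; apply/eqP => -[_ E]; have := jI; rewrite E !inE eqxx.
- by rewrite Ri; apply/eqP => -[_ E]; have := iI; rewrite -E !inE eqxx.
- rewrite Ri Rj; apply/eqP => -[E]; have : j \in I :\ i by rewrite !inE ji.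
  by rewrite E !inE eqxx.
Qed.

(** A single vertex is dominant for [[set m]] only if it is the greatest in the order [m], and the
    empty pair is not dominant because [v0] exists. *)
Lemma door0_rooms m (v0 : V) :
  #|[set r | room r && adjacent (set0, [set m]) r]| = 1.
Proof.
case: (arg_maxnP (key m) (isT : predT v0)) => v _ vm.
apply/eqP/cards1P; exists ([set v], [set m]); apply/setP => -[S I].
rewrite !inE; apply/idP/idP; last first.
  move=> /eqP[-> ->]; rewrite /room /adjacent /= eqxx sub0set !cards1 eqxx !andbT.
  apply/dominantP => u; exists m; first exact: set11.
  by move=> s /set1P->; exact: vm.
rewrite /room /adjacent /= -andbA => /and3P[D /eqP cE].
case/orP => /andP[/eqP ? sub].
  subst I; move: cE; rewrite cards1 => /eqP/cards1P[s ?]; subst S.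
  have /dominantP/(_ v)[i /set1P-> /(_ s (set11 s)) vs] := D.
  suff -> : s = v by [].
  by apply: (@key_inj m); apply/eqP; rewrite eqn_leq vs andbT; exact: vm.
subst S; move: cE; rewrite cards0 => /esym/eqP; rewrite cards_eq0 => /eqP I0.
by have /dominantP/(_ v0)[i] := D; rewrite I0 inE.
Qed.

(** * Parity of the number of fully coloured rooms *)

Section colouring.
Variables (c : V -> C) (m : C).

(** The condition on cardinals makes [c] injective on the vertices, so each index other than [m] is
    the colour of exactly one vertex. *)
Definition good_door (d : {set V} * {set C}) :=
  [&& dominant d.1 d.2, m \in d.2, c @: d.1 == d.2 :\ m & #|d.2| == #|d.1|.+1].

Lemma good_adjacentP S I d : room (S, I) ->
  reflect ((exists s, [/\ s \in S, m \in I, c @: (S :\ s) = I :\ m & d = (S :\ s, I)]) \/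
           (exists k, [/\ k \notin I, m \in k |: I, c @: S = (k |: I) :\ m & d = (S, k |: I)]))
          (good_door d && adjacent d (S, I)).
Proof.
case: d => T J /andP[/= D /eqP cSI]; rewrite /good_door /adjacent /=; apply: (iffP idP).
  move=> /andP[/and4P[DT mJ /eqP cT /eqP cJ] /orP[]/andP[/eqP ? sub]]; [subst J|subst T].
    have /eqP/cards1P[s sE] : #|S :\: T| = 1.
      by rewrite cardsD (finset.setIidPr sub) cSI cJ subSnn.
    have /setDP[sS sT] : s \in S :\: T by rewrite sE set11.
    have TE : T = S :\ s.
      apply/setP => x; rewrite !inE.
      have := in_set1 x s; rewrite -sE !inE => <-.
      by case: (boolP (x \in T)) => //= [/(fintype.subsetP sub)|_]; case: (x \in S).
    by left; exists s; rewrite -TE.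
  have /eqP/cards1P[k kE] : #|J :\: I| = 1.
    by rewrite cardsD (finset.setIidPr sub) cJ -cSI subSnn.
  have /setDP[kJ kI] : k \in J :\: I by rewrite kE set11.
  have JE : J = k |: I.
    apply/setP => x; rewrite !inE.
    have := in_set1 x k; rewrite -kE !inE => <-.
    by case: (boolP (x \in I)) => [/(fintype.subsetP sub) ->|_]; rewrite ?orbT ?orbF.
  by right; exists k; rewrite -JE.
case=> [[s [sS mI cS [-> ->]]]|[k [kI mI cS [-> ->]]]].
  rewrite (dominant_sub _ _ D) ?subD1set // mI cS !eqxx ?orbT ?andbT /=.
  by rewrite -cSI (cardsD1 s S) sS.
rewrite (dominant_sub _ _ D) ?finset.subsetUr // mI cS !eqxx ?orbT ?andbT /=.
by rewrite cardsU1 kI -cSI.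
Qed.

(** A fully coloured room has one good door. Any other room has none or two: two arise from a pair
    of vertices of the same colour, or from a colour [k] outside [I], whose vertex can be deleted or
    which can be adjoined to the indices. *)
Lemma room_doors S I : room (S, I) ->
  odd #|[set d | good_door d && adjacent d (S, I)]| = (c @: S == I).
Proof.
move=> rSI; have /andP[/= D /eqP cSI] := rSI.
have inD d := good_adjacentP d rSI.
have [mI|mI] := boolP (m \in I); last first.
  have [cI|cI] := eqVneq (c @: S) I.
    rewrite (_ : [set d | _] = [set (S, m |: I)]) ?cards1 //.
    apply/setP => d; rewrite !inE; apply/inD/eqP => [[[s []]|[k [kI + _ ->]]]|->].
    - by rewrite (negPf mI).
    - by rewrite !inE (negPf mI) orbF => /eqP->.
    - right; exists m; split; rewrite ?setU11 // cI.
      apply/setP => x; rewrite !inE.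
      by have [->|] := eqVneq x m; rewrite ?(negPf mI).
  rewrite (_ : [set d | _] = set0) ?cards0 //.
  apply/setP => d; rewrite !inE; apply/inD => -[[s []]|[k [kI + cS _]]].
    by rewrite (negPf mI).
  rewrite !inE (negPf mI) orbF => /eqP mk; subst k.
  case/negP: cI; apply/eqP; rewrite cS.
  apply/setP => x; rewrite !inE.
  by have [->|] := eqVneq x m; rewrite ?(negPf mI).
have cU s : s \in S -> c @: S = c s |: c @: (S :\ s).
  by move=> sS; rewrite -{1}(setD1K sS) imsetU1.
have cinj : #|c @: S| = #|S| -> {in S &, injective c}.
  by move=> /eqP/imset_injP.
have uniq_s k s : k \in c @: S -> {in S &, injective c} -> s \in S -> c s = k ->
    c @: (S :\ s) = c @: S :\ k.
  move=> _ cI sS <-; apply/setP => x; rewrite !inE; apply/imsetP/andP.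
    move=> [t]; rewrite !inE => /andP[ts tS] ->; split; last exact: imset_f.
    by apply: contra ts => /eqP /cI ->.
  move=> [xs /imsetP[t tS xE]]; exists t => //; rewrite !inE tS andbT.
  by apply: contra xs => /eqP <-; rewrite xE.
have [cI|cI] := eqVneq (c @: S) I.
  have ci : {in S &, injective c} by apply: cinj; rewrite cI.
  have /imsetP[s sS ms] : m \in c @: S by rewrite cI.
  rewrite (_ : [set d | _] = [set (S :\ s, I)]) ?cards1 //.
  apply/setP => d; rewrite !inE; apply/inD/eqP => [[[t [tS _ ct ->]]|[k [kI _ + _]]]|->].
  - suff -> : s = t by [].
    apply/eqP/negPn/negP => st; have : m \in c @: (S :\ t).
      by rewrite ms; apply: imset_f; rewrite !inE st.
    by rewrite ct !inE eqxx.
  - by move=> cS; have := mI; rewrite -cI cS !inE eqxx.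
  - by left; exists s; split; rewrite // (uniq_s m) // ?cI.
have [cm|cm] := eqVneq (c @: S) (I :\ m).
  have [/dinjectiveP/card_in_imset|] := boolP (dinjectiveb c S).
    rewrite cm cSI (cardsD1 m I) mI add1n.
    by move=> /n_Sn.
  move=> /dinjectivePn[s sS [t /andP[/= ts tS] cst]].
  have surj u : (u == s) || (u == t) -> c @: (S :\ u) = c @: S.
    move=> ust; apply/setP => x; apply/imsetP/imsetP => -[y].
      by rewrite !inE => /andP[_ yS] ->; exists y.
    move=> yS ->; have [yu|yu] := eqVneq y u; last by exists y; rewrite // !inE yu.
    move: ust; rewrite -yu => /orP[]/eqP->.
      by exists t; rewrite // !inE ts.
    by exists s; rewrite // !inE eq_sym ts.
  rewrite (_ : [set d | _] = [set (S :\ s, I); (S :\ t, I)]).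
    rewrite cards2; suff -> : (S :\ s, I) != (S :\ t, I) by [].
    apply/eqP => -[E]; have : t \in S :\ s by rewrite !inE ts.
    by rewrite E !inE eqxx.
  apply/setP => d; rewrite !inE; apply/inD/orP => [[[u [uS _ cu ->]]|[k [kI _ + _]]]|].
  - have /orP[/eqP->|/eqP->] : (u == s) || (u == t); [|by left|by right].
    apply/negPn/negP; rewrite negb_or => /andP[us ut].
    have /imset_injP/(_ s t) : #|c @: (S :\ u)| == #|S :\ u|.
      rewrite cu; move: cSI; rewrite (cardsD1 u S) uS (cardsD1 m I) mI !add1n => -[->].
      exact: eqxx.
    rewrite !inE sS tS eq_sym us eq_sym ut => /(_ isT isT cst) /eqP.
    by rewrite eq_sym (negPf ts).
  - rewrite cm => /setP/(_ k); rewrite !inE eqxx (negPf kI) andbF andbT.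
    by move=> /esym/negbFE/eqP km; move: kI; rewrite km mI.
  - by case=> /eqP->; left; [exists s|exists t]; rewrite surj // eqxx ?orbT.
have [/existsP[k /andP[kI /eqP ck]]|nk] := boolP [exists k, (k \notin I) && (c @: S == (k |: I) :\ m)].
  have km : k != m by apply: contra kI => /eqP->.
  have ci : {in S &, injective c}.
    apply: cinj; rewrite ck cSI; have := cardsU1 k I; rewrite kI (cardsD1 m (k |: I)).
    by rewrite !inE mI orbT !add1n => -[->].
  have kS : k \in c @: S by rewrite ck !inE km eqxx.
  have /imsetP[s sS ks] := kS.
  have cs : c @: (S :\ s) = I :\ m.
    rewrite (uniq_s k) // ck; apply/setP => x; rewrite !inE.
    by have [->|] := eqVneq x k; rewrite ?(negPf kI) ?andbF.
  rewrite (_ : [set d | _] = [set (S :\ s, I); (S, k |: I)]).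
    rewrite cards2; suff -> : (S :\ s, I) != (S, k |: I) by [].
    apply/eqP => -[E _]; have := sS; rewrite -E.
    by rewrite !inE eqxx.
  apply/setP => d; rewrite !inE; apply/inD/orP => [[[u [uS _ cu ->]]|[l [lI _ + ->]]]|].
  - left; suff -> : u = s by [].
    apply/eqP/negPn/negP => us; have : k \in c @: (S :\ u).
      by rewrite ks; apply: imset_f; rewrite !inE eq_sym us.
    by rewrite cu !inE (negPf kI) andbF.
  - rewrite ck => /setP/(_ k); rewrite !inE km eqxx (negPf kI) orbF /=.
    by move=> kl; right; have /eqP-> : l == k by move: kl; rewrite eq_sym; case: eqP.
  - by case=> /eqP->; [left; exists s|right; exists k; rewrite !inE mI orbT].
rewrite (_ : [set d | _] = set0) ?cards0 //.
apply/setP => d; rewrite !inE; apply/inD => -[[s [sS _ cs _]]|[k [kI _ cS _]]]; last first.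
  by case/negP: nk; apply/existsP; exists k; rewrite kI cS eqxx.
have := cU s sS; rewrite cs; have [csm|csm] := eqVneq (c s) m.
  by rewrite csm setD1K //; move/eqP; rewrite (negPf cI).
have [csI|csI] := boolP (c s \in I).
  move/eqP; rewrite [_ |: _](_ : _ = I :\ m) ?(negPf cm) //.
  apply/setP => x; rewrite !inE; have [->|] := eqVneq x (c s) => //=.
  by rewrite csm csI.
move=> E; case/negP: nk; apply/existsP; exists (c s); rewrite csI /= E.
apply/eqP/setP => x; rewrite !inE; have [->|] := eqVneq x (c s) => //=.
by rewrite csm.
Qed.

(* Counting the incidences between rooms and good doors modulo 2: only the door
   [(set0, [set m])] is incident to an odd number of rooms, so the number of
   fully coloured rooms is odd. *)
Lemma rainbow_dominant (v0 : V) :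
  exists S I, [/\ dominant S I, #|S| = #|I| & c @: S = I].
Proof.
have [[S I] /andP[rSI /eqP cSI]|nex] := pickP (fun r => room r && (c @: r.1 == r.2)).
  by exists S, I; case/andP: rSI => D /eqP.
have E : \sum_(r | room r) #|[set d | good_door d && adjacent d r]| =
         \sum_(d | good_door d) #|[set r | room r && adjacent d r]|.
  transitivity (\sum_(r | room r) \sum_(d | good_door d) adjacent d r).
    apply: eq_bigr => r _; rewrite -sum1_card [LHS]big_mkcond [RHS]big_mkcond /=.
    apply: eq_bigr => d _; rewrite !inE.
    by case: (good_door d) => //=; case: (adjacent d r).
  rewrite exchange_big /=; apply: eq_bigr => d _.
  rewrite -sum1_card [LHS]big_mkcond [RHS]big_mkcond /=.
  apply: eq_bigr => r _; rewrite !inE.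
  by case: (room r) => //=; case: (adjacent d r).
have good0 : good_door (set0, [set m]).
  rewrite /good_door /= set11 cards0 cards1 imset0 setDv !eqxx !andbT /=.
  by apply/dominantP => v; exists m; rewrite ?set11 // => s; rewrite inE.
have := congr1 odd E; rewrite (bigD1 _ good0) /= door0_rooms // oddD.
rewrite [X in X = _ -> _](_ : _ = false); last first.
  elim/big_ind: _ => // [x y|[S I] rSI]; first by rewrite oddD => -> ->.
  by rewrite room_doors //; have := nex (S, I); rewrite /= rSI.
(* Every other good door has a vertex, hence two rooms, so the rest of the sum is even. *)
rewrite [odd (\sum_(_ | _) _)](_ : _ = false) //.
elim/big_ind: _ => // [x y|[S I]]; first by rewrite oddD => -> ->.
rewrite /good_door /= => /andP[/and4P[D mI /eqP cS /eqP cI] ne].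
rewrite door_rooms //; apply: contra ne => /eqP S0; move: cI cS.
rewrite S0 cards0 imset0 => _ /esym/eqP; rewrite setD_eq0 => I1.
by apply/eqP; congr (_, _); apply/eqP; rewrite finset.eqEsubset I1 sub1set.
Qed.

End colouring.

End dominance.

(** * The combinatorial lemma on the integer points of a simplex *)

Definition grid (n m : nat) : finType :=
  {k : {ffun 'I_n.+1 -> 'I_m.+1} | \sum_i k i == m :> nat}.

(** A dominant set of grid points is small: the least coordinates [l i] over [I] nearly add up to
    [m], so the coordinates in [I] vary by at most [n.+1] over [S] and the others are at most
    [n.+1]. A colour outside [I] meets the first alternative, a colour in [I] the second. *)
Lemma grid_rainbow (n m : nat) (c : grid n m -> 'I_n.+1) :
  exists s : grid n m, forall i, val s i <= n.+1 \/ exists t,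
    c t = i /\ forall j, val t j <= val s j + n.+1 /\ val s j <= val t j + n.+1.
Proof.
set V : finType := grid n m in c *.
pose mk (w : {ffun 'I_n.+1 -> 'I_m.+1}) (wm : \sum_i w i == m :> nat) : V :=
  exist (fun k : {ffun 'I_n.+1 -> 'I_m.+1} => \sum_i k i == m :> nat) w wm.
(* Rank by the [i]-th coordinate, ties being broken arbitrarily. *)
pose key (i : 'I_n.+1) (k : V) := val k i * #|V| + enum_rank k.
have key_lt i (k l : V) : val k i < val l i -> key i k < key i l.
  move=> kl; apply: leq_trans (leq_addr _ _).
  apply: (@leq_trans ((val k i).+1 * #|V|)); last by rewrite leq_mul2r kl orbT.
  by rewrite mulSn [leqRHS]addnC /key ltn_add2l ltn_ord.
have key_inj i : injective (key i).
  move=> k l kl; have [/key_lt|/key_lt|kl'] := ltngtP (val k i) (val l i).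
  - by rewrite kl ltnn.
  - by rewrite kl ltnn.
  - move: kl; rewrite /key kl' => /eqP; rewrite eqn_add2l => /eqP /val_inj.
    exact: enum_rank_inj.
have v0P : \sum_i [ffun i : 'I_n.+1 => if i == ord0 then ord_max else ord0 : 'I_m.+1] i == m :> nat.
  rewrite (bigD1 ord0) //= ffunE eqxx big1 ?addn0 // => i /negPf i0.
  by rewrite ffunE i0.
have [S [I [/dominantP D cSI cS]]] := rainbow_dominant key_inj c ord0 (mk _ v0P).
have [i0 i0I _] := D (mk _ v0P).
have S0 : S != set0.
  by rewrite -card_gt0 cSI; apply/card_gt0P; exists i0.
have /set0Pn[s0 s0S] := S0.
have lo i : {s : V | s \in S & forall t, t \in S -> val s i <= val t i}.
  case: (@arg_minnP _ s0 (mem S) (fun s : V => (val s i : nat)) s0S) => s sS sm.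
  by exists s.
pose l i : nat := val (s2val (lo i)) i.
have lP i t : t \in S -> l i <= val t i by move=> tS; rewrite /l; case: (lo i) => /= s _; apply.
(* Otherwise, raising every [l i] by one and giving the surplus to [i0] produces a grid point
   strictly above the minimum of [S] in each order of [I]. *)
have big : m < \sum_(i in I) (l i).+1.
  rewrite ltnNge; apply/negP => le_m.
  pose u i : nat := (if i \in I then (l i).+1 else 0) +
    (if i == i0 then m - \sum_(i in I) (l i).+1 else 0).
  have usum : \sum_i u i = m.
    rewrite big_split /= -big_mkcond /= -big_mkcond /= big_pred1_eq.
    by rewrite subnKC.
  have um i : u i < m.+1 by rewrite ltnS -usum (bigD1 i) //= leq_addr.
  pose w := [ffun i => Ordinal (um i)].
  have wP : \sum_i w i == m :> nat.
    by rewrite -[X in _ == X]usum; apply/eqP/eq_bigr => i _; rewrite ffunE.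
  have [i iI] := D (mk w wP).
  case: (lo i) (erefl (l i)) => s sS sm; rewrite {1}/l.
  case: (lo i) => s' /= s'S s'm ls /(_ s' s'S).
  rewrite leqNgt => /negP[]; apply: key_lt; rewrite /= ffunE /= /u iI.
  have : val s' i = l i :> nat.
    apply/eqP; rewrite eqn_leq (lP _ _ s'S) andbT.
    by rewrite /l; case: (lo i) => /= r rS _; exact: s'm.
  lia.
pose g (s : V) i : nat := val s i.
have cI : #|I| <= n.+1 by rewrite -[X in _ <= X]card_ord max_card.
have bigI : m < \sum_(i in I) l i + n.+1.
  apply: leq_trans big _; rewrite (eq_bigr (fun i => l i + 1)); last by move=> i _; rewrite addn1.
  by rewrite big_split /= sum1_card leq_add2l.
have sum_le (s : V) : s \in S -> \sum_(i in I) l i <= \sum_(i in I) g s i.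
  by move=> sS; apply: leq_sum => i _; exact: lP.
have sE (s : V) : (\sum_(i in I) g s i + \sum_(i | i \notin I) g s i = m)%N.
  by rewrite -[RHS](eqP (valP s)) [in RHS](bigID (mem I)).
have inI (s : V) i : s \in S -> i \in I -> g s i <= l i + n.+1.
  move=> sS iI; have := sE s; rewrite (bigD1 i) //=; have := bigI; rewrite (bigD1 i) //=.
  have : \sum_(j in I | j != i) l j <= \sum_(j in I | j != i) g s j.
    by apply: leq_sum => j _; exact: lP.
  set A := \sum_(j in I | j != i) l j; set B := \sum_(j in I | j != i) g s j.
  by set E := \sum_(j | j \notin I) g s j; lia.
have outI (s : V) i : s \in S -> i \notin I -> g s i <= n.+1.
  move=> sS iI; have := sE s; rewrite [X in (_ + X)%N](bigD1 i) //=.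
  have := sum_le s sS; move: bigI.
  set A := \sum_(j in I) l j; set B := \sum_(j in I) g s j.
  by set E := \sum_(j | _) g s j; lia.
exists s0 => i; have [iI|iI] := boolP (i \in I); last by left; exact: outI.
right; move: iI; rewrite -cS => /imsetP[t tS ->]; exists t; split=> // j.
have [jI|jI] := boolP (j \in I); last by split; apply: leq_trans (outI _ _ _ jI) _ => //; rewrite leq_addl.
by split; apply: leq_trans (inI _ _ _ jI) _ => //; rewrite leq_add2r lP.
Qed.

From mathcomp Require Import all_classical all_reals all_analysis.
From mathcomp Require Import measurable_realfun.
From mathcomp Require Import ring lra.
Import Order.TTheory GRing.Theory Num.Theory.
Import numFieldNormedType.Exports.
Local Open Scope classical_set_scope.
Local Open Scope ring_scope.

(** * Zeros of continuous fields on the simplex *)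

Definition simplex (R : realType) (n : nat) : set 'rV[R]_n.+1 :=
  [set x | (forall i, 0 <= x ord0 i) /\ \sum_i x ord0 i = 1].

(** Each grid point is coloured by a component of [v] that is nonnegative there; one exists because
    the sum is nonnegative. *)
Lemma simplex_approx (R : realType) (n : nat) (v : 'rV[R]_n.+1 -> 'I_n.+1 -> R) :
  (forall x, simplex x -> 0 <= \sum_i v x i) -> forall m : nat,
  exists2 x, simplex x & forall i, x ord0 i <= n.+1%:R / m.+1%:R \/
    exists y, [/\ simplex y, 0 <= v y i &
                 forall j, `|x ord0 j - y ord0 j| <= n.+1%:R / m.+1%:R].
Proof.
move=> v0 m.
pose pt (k : grid n m.+1) : 'rV[R]_n.+1 := \row_i ((val k i)%:R / m.+1%:R).
have ptP k : simplex (pt k).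
  split=> [i|]; first by rewrite mxE divr_ge0.
  under eq_bigr do rewrite mxE.
  by rewrite -mulr_suml -natr_sum (eqP (valP k)) divff.
have col k : {i | 0 <= v (pt k) i}.
  apply/cid; apply: contrapT => /forallNP nv.
  have := v0 _ (ptP k); apply/negP; rewrite -ltNge.
  rewrite big_ord_recl ltr_wnDr //; last first.
    by rewrite ltNge; apply/negP/nv.
  by apply: sumr_le0 => i _; rewrite leNgt; apply/negP => /ltW /nv.
have [s sP] := grid_rainbow (fun k => sval (col k)).
exists (pt s) => // i; have [si|[t [ti tj]]] := sP i; [left|right].
  by rewrite mxE ler_pM2r ?invr_gt0 // ler_nat.
exists (pt t); split=> //; first by rewrite -ti; exact: svalP (col t).
move=> j; rewrite !mxE -mulrBl normrM [X in _ * X]ger0_norm ?invr_ge0 //.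
rewrite ler_pM2r ?invr_gt0 // ler_norml; have [] := tj j.
by rewrite -!(ler_nat R) !natrD => A B; apply/andP; split; lra.
Qed.

Lemma continuous_sum (R : realType) (T : topologicalType) (I : finType)
    (F : I -> T -> R) :
  (forall i, continuous (F i)) -> continuous (fun x => \sum_i F i x).
Proof.
move=> Fc; have := @continuous_big R I +%R 0 xpredT _ T (index_enum I) F.
by apply=> [|i _]; [exact: add_continuous|exact: Fc].
Qed.

Lemma simplex_compact (R : realType) (n : nat) : compact (@simplex R n).
Proof.
have cube : compact [set v : 'rV[R]_n.+1 | forall i, `[0, 1]%classic (v ord0 i)].
  by apply: (@rV_compact R n.+1 (fun=> `[0 : R, 1]%classic)) => _; exact: segment_compact.
apply: (subclosed_compact _ cube) => [|x [x0 x1] i]; last first.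
  rewrite /= in_itv /= x0 /= -x1 (bigD1 i) //= lerDl.
  exact: sumr_ge0.
have -> : simplex (R := R) (n := n) =
  (\bigcap_i ((fun x : 'rV[R]_n.+1 => x ord0 i) @^-1` [set t | 0 <= t])) `&`
  ((fun x : 'rV[R]_n.+1 => \sum_i x ord0 i) @^-1` [set 1]).
  apply/seteqP; split=> [x [x0 x1]|x [x0 x1]]; first by split=> // i _; exact: x0.
  by split=> // i; exact: x0.
apply: closedI.
  apply: closed_bigI => i _; apply: preimage_closed; first by move=> x _; exact: coord_continuous.
  exact: closed_ge.
apply: preimage_closed; last exact: closed_eq. 
move=> x _; apply: continuous_sum => i; exact: coord_continuous.
Qed.

(** At a cluster point of the approximations no component is negative: by the boundary condition its
    coordinate would be positive, and continuity would contradict both alternatives of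
    [simplex_approx]. Zero sum then forces all components to vanish. *)
Theorem simplex_zero (R : realType) (n : nat) (v : 'rV[R]_n.+1 -> 'I_n.+1 -> R) :
  (forall i, continuous (v ^~ i)) ->
  (forall x, simplex x -> \sum_i v x i = 0) ->
  (forall x i, simplex x -> x ord0 i = 0 -> 0 <= v x i) ->
  exists2 x, simplex x & forall i, v x i = 0.
Proof.
move=> vc v0 vb.
have ap m : {x | simplex x & forall i, x ord0 i <= n.+1%:R / m.+1%:R \/
    exists y, [/\ simplex y, 0 <= v y i &
                 forall j, `|x ord0 j - y ord0 j| <= n.+1%:R / m.+1%:R]}.
  by apply/cid2/simplex_approx => x /v0 ->.
pose x m := s2val (ap m).
have [p [pS pc]] : (@simplex R n) `&` cluster (x @ \oo) !=set0.
  apply: (@simplex_compact R n (x @ \oo) _).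
  by exists 0%N => // m _ /=; rewrite /x; case: (ap m).
have vp i : 0 <= v p i.
  rewrite leNgt; apply/negP => vi.
  have pi : 0 < p ord0 i.
    rewrite lt_def (proj1 pS) andbT; apply: contraTneq vi => pi.
    by rewrite -leNgt; exact: vb.
  have : nbhs p [set y | v y i < 0].
    by apply: (vc i p [set t | t < 0]); exact: lt_nbhsl.
  move=> /nbhs_ballP[d /= d0 dP].
  (* [d / 2] keeps the witness near the approximation inside the ball where component [i] is
     negative; [p ord0 i / 2] keeps coordinate [i] of the approximation above [e]. *)
  pose e := Num.min (d / 2) (p ord0 i / 2).
  have e0 : 0 < e by rewrite lt_min !divr_gt0.
  have [N _ NP] : \forall m \near \oo, n.+1%:R / m.+1%:R < e.
    near=> m; rewrite ltr_pdivrMr // -ltr_pdivrMl // mulrC.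
    apply: (@lt_trans _ _ m%:R); last by rewrite ltr_nat.
    by near: m; exact: nbhs_infty_gtr.
  have [y [[m /= Nm <-] [_ ye]]] : (x @` [set m | (N <= m)%N]) `&` ball p e !=set0.
    apply: pc; last exact: nbhsx_ballx.
    by exists N => // m /= Nm; exists m.
  have := ye ord0 i; rewrite /ball /= => yi.
  have me := NP _ Nm; rewrite /= in me.
  have [ed ep] : e <= d / 2 /\ e <= p ord0 i / 2 by rewrite /e !ge_min !lexx orbT.
  move: ye; rewrite /x; case: (ap m) => /= z zS /(_ i)[zi|[u [uS vu zu]]] ye.
    have := ye ord0 i; rewrite /ball /= ltr_norml => /andP[_].
    by move: (le_lt_trans zi me) ep; clear; move: e => e; lra.
  have : ball p d u.
    split=> // k j; rewrite (ord1 k) /ball /=.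
    have := ye ord0 j; rewrite /ball /= => yj; have := zu j => zj.
    have := ler_distD (z ord0 j) (p ord0 j) (u ord0 j).
    by move: (le_lt_trans zj me) ed yj; clear; move: e => e; lra.
  by move=> /dP /=; rewrite ltNge vu.
exists p => // i; apply/eqP; rewrite eq_le vp andbT.
have := v0 _ pS; rewrite (bigD1 i) //= => /eqP.
rewrite addr_eq0 => /eqP ->; rewrite oppr_le0.
exact: sumr_ge0.
Unshelve. all: by end_near.
Qed.

(** * Stationary states of finite coagulation systems *)

Lemma continuous_mul (R : realType) (T : topologicalType) (f g : T -> R) :
  continuous f -> continuous g -> continuous (fun x => f x * g x).
Proof. by move=> fc gc x; apply: cvgM; [exact: fc|exact: gc]. Qed.

Lemma continuous_add (R : realType) (T : topologicalType) (f g : T -> R) :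
  continuous f -> continuous g -> continuous (fun x => f x + g x).
Proof. by move=> fc gc x; apply: cvgD; [exact: fc|exact: gc]. Qed.

Lemma continuous_sub (R : realType) (T : topologicalType) (f g : T -> R) :
  continuous f -> continuous g -> continuous (fun x => f x - g x).
Proof. by move=> fc gc x; apply: cvgB; [exact: fc|exact: gc]. Qed.

Lemma finite_stationary (R : realType) (I : finType) (K : I -> I -> R)
    (s : I -> I -> option I) (eta : I -> R) :
  (forall i j, 0 < K i j) -> (forall i, 0 <= eta i) ->
  exists2 f : I -> R, forall i, 0 <= f i & forall i,
    f i * (\sum_j K i j * f j) =
    2^-1 * (\sum_j \sum_(k | s j k == Some i) K j k * f j * f k) + eta i.
Proof.
move=> K0 eta0.
have [k0 k00 k0K] : exists2 k0, 0 < k0 & forall i j, k0 <= K i j.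
  exists (\big[Num.min/1]_(p : I * I) K p.1 p.2).
    by elim/big_ind: _ => // x y x0 y0; rewrite lt_min x0 y0.
  by move=> i j; exact: (bigmin_inf (i, j)).
pose T := \sum_i eta i.
have T0 : 0 <= T by exact: sumr_ge0.
(* Chosen so that half of [k0 * B ^+ 2] is at least the total source [T]; the summand 1 lets
   [B ^+ 2] dominate [B - 1]. *)
pose B := 1 + 2 * T / k0.
have B1 : 1 <= B by rewrite lerDl divr_ge0 ?mulr_ge0 // ltW.
have B0 : 0 < B by exact: lt_le_trans B1.
have TB : T <= 2^-1 * k0 * B ^+ 2.
  have : T = 2^-1 * k0 * (B - 1) by rewrite /B; field; rewrite gt_eqF.
  move=> ->; rewrite -mulrA -[leRHS]mulrA ler_pM2l // ler_pM2l //; nra.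
(* [f] is [B] times a point of the simplex without its coordinate [ord0], which is
   a slack: when it vanishes, the loss, at least [k0 B^2], exceeds gain and source. *)
pose gain (f : I -> R) i := 2^-1 * (\sum_j \sum_(k | s j k == Some i) K j k * f j * f k).
pose loss (f : I -> R) i := f i * (\sum_j K i j * f j).
pose b f i := gain f i + eta i - loss f i.
pose g (x : 'rV[R]_(#|I|.+1)) i := B * x ord0 (lift ord0 (enum_rank i)).
pose v (x : 'rV[R]_(#|I|.+1)) (j : 'I_(#|I|.+1)) := oapp (fun r : 'I_#|I| => b (g x) (enum_val r)) (- \sum_i b (g x) i) (unlift ord0 j).
have gc i : continuous (g ^~ i).
  rewrite /g; apply: continuous_mul; first exact: cst_continuous.
  by move=> x; exact: coord_continuous.
have bc i : continuous (fun x => b (g x) i).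
  have gainc : continuous (fun x => \sum_j \sum_(k | s j k == Some i) K j k * g x j * g x k).
    apply: continuous_sum => j.
    under eq_fun do rewrite big_mkcond.
    apply: continuous_sum => k; case: (s j k == Some i); last exact: cst_continuous.
    by do 2 (apply: continuous_mul => //); exact: cst_continuous.
  have lossc : continuous (fun x => \sum_j K i j * g x j).
    by apply: continuous_sum => j; apply: continuous_mul => //; exact: cst_continuous.
  rewrite /b /gain /loss; apply: continuous_sub; last exact: continuous_mul.
  apply: continuous_add; last exact: cst_continuous.
  by apply: continuous_mul => //; exact: cst_continuous.
have g0 x i : simplex x -> 0 <= g x i by move=> [x0 _]; rewrite mulr_ge0 // ltW.
have Kg0 x j k : simplex x -> 0 <= K j k * g x j * g x k.
  move=> xS; apply: mulr_ge0; last exact: g0.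
  by apply: mulr_ge0; [exact/ltW/K0|exact: g0].
have gain0 x i : simplex x -> 0 <= gain (g x) i.
  move=> xS; apply: mulr_ge0 => //; apply: sumr_ge0 => j _; apply: sumr_ge0 => k _.
  exact: Kg0.
have v0E x : v x ord0 = - \sum_i b (g x) i by rewrite /v unlift_none.
have vlE x r : v x (lift ord0 r) = b (g x) (enum_val r) by rewrite /v liftK.
have [x xS x0] : exists2 x, simplex x & forall i, v x i = 0.
  apply: simplex_zero => [j|x xS|x j xS xj].
  - rewrite /v; case: (unlift ord0 j) => [r|] /=; first exact: bc.
    by move=> x; apply: continuousN; exact: (continuous_sum bc).
  - rewrite big_ord_recl v0E (eq_bigr _ (fun r _ => vlE x r)) addrC.
    by rewrite -(big_enum_val (fun i => b (g x) i)) /= subrr.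
  - rewrite /v; case: unliftP => [r rE|jE] /=.
      rewrite /b /loss /g enum_valK -rE xj mulr0 mul0r subr0.
      by rewrite addr_ge0 // -/(g x); exact: gain0.
    have gB : \sum_i g x i = B.
      rewrite -mulr_sumr; have := xS.2; rewrite big_ord_recl -jE xj add0r.
      by rewrite (reindex enum_rank) /= => [->|]; rewrite ?mulr1 //; exact/onW_bij/enum_rank_bij.
    rewrite oppr_ge0 /b sumrB big_split /= -/T.
    (* A pair produces at most one particle and is counted with weight one half, so the gain makes
       up for at most half of the loss; the other half absorbs the source. *)
    have gl : \sum_i gain (g x) i <= 2^-1 * \sum_i loss (g x) i.
      rewrite -mulr_sumr ler_pM2l // exchange_big /=; apply: ler_sum => l _.
      rewrite /loss mulr_sumr (exchange_big_dep predT) //=; apply: ler_sum => k _.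
      rewrite [leRHS](_ : _ = K l k * g x l * g x k); last by ring.
      have F0 : 0 <= K l k * g x l * g x k by exact: Kg0.
      case: (s l k) => [i|]; last by rewrite big_pred0.
      by rewrite (big_pred1 i) // => i'; rewrite eq_sym; apply/eqP/eqP => [->|[]].
    have ll : k0 * B ^+ 2 <= \sum_i loss (g x) i.
      rewrite expr2 -{1}gB mulrCA mulr_suml; apply: ler_sum => i _.
      rewrite ler_wpM2l ?g0 // -gB mulr_sumr; apply: ler_sum => l _.
      by rewrite ler_wpM2r ?g0.
    by move: gl ll TB; clear; move: (\sum_i gain _ _) (\sum_i loss _ _) => G L; lra.
exists (g x) => [i|i]; first exact: g0.
have := x0 (lift ord0 (enum_rank i)); rewrite vlE enum_rankK /b => /eqP.
by rewrite subr_eq0 => /eqP/esym.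
Qed.

(** * Flux of mass and dyadic decay in the truncated system *)

Definition tail_ratio (R : realType) (a : R) : R := 2 `^ ((a - 1) / 2).

(** The square root comes from [truncated_dyadic] and bounds the mass of a dyadic range up to the
    factor [tail_ratio a ^+ t]; dividing by [1 - tail_ratio a] sums the geometric series over
    [t]. *)
Definition tail_const (R : realType) (a c J : R) : R :=
  Num.sqrt (J / (c * (2^-1 * Num.min (2 `^ a) (4 `^ a)))) / (1 - tail_ratio a).

Lemma tail_ratio_bounds (R : realType) (a : R) : a < 1 -> 0 < tail_ratio a < 1.
Proof.
move=> a1; rewrite /tail_ratio powR_gt0 //= lt_neqAle; apply/andP; split.
  rewrite powR_eq1 !negb_or pnatr_eq1 ltrn0 /= mulf_eq0 negb_or.
  by rewrite invr_eq0 pnatr_eq0 andbT subr_eq0 lt_eqF.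
by rewrite -[leRHS](powRr0 2); apply: ler_powR; lra.
Qed.

Lemma tail_const_ge0 (R : realType) (a c J : R) : a < 1 -> 0 <= tail_const a c J.
Proof.
move=> /tail_ratio_bounds /andP[_ q1].
by rewrite divr_ge0 ?sqrtr_ge0 // subr_ge0 ltW.
Qed.

Section truncated_system.
Variables (R : realType) (I : finType) (r : I -> R) (K : I -> I -> R).
Variables (s : I -> I -> option I) (eta f : I -> R) (M : R).
Hypothesis r0 : forall i, 0 < r i.
Hypothesis K0 : forall i j, 0 <= K i j.
Hypothesis K_sym : forall i j, K i j = K j i.
Hypothesis s_some : forall i j k, s i j = Some k -> r k = r i + r j.
Hypothesis s_none : forall i j, s i j = None -> M < r i + r j.
Hypothesis eta0 : forall i, 0 <= eta i.
Hypothesis f0 : forall i, 0 <= f i.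
Hypothesis f_sol : forall i, f i * (\sum_j K i j * f j) =
    2^-1 * (\sum_j \sum_(k | s j k == Some i) K j k * f j * f k) + eta i.

Lemma truncated_weak (phi : I -> R) :
  \sum_i \sum_j K i j * f i * f j * phi i =
  2^-1 * (\sum_i \sum_j K i j * f i * f j * oapp phi 0 (s i j)) +
  \sum_i phi i * eta i.
Proof.
transitivity (\sum_i phi i * (f i * (\sum_j K i j * f j))).
  apply: eq_bigr => i _; rewrite !mulr_sumr; apply: eq_bigr => j _; ring.
under eq_bigr do rewrite f_sol mulrDr.
rewrite big_split /=; congr (_ + _).
transitivity (2^-1 * \sum_i \sum_j \sum_(k | s j k == Some i) K j k * f j * f k * phi i).
  rewrite mulr_sumr; apply: eq_bigr => i _; rewrite mulrCA; congr (_ * _).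
  rewrite mulr_sumr; apply: eq_bigr => j _; rewrite mulr_sumr; apply: eq_bigr => k _.
  by rewrite mulrC.
congr (_ * _); rewrite exchange_big /=; apply: eq_bigr => j _.
rewrite (exchange_big_dep predT) //=; apply: eq_bigr => k _.
case: (s j k) => [i|] /=; last by rewrite big_pred0 ?mulr0.
by rewrite (big_pred1 i) // => i'; rewrite eq_sym; apply/eqP/eqP => [->|[]].
Qed.

(* Tests the weak equation with [r 1_(r <= x)]. *)
Lemma truncated_flux (x : R) : x <= M ->
  \sum_(i | r i <= x) \sum_(j | x < r i + r j) K i j * f i * f j * r i =
  \sum_(i | r i <= x) r i * eta i.
Proof.
move=> xM; pose phi i := if r i <= x then r i else 0.
have := truncated_weak phi.
have -> : \sum_i phi i * eta i = \sum_(i | r i <= x) r i * eta i.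
  by rewrite [RHS]big_mkcond; apply: eq_bigr => i _; rewrite /phi; case: ifP; rewrite ?mul0r.
(* [G] collects the mergers that stay below [x]. By symmetry of [K] their gain is [2 * G] before the
   factor 1/2, so [G] cancels and only the mergers crossing [x] remain. *)
pose G := \sum_i \sum_(j | r i + r j <= x) K i j * f i * f j * r i.
have -> : \sum_i \sum_j K i j * f i * f j * oapp phi 0 (s i j) = 2 * G.
  have -> : 2 * G = G + \sum_i \sum_(j | r i + r j <= x) K i j * f i * f j * r j.
    rewrite mulrDl !mul1r; congr (_ + _); rewrite /G (exchange_big_dep predT) //=.
    apply: eq_bigr => i _; apply: eq_big => [j|j _]; first by rewrite addrC.
    by rewrite K_sym; ring.
  rewrite -big_split /=; apply: eq_bigr => i _; rewrite -big_split [RHS]big_mkcond /=.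
  apply: eq_bigr => j _; case E : (s i j) => [k|] /=.
    rewrite /phi (s_some E); case: ifP => _; ring.
  by have := s_none E; rewrite mulr0 leNgt => /(le_lt_trans xM) ->.
have -> : \sum_i \sum_j K i j * f i * f j * phi i = G +
    \sum_(i | r i <= x) \sum_(j | x < r i + r j) K i j * f i * f j * r i.
  rewrite [X in G + X]big_mkcond -big_split /=; apply: eq_bigr => i _; rewrite /phi.
  case: ifP => [rx|/negbT]; last first.
    rewrite -ltNge => xr; rewrite addr0 [RHS]big_pred0 => [|j]; last first.
      by apply/negbTE; rewrite -ltNge (lt_trans xr) // ltrDl.
    by rewrite big1 // => j _; rewrite mulr0.
  rewrite (bigID (fun j => r i + r j <= x)) /=; congr (_ + _).
  by apply: eq_bigl => j; rewrite ltNge.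
rewrite mulrA mulVf ?pnatr_eq0 // mul1r; exact: addrI.
Qed.

(* Two particles with sizes in [(x/2, x]] cross the size [x] when they merge. *)
Lemma truncated_dyadic (a c J x : R) : 0 < x -> x <= M -> 0 <= c ->
  \sum_i r i * eta i <= J ->
  (forall i j, c * ((r i)^-1 + (r j)^-1) `^ a <= K i j) ->
  c * (2^-1 * Num.min (2 `^ a) (4 `^ a)) * (\sum_(i | x / 2 < r i <= x) f i) ^+ 2 <= J * x `^ (a - 1).
Proof.
move=> x0 xM c0 etaJ Kc.
have J0 : \sum_(i | r i <= x) \sum_(j | x < r i + r j) K i j * f i * f j * r i <= J.
  rewrite truncated_flux //; apply: le_trans etaJ.
  by rewrite [leRHS](bigID (fun i => r i <= x)) /= lerDl sumr_ge0 // => i _; rewrite mulr_ge0 // ltW.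
have pow u : 2 <= u <= 4 -> Num.min (2 `^ a) (4 `^ a) <= u `^ a.
  move=> /andP[u2 u4]; rewrite ge_min; have [a0|a0] := leP 0 a.
    by apply/orP; left; apply: ge0_ler_powR => //; rewrite nnegrE //; lra.
  apply/orP; right; rewrite -[a]opprK !(powRN _ (- a)) lef_pV2 ?posrE ?powR_gt0 //; try lra.
  by apply: ge0_ler_powR => //; rewrite ?nnegrE; lra.
have Kx i j : x / 2 < r i <= x -> x / 2 < r j <= x ->
    c * (2^-1 * Num.min (2 `^ a) (4 `^ a)) <= x `^ (a - 1) * (K i j * r i).
  move=> /andP[i1 i2] /andP[j1 j2].
  (* Each summand lies in [1, 2], so [u] lies in [2, 4]: hence the minimum in the constant. Its
     factor [2^-1] comes from [r i > x / 2]. *)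
  pose u := x / r i + x / r j.
  have uE : (r i)^-1 + (r j)^-1 = x^-1 * u.
    by rewrite /u; field; rewrite !gt_eqF //.
  have ub k : x / 2 < r k -> r k <= x -> 1 <= x / r k <= 2.
    by move=> k1 k2; rewrite ler_pdivlMr // ler_pdivrMr // mul1r k2 /=; lra.
  have u24 : 2 <= u <= 4.
    have /andP[] := ub i i1 i2; have /andP[] := ub j j1 j2; rewrite /u.
    move: (x / r i) (x / r j) => y z; lra.
  have xa : x `^ (a - 1) * x `^ (- a) * x = 1.
    have xn0 : x != 0 by rewrite gt_eqF.
    rewrite -[X in _ * X](powRr1 (ltW x0)) -!powRD ?xn0 ?implybT //.
    by rewrite [_ + 1](_ : _ = 0) ?powRr0 //; ring.
  have := Kc i j; rewrite uE powRM ?invr_ge0 ?(ltW x0) //; last by have /andP[? _] := u24; lra.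
  rewrite -powR_inv1 ?(ltW x0) // -powRrM mulN1r => Kij.
  have : c * (x `^ (- a) * u `^ a) * (x / 2) <= K i j * r i.
    by apply: ler_pM => //; rewrite ?mulr_ge0 ?powR_ge0 //; lra.
  move=> /(ler_wpM2l (powR_ge0 x (a - 1))); apply: le_trans.
  rewrite [leRHS](_ : _ = (x `^ (a - 1) * x `^ (- a) * x) * (c * (2^-1 * u `^ a))); last by ring.
  by rewrite xa mul1r ler_wpM2l // ler_wpM2l // pow.
rewrite mulrC [leRHS]mulrC; apply: le_trans (ler_wpM2l (powR_ge0 _ _) J0).
rewrite expr2 -mulrA [leLHS]mulr_suml [leRHS]mulr_sumr.
rewrite [leRHS](bigID (fun i => x / 2 < r i)) /= -[leLHS]addr0 lerD //; last first.
  apply: sumr_ge0 => i _; apply: mulr_ge0; rewrite ?powR_ge0 //.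
  by apply: sumr_ge0 => j _; rewrite !mulr_ge0 // ltW.
under [leRHS]eq_bigl do rewrite andbC.
apply: ler_sum => i /andP[i1 i2]; rewrite mulr_suml [leLHS]mulr_sumr [leRHS]mulr_sumr.
rewrite [leRHS]big_mkcond [leLHS]big_mkcond; apply: ler_sum => j _.
case: ifP => [/andP[j1 j2]|_]; last first.
  by case: ifP => // _; rewrite !mulr_ge0 ?powR_ge0 // ltW.
rewrite ifT; last by lra.
have := Kx i j; rewrite i1 i2 j1 j2 => /(_ isT isT) /(ler_wpM2l (mulr_ge0 (f0 i) (f0 j))).
by move=> H; apply: le_trans (le_trans H _); rewrite le_eqVlt; apply/orP; left; apply/eqP; ring.
Qed.

Section tail.
Variables (a c J : R) (N : nat).
Hypothesis ME : M = 2 ^+ N.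
Hypothesis a1 : a < 1.
Hypothesis c0 : 0 < c.
Hypothesis J0 : 0 <= J.
Hypothesis rM : forall i, r i <= M.
Hypothesis etaJ : \sum_i r i * eta i <= J.
Hypothesis Kc : forall i j, c * ((r i)^-1 + (r j)^-1) `^ a <= K i j.

Let q := tail_ratio a.
Let C := tail_const a c J.

Let q0 : 0 <= q. Proof. by have /andP[/ltW] := tail_ratio_bounds a1. Qed.
Let q1 : q < 1. Proof. by have /andP[] := tail_ratio_bounds a1. Qed.
Let C0 : 0 <= C. Proof. exact: tail_const_ge0. Qed.

Lemma truncated_dyadic_pow2 t : (t <= N)%N ->
  \sum_(i | 2 ^+ t / 2 < r i <= 2 ^+ t) f i <= C * (1 - q) * q ^+ t.
Proof.
move=> tN; have x0 : 0 < 2 ^+ t :> R by rewrite exprn_gt0.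
have xM : 2 ^+ t <= M by rewrite ME ler_weXn2l // ler1n.
pose k := c * (2^-1 * Num.min (2 `^ a) (4 `^ a)).
have k0 : 0 < k by rewrite !mulr_gt0 // lt_min !powR_gt0.
have CE : Num.sqrt (J / k) = C * (1 - q) by rewrite /C /tail_const divfK // gt_eqF ?subr_gt0.
have := truncated_dyadic x0 xM (ltW c0) etaJ Kc.
rewrite -/k mulrC -ler_pdivlMr // => H.
rewrite -CE -ler_sqr ?nnegrE ?mulr_ge0 ?sqrtr_ge0 ?exprn_ge0 ?sumr_ge0 //.
apply: le_trans H _; rewrite exprMn sqr_sqrtr; last by rewrite divr_ge0 // ltW.
rewrite mulrAC ler_wpM2l ?divr_ge0 ?(ltW k0) // le_eqVlt; apply/orP; left; apply/eqP.
rewrite -exprM /q /tail_ratio -!powR_mulrn ?powR_ge0 // -!powRrM; congr (_ `^ _).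
by rewrite natrM; field.
Qed.

(** Induction downwards from [t >= N], where no size exceeds [2 ^+ t]. *)
Lemma truncated_tail t : \sum_(i | 2 ^+ t < r i) f i <= C * q ^+ t.
Proof.
move: {-1}(N - t)%N (erefl (N - t)%N) => n; elim: n t => [|n IHn] t Nt.
  rewrite big_pred0 => [|i]; first by rewrite mulr_ge0 ?exprn_ge0.
  apply/negbTE; rewrite -leNgt; apply: le_trans (rM i) _.
  by rewrite ME ler_weXn2l ?ler1n //; move/eqP: Nt; rewrite subn_eq0.
have tN : (t < N)%N by rewrite -subn_gt0 Nt.
rewrite (bigID (fun i => r i <= 2 ^+ t.+1)) /=.
have /IHn tl : (N - t.+1 = n)%N by rewrite subnS Nt.
have tE : \sum_(i | (2 ^+ t < r i) && ~~ (r i <= 2 ^+ t.+1)) f i = \sum_(i | 2 ^+ t.+1 < r i) f i.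
  apply: eq_bigl => i; rewrite -ltNge.
  have [ti|] := ltP (2 ^+ t.+1) (r i); last by rewrite andbF.
  by rewrite andbT; apply: lt_trans ti; rewrite ltr_eXn2l // ltr1n.
rewrite tE.
have := truncated_dyadic_pow2 tN.
rewrite [_ / 2](_ : _ = 2 ^+ t) => [dy|]; last by rewrite exprSr mulfK ?pnatr_eq0.
apply: le_trans (lerD dy tl) _; rewrite exprSr.
(* One dyadic range and the next tail add up to [C * q ^+ t] times [2 * q - q ^+ 2], which is at
   most 1. *)
rewrite [leLHS](_ : _ = C * q ^+ t * (1 - (1 - q) ^+ 2)); last by ring.
apply: ler_piMr; last by rewrite gerBl sqr_ge0.
by rewrite mulr_ge0 ?exprn_ge0.
Qed.

(** One [C] pays for the size 1, which lies in the dyadic range (1/2, 1], the other for the tail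
    above 1. *)
Lemma truncated_mass : (forall i, 1 <= r i) -> \sum_i f i <= C *+ 2.
Proof.
move=> r1; rewrite (bigID (fun i => r i <= 1)) /= mulr2n lerD //.
  apply: le_trans (_ : C * (1 - q) * q ^+ 0 <= _); last first.
    by rewrite expr0 mulr1; apply: ler_piMr; rewrite // gerBl.
  apply: le_trans (truncated_dyadic_pow2 (leq0n N)); rewrite expr0.
  rewrite le_eqVlt; apply/orP; left; apply/eqP/eq_bigl => i.
  by have ri := r1 i; apply/idP/andP => [->|[]//]; split=> //; lra.
have := truncated_tail 0; rewrite expr0 mulr1; apply: le_trans.
rewrite le_eqVlt; apply/orP; left; apply/eqP/eq_bigl => i.
by rewrite ltNge.
Qed.

End tail.

End truncated_system.

(** * Extraction, dyadic codes and quantile functions *)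

Lemma diagonal_subsequence (R : realType) (u : nat -> nat -> R) (b : R) :
  (forall n t, `|u n t| <= b) ->
  exists sigma : nat -> nat, (forall n, (n <= sigma n)%N) /\
    forall t, cvgn (fun n => u (sigma n) t).
Proof.
(* A cluster point in the compact product of intervals replaces successive extractions: at step [n]
   it is approached in the coordinates up to [n]. The indices only have to dominate [n]; they need
   not increase. *)
move=> ub; pose A := [set f : prod_topology (fun _ : nat => R) | forall t, `[- b, b]%classic (f t)].
have Ac : compact A.
  have := @tychonoff _ (fun _ : nat => R) (fun _ => `[- b, b]%classic).
  by apply=> _; exact: segment_compact.
have [|p [_ pc]] := Ac ((u : nat -> prod_topology (fun _ : nat => R)) @ \oo) _.
  by exists 0%N => // n _ t; rewrite /= in_itv /= -ler_norml.
have near_p n : nbhs p [set f : prod_topology (fun _ : nat => R) |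
    forall t, (t <= n)%N -> `|p t - f t| < n.+1%:R^-1].
  have nt t : nbhs p [set f : prod_topology (fun _ : nat => R) | `|p t - f t| < n.+1%:R^-1].
    apply: (@proj_continuous _ (fun _ : nat => R) t p [set y | `|p t - y| < n.+1%:R^-1]).
    by apply/nbhs_ballP; exists n.+1%:R^-1; rewrite /= ?invr_gt0.
  suff H m : nbhs p [set f : prod_topology (fun _ : nat => R) |
      forall t, (t <= m)%N -> `|p t - f t| < n.+1%:R^-1] by exact: H.
  elim: m => [|m IHm].
    by apply: filterS (nt 0%N) => f /= ft t; rewrite leqn0 => /eqP->.
  apply: filterS (filterI IHm (nt m.+1)) => f /= [fm fm1] t.
  by rewrite leq_eqVlt => /orP[/eqP->//|]; rewrite ltnS; exact: fm.
have ex n : {m | (n <= m)%N & forall t, (t <= n)%N -> `|p t - u m t| < n.+1%:R^-1}.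
  apply: cid2; have [_ [[m nm <-] mP]] := pc (u @` [set m | (n <= m)%N]) _
    ltac:(by exists n => // m nm; exists m) (near_p n).
  by exists m.
exists (fun n => s2val (ex n)); split=> [n|t]; first by case: (ex n).
apply/cvg_ex; exists (p t); apply/cvgrPdist_lt => e e0; near=> n.
case: (ex n) => m nm /= /(_ t) H.
have tn : (t <= n)%N by near: n; exact: nbhs_infty_ge.
apply: lt_trans (H tn) _; near: n; exact: near_infty_natSinv_lt (PosNum e0).
Unshelve. all: by end_near. Qed.

Section code.
Variable J : finType.
Implicit Types k : J -> nat.

Local Notation D := #|{ffun J -> bool}|.

(* Families with the same integer parts of [k j / 2^m] have codes with the same
   quotient by [D ^ m], so that dyadic cells are intervals in the order of codes. *)
Fixpoint code l k : nat :=
  if l is l'.+1 then code l' (fun j => (k j)./2) * D + enum_rank [ffun j => odd (k j)]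
  else pickle [ffun j => k j].

Lemma code_base_gt0 : (0 < D)%N.
Proof. by apply/card_gt0P; exists [ffun=> false]. Qed.

Lemma eq_code l k k' : k =1 k' -> code l k = code l k'.
Proof. by move=> /funext->. Qed.

Lemma codeS_div l k : (code l.+1 k %/ D)%N = code l (fun j => (k j)./2).
Proof. by rewrite /= divnMDl ?code_base_gt0 // divn_small ?addn0. Qed.

Lemma code_div l m k : (code (l + m) k %/ D ^ m)%N = code l (fun j => k j %/ 2 ^ m)%N.
Proof.
elim: m k => [|m IHm] k.
  by rewrite addn0 expn0 divn1; apply: eq_code => j; rewrite expn0 divn1.
rewrite addnS expnS divnMA codeS_div IHm; apply: eq_code => j.
by rewrite expnS divnMA divn2.
Qed.

Lemma code_inj l k k' : code l k = code l k' -> k =1 k'.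
Proof.
elim: l k k' => [|l IHl] k k' E j.
  by have /ffunP/(_ j) := pcan_inj pickleK E; rewrite !ffunE.
have hk : (fun j => (k j)./2) =1 (fun j => (k' j)./2).
  by apply: IHl; rewrite -!codeS_div E.
move: E => /=; rewrite (eq_code l hk).
move=> /eqP; rewrite eqn_add2l => /eqP/val_inj/enum_rank_inj/ffunP/(_ j).
rewrite !ffunE => oE.
by rewrite -[LHS]odd_double_half -[RHS]odd_double_half oE (hk j).
Qed.

End code.

Section quantile.
Variables (R : realType) (I : finType) (c : I -> nat) (h : I -> R).
Hypothesis c_inj : injective c.
Hypothesis h0 : forall i, 0 <= h i.

(* The atoms are laid out as consecutive intervals of length [h i] in the order
   of the codes, and [quantile s] is the atom whose interval contains [s]. *)
Definition qlow i : R := \sum_(j | (c j < c i)%N) h j.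

Definition qcell i : set R := `[qlow i, qlow i + h i[%classic.

Definition quantile (s : R) : option I := [pick i | `[< qcell i s >]].

Lemma qlow_ge0 i : 0 <= qlow i. Proof. exact: sumr_ge0. Qed.

Lemma qlowD i : qlow i + h i = \sum_(j | (c j <= c i)%N) h j.
Proof.
rewrite [RHS](bigD1 i) //= addrC; congr (_ + _); apply: eq_bigl => j.
by rewrite ltn_neqAle andbC (inj_eq c_inj).
Qed.

Lemma qlowD_le i : qlow i + h i <= \sum_j h j.
Proof.
by rewrite qlowD [leRHS](bigID (fun j => (c j <= c i)%N)) /= lerDl sumr_ge0.
Qed.

Lemma ler_sum_pred (P Q : pred I) : (forall i, P i -> Q i) ->
  \sum_(i | P i) h i <= \sum_(i | Q i) h i.
Proof.
move=> PQ; rewrite [leLHS]big_mkcond [leRHS]big_mkcond; apply: ler_sum => i _.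
by case: ifP => [/PQ ->//|_]; case: ifP.
Qed.

Lemma qcell_sub i : qcell i `<=` `[0, \sum_j h j[%classic.
Proof.
move=> s; rewrite /qcell /= !in_itv /= => /andP[ls sl].
by rewrite (le_trans (qlow_ge0 i) ls) (lt_le_trans sl (qlowD_le i)).
Qed.

Lemma qcell_le i j s : qcell i s -> qcell j s -> (c i <= c j)%N.
Proof.
rewrite /qcell /= !in_itv /= => /andP[ls _] /andP[_ sl]; rewrite leqNgt; apply/negP => ji.
have := lt_le_trans sl (le_trans _ ls); rewrite ltxx => F; apply: notF; apply: F.
by rewrite qlowD; apply: ler_sum_pred => k kj; exact: leq_ltn_trans ji.
Qed.

Lemma qcell_inj i j s : qcell i s -> qcell j s -> i = j.
Proof.
move=> si sj; apply: c_inj; apply/eqP.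
by rewrite eqn_leq (qcell_le si sj) (qcell_le sj si).
Qed.

Lemma quantileP s i : qcell i s -> quantile s = Some i.
Proof.
move=> si; rewrite /quantile; case: pickP => [j /asboolP sj|/(_ i)].
  by rewrite (qcell_inj si sj).
by move=> /asboolP.
Qed.

Lemma quantile_none s : \sum_j h j <= s -> quantile s = None.
Proof.
move=> hs; rewrite /quantile; case: pickP => // i /asboolP /qcell_sub.
by rewrite /= in_itv /= ltNge hs andbF.
Qed.

Lemma qcell_cover s : 0 <= s -> s < \sum_j h j -> exists i, qcell i s.
Proof.
move=> s0 sh; suff H n : s < \sum_(j | (c j < n)%N) h j -> exists i, qcell i s.
  apply: (H (\max_j c j).+1); rewrite [ltRHS](eq_bigl predT) // => j.
  by rewrite ltnS leq_bigmax.
elim: n => [|n IHn]; first by rewrite big_pred0 // ltNge s0.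
move=> sn; have [/IHn//|ns] := ltP s (\sum_(j | (c j < n)%N) h j).
have [/existsP[i /eqP ci]|nex] := boolP [exists i, c i == n].
  exists i; rewrite /qcell /= in_itv /= /qlow ci ns /=.
  by have := qlowD i; rewrite /qlow ci => ->.
move: sn; rewrite (eq_bigl (fun j => (c j < n)%N)) ?ltNge ?ns // => j.
rewrite ltnS leq_eqVlt; have [cn|//] := eqVneq (c j) n.
by case/negP: nex; apply/existsP; exists j; rewrite cn.
Qed.

(** Applied to the map that truncates codes, this reads the cell of the atom at [s] off the masses
    preceding the cells, which are convergent numbers. *)
Lemma quantile_level (m : nat -> nat) s i j : {homo m : x y / (x <= y)%N} ->
  qcell i s -> (\sum_(k | (m (c k) < j)%N) h k <= s) = (j <= m (c i))%N.
Proof.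
move=> mm; rewrite /qcell /= in_itv /= => /andP[ls sl]; apply/idP/idP => [hs|jm].
  rewrite leqNgt; apply/negP => ij; move: sl; rewrite qlowD ltNge => /negP[].
  by apply: le_trans hs; apply: ler_sum_pred => k /mm ki; exact: leq_ltn_trans ij.
apply: le_trans ls; apply: ler_sum_pred => k kj; rewrite ltnNge; apply/negP => /mm.
by rewrite leqNgt (leq_trans kj jm).
Qed.

Lemma measurable_qcell i : measurable (qcell i).
Proof. exact: measurable_itv. Qed.

Lemma oapp_quantileE (F : I -> R) s :
  oapp F 0 (quantile s) = \sum_i F i * \1_(qcell i) s.
Proof.
rewrite /quantile; case: pickP => [i /asboolP si|nq] /=.
  rewrite (bigD1 i) //= indicE mem_set // mulr1 big1 ?addr0 // => j ji.
  rewrite indicE memNset ?mulr0 // => sj; move/eqP: ji; apply.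
  exact: qcell_inj sj si.
rewrite big1 // => i _; rewrite indicE memNset ?mulr0 //.
by move=> si; have := nq i; move/asboolP.
Qed.

Lemma measurable_oapp_quantile (D : set R) (F : I -> R) : measurable_fun D (oapp F 0 \o quantile).
Proof.
rewrite (_ : _ \o _ = (fun s => \sum_i F i * \1_(qcell i) s)); last first.
  by apply/funext => s /=; rewrite oapp_quantileE.
apply: measurable_sum => i; apply: measurable_funM => //.
by apply: measurable_indic; exact: measurable_qcell.
Qed.

Lemma integral_quantile (D : set R) (F : I -> R) : measurable D ->
  `[0, \sum_j h j[%classic `<=` D ->
  (\int[lebesgue_measure]_(s in D) (oapp F 0 (quantile s))%:E =
   (\sum_i h i * F i)%:E)%E.
Proof.
move=> mD sD; under eq_integral do rewrite oapp_quantileE -sumEFin.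
have ind i : lebesgue_measure.-integrable D (fun s : R => (\1_(qcell i) s)%:E).
  apply: (@integrableS _ _ _ _ setT) => //.
  exact: integrable_indic_itv.
rewrite integral_sum // => [|i]; last first.
  under eq_fun do rewrite EFinM.
  exact: integrableZl.
rewrite -sumEFin; apply: eq_bigr => i _.
under eq_integral do rewrite EFinM.
rewrite integralZl // integral_indic //; last exact: measurable_qcell.
rewrite setIidl; last exact: subset_trans (@qcell_sub i) sD.
rewrite [X in (_ * X)%E](_ : _ = lebesgue_measure `[qlow i, qlow i + h i[%classic) //.
rewrite lebesgue_measure_itv /= lte_fin ltrDl EFinM muleC.
have [h0i|] := ltP 0 (h i); first by rewrite -EFinB addrC addKr.
by move=> hi; have -> : h i = 0 by apply/eqP; rewrite eq_le hi h0.
Qed.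

End quantile.

Section quantile_cvg.
Variables (R : realType) (I : nat -> finType).
Variables (c : forall N, I N -> nat) (h : forall N, I N -> R) (D : nat) (b : R).
Hypothesis D0 : (0 < D)%N.
Hypothesis c_inj : forall N, injective (@c N).
Hypothesis h0 : forall N i, 0 <= @h N i.
Hypothesis hb : forall N, \sum_i @h N i <= b.
Hypothesis tight : forall e : R, 0 < e ->
  exists j, forall N, \sum_(i | (j <= c i %/ D ^ N)%N) @h N i <= e.

Let total N := \sum_i @h N i.
Let lev l N (i : I N) := (c i %/ D ^ (N - l))%N.
Let G l j N := \sum_(i | (lev l i < j)%N) @h N i.

(** If [s] differs from every limit mass, the first [j] whose limit mass exceeds [s] fixes the cell
    of the atom at [s] for all large [n]. The limit masses form the countable set [Z]. *)
Lemma quantile_cvg : exists sigma : nat -> nat, (forall n, (n <= sigma n)%N) /\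
  exists (H : R) (Z : set R), [/\ 0 <= H, total (sigma n) @[n --> \oo] --> H,
    countable Z, Z H & forall s, 0 <= s < H -> ~ Z s -> forall l, exists m,
    \forall n \near \oo, exists2 i, quantile (@c (sigma n)) (@h (sigma n)) s = Some i
      & lev l i = m].
Proof.
(* All the masses [G l j] and the total mass form one family, so that a single extraction serves
   every level. *)
pose u N t := match (unpickle t : option (option (nat * nat))) with
  | Some (Some p) => G p.1 p.2 N | _ => total N end.
have Gb l j N : 0 <= G l j N <= total N.
  rewrite sumr_ge0 //= /total [leRHS](bigID (fun i => lev l i < j)%N) /=.
  by rewrite lerDl sumr_ge0.
have ub N t : `|u N t| <= b.
  have t0 : 0 <= total N by exact: sumr_ge0.
  rewrite /u; case: unpickle => [[p|]|]; rewrite ger0_norm //; try exact: hb.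
    by apply: le_trans (hb N); have /andP[] := Gb p.1 p.2 N.
  by have /andP[] := Gb p.1 p.2 N.
have [sigma [sn cu]] := diagonal_subsequence ub.
exists sigma; split=> //.
pose H := lim (total (sigma n) @[n --> \oo]).
have cH : total (sigma n) @[n --> \oo] --> H.
  by have := cu (pickle (None : option (nat * nat))); rewrite /u pickleK.
pose Gl l j := lim (G l j (sigma n) @[n --> \oo]).
have cG l j : G l j (sigma n) @[n --> \oo] --> Gl l j.
  by have := cu (pickle (Some (l, j))); rewrite /u pickleK.
pose Z := range (oapp (fun p : nat * nat => Gl p.1 p.2) H).
exists H, Z; split => //; [|by apply: sub_countable (card_image_le _ _) _; exact: countableP|by exists None|].
  by apply: limr_ge; [apply/cvg_ex; exists H|apply: nearW => n; exact: sumr_ge0].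
move=> s /andP[s0 sH] sZ l.
(* Tightness is used here: without it the mass beyond [s] could escape to ever larger codes. *)
have [J sJ] : exists J, s < Gl l J.
  have [j0 j0P] := @tight ((H - s) / 2) ltac:(by rewrite divr_gt0 // subr_gt0).
  exists (j0 * D ^ l)%N.
  have cGH : G l (j0 * D ^ l) (sigma n) - total (sigma n) @[n --> \oo] --> Gl l (j0 * D ^ l)%N - H.
    exact: cvgB (cG _ _) cH.
  have : - ((H - s) / 2) <= Gl l (j0 * D ^ l)%N - H.
    rewrite -(cvg_lim _ cGH) //; apply: limr_ge; first exact: (cvgP _ cGH).
    near=> n; have ln : (l <= sigma n)%N.
      by apply: leq_trans (sn n); near: n; exact: nbhs_infty_ge.
    have := j0P (sigma n); rewrite /total [X in _ <= _ - X](bigID (fun i => lev l i < j0 * D ^ l)%N) /=.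
    rewrite opprD addNKr lerN2; apply: le_trans; rewrite le_eqVlt; apply/orP; left.
    apply/eqP/eq_bigl => i; rewrite -leqNgt /lev !leq_divRL ?expn_gt0 ?D0 //.
    by rewrite -mulnA -expnD subnKC.
  by move: sH; lra.
have ex : exists j, s < Gl l j by exists J.
case: (ex_minnP ex) => -[|m] sm mmin.
  have G0 n : G l 0 (sigma n) = 0 by rewrite /G big_pred0.
  by move: sm; rewrite /Gl; under eq_fun do rewrite G0; rewrite lim_cst // ltNge s0.
exists m.
have ms : Gl l m < s.
  rewrite lt_neqAle leNgt; apply/andP; split.
    by apply/eqP => E; apply: sZ; exists (Some (l, m)).
  by apply/negP => /mmin; rewrite ltnn.
have totgt : \forall n \near \oo, s < total (sigma n) by exact: cvgr_gt cH _ sH.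
have Ggt : \forall n \near \oo, s < G l m.+1 (sigma n) by exact: cvgr_gt (cG l m.+1) _ sm.
have Glt : \forall n \near \oo, G l m (sigma n) < s by exact: cvgr_lt (cG l m) _ ms.
near=> n.
have [i si] : exists i, qcell (@c (sigma n)) (@h (sigma n)) i s.
  apply: qcell_cover => //.
  by near: n.
exists i; first exact: quantileP.
have mono : {homo (fun x => x %/ D ^ (sigma n - l))%N : x y / (x <= y)%N}.
  by move=> x y; exact: leq_div2r.
apply/eqP; rewrite eqn_leq -ltnS ltnNge.
rewrite -!(quantile_level (@c_inj _) (@h0 _) _ mono si) -ltNge; apply/andP; split.
  by near: n.
by apply: ltW; near: n.
Unshelve. all: by end_near.
Qed.

End quantile_cvg.

(** * Images of measures with a density *)

Section weighted_image.
Context d d' (T : measurableType d) (T' : measurableType d') (R : realType).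
Variables (mu : {measure set T -> \bar R}) (D : set T) (X : T -> T') (w : T -> R).
Hypothesis mD : measurable D.
Hypothesis mX : measurable_fun D X.
Hypothesis mw : measurable_fun D w.
Hypothesis w0 : forall x, 0 <= w x.
Local Open Scope ereal_scope.

Definition weighted_image (A : set T') : \bar R := \int[mu]_(x in D `&` X @^-1` A) (w x)%:E.

Let mXA A : measurable A -> measurable (D `&` X @^-1` A).
Proof. exact: mX. Qed.

Lemma weighted_image_indicE (A : set T') : measurable A ->
  weighted_image A = \int[mu]_(x in D) (w x * \1_A (X x))%:E.
Proof.
move=> mA; rewrite /weighted_image integral_mkcondr; apply: eq_integral => x _.
rewrite /patch indicE; case: ifPn => [|] XA; first by rewrite mem_set ?mulr1 //; rewrite inE in XA.
by rewrite memNset ?mulr0 // => AX; move/negP: XA; apply; rewrite inE.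
Qed.

Import HBNNSimple.

(** Simple functions and monotone convergence settle nonnegative [g]. Multiplication by the finite
    nonnegative [w] commutes with positive and negative parts, so the formula holds for every
    measurable [g], integrable or not. *)
Lemma weighted_image_measure : exists2 nu : {measure set T' -> \bar R},
  forall A, nu A = weighted_image A & forall g : T' -> \bar R,
    measurable_fun setT g -> \int[nu]_y g y = \int[mu]_(x in D) ((w x)%:E * g (X x)).
Proof.
have nu0 : weighted_image set0 = 0.
  by rewrite /weighted_image preimage_set0 setI0 integral_set0.
have nu_ge0 A : 0 <= weighted_image A.
  by apply: integral_ge0 => x _; rewrite lee_fin.
have nu_sigma : semi_sigma_additive weighted_image.
  move=> F mF tF mUF; rewrite /weighted_image preimage_bigcup setI_bigcupr.
  rewrite ge0_integral_bigcup.
  - apply: is_cvg_nneseries => n _ _; exact: nu_ge0.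
  - by move=> k; exact: mXA.
  - apply/measurable_EFinP; apply: measurable_funS mw => //.
    by apply: bigcup_sub => i _; exact: subIsetl.
  - by move=> x _; rewrite lee_fin.
  - by move=> i j _ _ [x [[_ Fi] [_ Fj]]]; apply: tF => //; exists (X x).
pose nu : {measure set T' -> \bar R} :=
  HB.pack weighted_image (isMeasure.Build _ _ _ weighted_image nu0 nu_ge0 nu_sigma).
have ge0 (g : T' -> \bar R) : (forall y, 0 <= g y) -> measurable_fun setT g ->
    \int[nu]_y g y = \int[mu]_(x in D) ((w x)%:E * g (X x)).
  move=> g0 mg; pose h := nnsfun_approx measurableT mg.
  have hg y : (h n y)%:E @[n --> \oo] --> g y by exact: cvg_nnsfun_approx.
  have hnd y : {homo (fun n => (h n y)%:E) : m n / (m <= n)%N >-> m <= n}.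
    by move=> m n mn; rewrite lee_fin; exact/lefP/nd_nnsfun_approx.
  have lhs : \int[nu]_y (h n y)%:E @[n --> \oo] --> \int[nu]_y g y.
    rewrite (eq_integral (fun y => limn (fun n => (h n y)%:E))); last first.
      by move=> y _; exact/esym/cvg_lim.
    apply: (@cvg_monotone_convergence _ _ _ nu setT measurableT (fun n y => (h n y)%:E)) => //.
    - by move=> n; apply/measurable_EFinP.
    - by move=> n y _; rewrite lee_fin.
  have rhs : \int[mu]_(x in D) ((w x)%:E * (h n (X x))%:E) @[n --> \oo] -->
      \int[mu]_(x in D) ((w x)%:E * g (X x)).
    rewrite [X in _ --> X](eq_integral (fun x => limn (fun n => (w x)%:E * (h n (X x))%:E))); last first.
      by move=> x _; apply/esym/cvg_lim => //; exact: cvgeZl.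
    apply: (@cvg_monotone_convergence _ _ _ mu D mD (fun n x => (w x)%:E * (h n (X x))%:E)).
    - move=> n; apply: emeasurable_funM; first exact/measurable_EFinP.
      by apply/measurable_EFinP; apply: measurableT_comp.
    - by move=> n x _; rewrite mule_ge0 // lee_fin.
    - by move=> x _ m n mn; rewrite lee_wpmul2l ?lee_fin //; have := hnd (X x) m n mn.
  rewrite -(cvg_lim _ lhs) // -(cvg_lim _ rhs) //; congr (lim (_ @ \oo)); apply/funext => n.
  rewrite integralT_nnsfun sintegralE.
  transitivity (\sum_(y \in range (h n)) \int[mu]_(x in D) (w x * (y * \1_(h n @^-1` [set y]) (X x)))%:E).
    apply: eq_fsbigr => y; rewrite inE => -[z _ zy].
    rewrite /= weighted_image_indicE // -ge0_integralZl //.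
    - by apply: eq_integral => x _; rewrite -EFinM mulrCA.
    - apply/measurable_EFinP; apply: measurable_funM => //.
      by apply: measurableT_comp => //; exact: measurable_indic.
    - by move=> x _; rewrite lee_fin mulr_ge0.
    - by rewrite lee_fin -zy.
  rewrite -ge0_integral_fsum //.
  - apply: eq_integral => x _; rewrite -EFinM [in RHS]fimfunE fsumEFin // mulr_fsumr //.
  - move=> y; apply/measurable_EFinP; apply: measurable_funM => //.
    apply: measurable_funM => //.
    by apply: measurableT_comp => //; exact: measurable_indic.
  - move=> y x Dx; rewrite lee_fin mulr_ge0 //.
    have := nnfun_muleindic_ge0 (h n) y (X x); by rewrite lee_fin.
exists nu => // g mg.
rewrite [LHS]integralE [RHS]integralE !ge0 //; try by [exact: measurable_funepos|exact: measurable_funeneg].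
congr (_ - _); apply: eq_integral => x _; rewrite ?funeposE ?funenegE /=.
  by rewrite maxe_pMr ?lee_fin // mule0.
by rewrite maxe_pMr ?lee_fin // mule0 muleN.
Qed.

End weighted_image.

Lemma continuous_borel_measurable (R : realType) (T : ptopologicalType) (g : T -> R) :
  continuous g -> measurable_fun setT (g : borel T -> R).
Proof.
move=> /continuousP gc; apply: (measurability _ (RGenOpens.measurableE R)).
move=> _ [_ [a [b ->] <-]]; rewrite setTI; apply: sub_sigma_algebra.
exact/gc/interval_open.
Qed.

(** * Topology of the orthant without the origin *)

Section Rstar_topology.
Variables (R : realType) (n : nat).
Notation X := (Rstar R n).
Implicit Types x y : X.

Definition Rstar_val (x : X) : 'rV[R]_n.+1 := \val x.

Lemma Rstar_val_inj : injective Rstar_val. Proof. exact: val_inj. Qed.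

Lemma Rstar_ballE x (e : R) y : ball x e y = ball (Rstar_val x) e (Rstar_val y).
Proof. by []. Qed.

Lemma Rstar_ge0 x j : 0 <= Rstar_val x ord0 j.
Proof. by have /set_mem[] := valP x. Qed.

Lemma l1norm_gt0 x : 0 < l1norm x.
Proof.
have /set_mem[x0 xn0] := valP x.
rewrite lt_neqAle sumr_ge0 ?andbT // eq_sym; apply: contra xn0 => /eqP xs.
apply/eqP/rowP => j; rewrite mxE.
by have := psumr_eq0P (fun i _ => x0 i) xs; exact.
Qed.

Lemma l1norm_add x y : l1norm (Rstar_add x y) = l1norm x + l1norm y.
Proof. by rewrite /l1norm -big_split; apply: eq_bigr => j _; rewrite /= mxE. Qed.

Lemma coord_le_l1norm x j : Rstar_val x ord0 j <= l1norm x.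
Proof.
rewrite /l1norm (bigD1 j) //= lerDl sumr_ge0 // => i _; exact: Rstar_ge0.
Qed.

Lemma Rstar_val_continuous : continuous Rstar_val.
Proof. exact: initial_continuous. Qed.

Lemma l1norm_continuous : continuous (@l1norm R n).
Proof.
apply: continuous_sum => j x.
apply: (@continuous_comp _ _ _ Rstar_val (fun v : 'rV[R]_n.+1 => v ord0 j)).
  exact: Rstar_val_continuous.
exact: coord_continuous.
Qed.

Lemma Rstar_cvgP (F : set_system X) (x : X) : Filter F ->
  (forall j, (fun y => Rstar_val y ord0 j) @ F --> Rstar_val x ord0 j) -> F --> x.
Proof.
move=> FF cj; apply/cvg_ballP => e e0.
have : \forall y \near F, forall j, ball (Rstar_val x ord0 j) e (Rstar_val y ord0 j).
  by apply: filter_forall => j; move/cvg_ballP: (cj j); apply.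
apply: filterS => y yj; rewrite Rstar_ballE; split=> // i j; rewrite (ord1 i); exact: yj.
Qed.

Lemma Rstar_coord_continuous j : continuous (fun y : X => Rstar_val y ord0 j).
Proof.
move=> x; apply: (@continuous_comp _ _ _ Rstar_val (fun v : 'rV[R]_n.+1 => v ord0 j)).
  exact: Rstar_val_continuous.
exact: coord_continuous.
Qed.

Lemma Rstar_add_continuous : continuous (fun z : X * X => Rstar_add z.1 z.2).
Proof.
move=> [z1 z2]; apply: Rstar_cvgP => j.
have E : (fun y => Rstar_val y ord0 j) \o (fun z : X * X => Rstar_add z.1 z.2) =
    (fun z : X * X => Rstar_val z.1 ord0 j + Rstar_val z.2 ord0 j).
  by apply/funext => u /=; rewrite /Rstar_val /= mxE.
suff : ((fun y => Rstar_val y ord0 j) \o (fun z : X * X => Rstar_add z.1 z.2)) @ (z1, z2) -->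
  Rstar_val z1 ord0 j + Rstar_val z2 ord0 j by rewrite /Rstar_val /= mxE.
rewrite E; apply: cvgD.
  exact: (@cvg_comp _ _ _ fst (fun y : X => Rstar_val y ord0 j) _ _ _ cvg_fst (@Rstar_coord_continuous j z1)).
exact: (@cvg_comp _ _ _ snd (fun y : X => Rstar_val y ord0 j) _ _ _ cvg_snd (@Rstar_coord_continuous j z2)).
Qed.

(** [0 < a] keeps the cluster point found among row vectors away from the origin, hence inside the
    space. *)
Lemma Rstar_shell_compact (a b : R) : 0 < a -> compact [set x : X | a <= l1norm x <= b].
Proof.
move=> a0.
pose A := [set v : 'rV[R]_n.+1 | (forall j, 0 <= v ord0 j <= b) /\ a <= \sum_j v ord0 j <= b].
have Ac : compact A.
  have cube : compact [set v : 'rV[R]_n.+1 | forall i, `[0, b]%classic (v ord0 i)].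
    by apply: (@rV_compact R n.+1 (fun=> `[0 : R, b]%classic)) => _; exact: segment_compact.
  have -> : A = (fun x : 'rV[R]_n.+1 => \sum_i x ord0 i) @^-1` `[a, b]%classic `&`
      [set v : 'rV[R]_n.+1 | forall i, `[0, b]%classic (v ord0 i)].
    apply/seteqP; split=> [v [vb va]|v [va vb]].
      by split=> [|i]; rewrite /= in_itv //=; exact: vb.
    by split=> [j|]; [have := vb j|move: va]; rewrite /= in_itv.
  rewrite setIC; apply: compact_closedI => //.
  apply: preimage_closed; last exact: itv_closed.
  by move=> x _; apply: continuous_sum => i; exact: coord_continuous.
move=> F FF FA.
have FvA : (Rstar_val @ F) A.
  suff : F (Rstar_val @^-1` A) by [].
  apply: filterS FA => x /= /andP[ax xb]; split; last by rewrite -/(l1norm x) ax xb.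
  by move=> j; rewrite Rstar_ge0 (le_trans (coord_le_l1norm x j) xb).
have [v [[vb va] vF]] := Ac _ _ FvA.
have vP : v \in orthant_star R n.+1.
  apply/mem_set; split=> [j|]; first by case/andP: (vb j).
  apply: contraTneq va => ->; rewrite negb_and -ltNge big1 ?a0 // => i _; by rewrite mxE.
pose x : X := exist _ v vP.
have Fx : cluster F x.
  move=> B C FB /nbhs_ballP[e /= e0 eC].
  have FB' : F (Rstar_val @^-1` (Rstar_val @` B)) by apply: filterS FB => y yB; exists y.
  have [_ [[y yB <-] yv]] := vF (Rstar_val @` B) (ball v e) FB' (nbhsx_ballx v e e0).
  by exists y; split => //; apply: eC.
by exists x; split.
Qed.

End Rstar_topology.

(** * Radon regularity of Borel measures *)

Section regularity.
Context (R : realType) (T : ptopologicalType).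
Local Notation BT := (borel T).
Variables (f : {measure set BT -> \bar R}).
Hypothesis haus : hausdorff_space T.
Hypothesis exhaust : forall U : set T, open U -> exists C : nat -> set T,
  [/\ forall m, compact (C m), forall m, closed (C m),
      {homo C : m k / (m <= k)%N >-> m `<=` k} & \bigcup_m C m = U].

Lemma open_borel (U : set T) : open U -> measurable (U : set BT).
Proof. by move=> oU; apply: sub_sigma_algebra. Qed.

Lemma closed_borel (C : set T) : closed C -> measurable (C : set BT).
Proof.
move=> cC; rewrite -(setCK C); apply: (@measurableC _ BT); apply: open_borel.
exact: closed_openC.
Qed.

Lemma inner_regular_open (U : set T) : open U ->
  f U = ereal_sup [set f C | C in [set C : set T | compact C /\ C `<=` U]].
Proof.
move=> oU; apply/eqP; rewrite eq_le; apply/andP; split; last first.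
  apply: ge_ereal_sup => _ [C [cC CU] <-].
  apply: le_measure; rewrite ?inE //; last exact: open_borel.
  by apply: closed_borel; exact: compact_closed.
have [C [cC clC Cnd CU]] := exhaust oU.
have cv := @nondecreasing_cvg_mu _ BT R f C (fun m => closed_borel (clC m)).
have {}cv : (f \o C) m @[m --> \oo] --> f (\bigcup_m C m).
  by apply: cv; [rewrite CU; exact: open_borel|move=> m k mk; apply/subsetPset/Cnd].
rewrite -CU -(cvg_lim _ cv) //; apply: lime_le; first exact: (cvgP _ cv).
apply: nearW => m; apply: ereal_sup_ubound; exists (C m) => //; split=> //.
exact: bigcup_sup.
Qed.

Section outer.
Variable O : set T.
Hypothesis oO : open O.
Hypothesis fO : (f O < +oo)%E.

(** Outer regularity is measured inside [O], where [f] is finite, so that continuity from above can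
    handle countable intersections. *)
Definition outer_approx (A : set BT) := measurable A /\ forall e : R, 0 < e ->
  exists U : set T, [/\ open U, A `<=` U & (f ((U `\` A) `&` O) <= e%:E)%E].

Let mO : measurable (O : set BT) := open_borel oO.

Lemma outer_approx_open (U : set T) : open U -> outer_approx U.
Proof.
move=> oU; split=> [|e e0]; first exact: open_borel.
by exists U; split=> //; rewrite setDv set0I measure0 lee_fin ltW.
Qed.

Lemma outer_approx_bigcup (A : nat -> set BT) :
  (forall i, outer_approx (A i)) -> outer_approx (\bigcup_i A i).
Proof.
move=> hA; split=> [|e e0]; first by apply: bigcup_measurable => i _; case: (hA i).
have ex i : {U : set T | [/\ open U, A i `<=` U & (f ((U `\` A i) `&` O) <= (e / (2 ^ i.+1)%:R)%:E)%E]}.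
  by apply: cid; apply: (hA i).2; rewrite divr_gt0 // ltr0n expn_gt0.
pose U i := sval (ex i).
have UP i : [/\ open (U i), A i `<=` U i & (f ((U i `\` A i) `&` O) <= (e / (2 ^ i.+1)%:R)%:E)%E].
  exact: svalP (ex i).
have mU i : measurable (U i : set BT) by apply: open_borel; case: (UP i).
have mA i : measurable (A i) by case: (hA i).
exists (\bigcup_i U i); split.
- by apply: bigcup_open => i _; case: (UP i).
- by apply: subset_bigcup => i _; case: (UP i).
apply: le_trans (epsilon_trick0 xpredT (ltW e0)).
apply: (@le_trans _ _ (\sum_(i <oo) f ((U i `\` A i) `&` O))%E).
  apply: measure_sigma_subadditive.
  - by move=> i; apply: measurableI => //; exact: measurableD.
  - apply: measurableI => //; apply: measurableD; exact: bigcup_measurable.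
  - move=> x [[[i _ Ui] nA] Ox]; exists i => //; split=> //; split=> // Ai.
    by apply: nA; exists i.
by apply: lee_nneseries => // i _; case: (UP i).
Qed.

Lemma outer_approxI (A B : set BT) : outer_approx A -> outer_approx B -> outer_approx (A `&` B).
Proof.
move=> [mA hA] [mB hB]; split=> [|e e0]; first exact: measurableI.
have e20 : 0 < e / 2 by rewrite divr_gt0.
have [U [oU AU fU]] := hA _ e20; have [V [oV BV fV]] := hB _ e20.
have mU := open_borel oU; have mV := open_borel oV.
exists (U `&` V); split; [exact: openI|exact: setISS|].
rewrite (splitr e) EFinD; apply: le_trans (leeD fU fV).
apply: le_trans (measureU2 _ _ _); last 2 first.
- by apply: measurableI => //; exact: measurableD.
- by apply: measurableI => //; exact: measurableD.
apply: le_measure; rewrite ?inE.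
- by apply: measurableI => //; apply: measurableD; exact: measurableI.
- by apply: measurableU; apply: measurableI => //; exact: measurableD.
- move=> x [[[Ux Vx] nAB] Ox]; have [Ax|nAx] := pselect (A x); last by left.
  by right; split=> //; split=> // Bx; apply: nAB.
Qed.

Lemma outer_approx_bigcap (A : nat -> set BT) :
  (forall i, outer_approx (A i)) -> outer_approx (\bigcap_i A i).
Proof.
move=> hA; have mA i : measurable (A i) by case: (hA i).
have mcap : measurable (\bigcap_i A i) by exact: bigcapT_measurable.
split=> // e e0; pose B k := \big[setI/setT]_(i < k) A i.
have hB k : outer_approx (B k).
  rewrite /B; elim/big_ind: _ => //; first exact/outer_approx_open/openT.
  exact: outer_approxI.
have mB k : measurable (B k) by case: (hB k).
have BE k : B k = \bigcap_(i < k) A i by rewrite bigcap_mkord.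
pose F k : set BT := (B k `\` \bigcap_i A i) `&` O.
have mF k : measurable (F k) by apply: measurableI => //; exact: measurableD.
have F0 : \bigcap_k F k = set0.
  apply/seteqP; split=> // x Fx; have [[_ nA] _] := Fx 0%N I; apply: nA => i _.
  by have [[+ _] _] := Fx i.+1 I; rewrite BE; apply => /=.
have cv : (f \o F) k @[k --> \oo] --> f set0.
  rewrite -F0; apply: (@nonincreasing_cvg_mu _ BT R f) => //.
  - apply: le_lt_trans fO; apply: le_measure; rewrite ?inE //; exact: subIsetr.
  - by rewrite F0; exact: measurable0.
  - move=> m k mk; apply/subsetPset => x [[Bx nA] Ox]; split=> //; split=> //.
    by move: Bx; rewrite !BE => Bx i /= im; apply: Bx; exact: leq_trans mk.
rewrite measure0 in cv; have e20 : 0 < e / 2 by rewrite divr_gt0.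
have [k _ /(_ _ (leqnn k)) fk] : \forall k \near \oo, (f (F k) < (e / 2)%:E)%E.
  apply: (cv [set y | (y < (e / 2)%:E)%E]).
  by apply: open_ereal_lt'; rewrite lte_fin.
have [U [oU BU fU]] := (hB k).2 _ e20; have mU := open_borel oU.
exists U; split=> //.
  by apply: subset_trans BU; rewrite BE => x Ax i _; exact: Ax.
rewrite (splitr e) EFinD; apply: le_trans (leeD fU (ltW fk)).
apply: le_trans (measureU2 _ _ _) => //; last first.
  by apply: measurableI => //; exact: measurableD.
apply: le_measure; rewrite ?inE.
- by apply: measurableI => //; apply: measurableD.
- by apply: measurableU => //; apply: measurableI => //; exact: measurableD.
- move=> x [[Ux nA] Ox]; have [Bx|nBx] := pselect (B k x); last by left.
  by right.
Qed.

(** The sets approximable together with their complement form a sigma-algebra. It contains the open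
    sets, because [exhaust] makes each closed set a countable intersection of open ones. *)
Lemma outer_approx_measurable (A : set BT) : measurable A -> outer_approx A.
Proof.
pose G (A : set BT) := outer_approx A /\ outer_approx (~` A).
suff : <<s (@open T) >> `<=` G by move=> H /H[].
apply: smallest_sub; last first.
  move=> U oU; split; first exact: outer_approx_open.
  have [C [_ clC _ <-]] := exhaust oU.
  rewrite setC_bigcup; apply: outer_approx_bigcap => i.
  by apply: outer_approx_open; exact: closed_openC.
split.
- split; first exact/outer_approx_open/open0.
  by rewrite setC0; exact/outer_approx_open/openT.
- by move=> B [B1 B2]; rewrite setTD; split=> //; rewrite setCK.
- move=> F FG; split; first by apply: outer_approx_bigcup => i; case: (FG i).
  by rewrite setC_bigcup; apply: outer_approx_bigcap => i; case: (FG i).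
Qed.

End outer.

Lemma radon_of_exhaustion (O : nat -> set T) :
  (forall m, open (O m)) -> \bigcup_m O m = setT -> (forall m, (f (O m) < +oo)%E) ->
  (forall C : set T, compact C -> (f C < +oo)%E) -> radon f.
Proof.
move=> oO OT fO fC; split=> // [A mA|]; last exact: inner_regular_open.
apply/eqP; rewrite eq_le; apply/andP; split.
  apply: le_ereal_inf_tmp => _ [U [oU AU] <-].
  by apply: le_measure; rewrite ?inE //; exact: open_borel.
apply/lee_addgt0Pr => e e0.
(* Each piece [O m] gets its own open set with an error summable in [m]; intersecting it with [O m]
   confines the excess to where it was estimated. *)
have ex m : {U : set T | [/\ open U, A `<=` U &
    (f ((U `\` A) `&` O m) <= (e / (2 ^ m.+1)%:R)%:E)%E]}.
  apply: cid; have [_ H] := outer_approx_measurable (oO m) (fO m) mA.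
  by apply: H; rewrite divr_gt0 // ltr0n expn_gt0.
pose V m := sval (ex m).
have VP m : [/\ open (V m), A `<=` V m & (f ((V m `\` A) `&` O m) <= (e / (2 ^ m.+1)%:R)%:E)%E].
  exact: svalP (ex m).
pose U := \bigcup_m (V m `&` O m).
have oU : open U by apply: bigcup_open => m _; apply: openI => //; case: (VP m).
have AU : A `<=` U.
  move=> x Ax; have [m _ Om] : (\bigcup_m O m) x by rewrite OT.
  by exists m => //; split=> //; case: (VP m) => _ AV _; exact: AV.
have mV m : measurable (V m : set BT) by apply: open_borel; case: (VP m).
have mO m : measurable (O m : set BT) by exact: open_borel.
have mU := open_borel oU.
apply: (@le_trans _ _ (f U)); first by apply: ereal_inf_lbound; exists U.
rewrite -[X in f X](setDUK AU) measureU //; [|exact: measurableD|exact: setDIK].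
rewrite leeD2l //; apply: le_trans (epsilon_trick0 xpredT (ltW e0)).
apply: (@le_trans _ _ (\sum_(m <oo) f ((V m `\` A) `&` O m))%E).
  apply: measure_sigma_subadditive.
  - by move=> m; apply: measurableI => //; exact: measurableD.
  - exact: measurableD.
  - by move=> x [[m _ [Vx Ox]] nA]; exists m.
by apply: lee_nneseries => // m _; case: (VP m).
Qed.

End regularity.

Section Rstar_regularity.
Variables (R : realType) (n : nat).
Notation X := (Rstar R n).

Lemma Rstar_hausdorff : hausdorff_space X.
Proof.
move=> x y xy; apply: Rstar_val_inj; apply: norm_hausdorff.
move=> A B /nbhs_ballP[e /= e0 eA] /nbhs_ballP[d /= d0 dB].
have [z [xz yz]] := xy _ _ (nbhsx_ballx x e e0) (nbhsx_ballx y d d0).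
by exists (Rstar_val z); split; [apply: eA|apply: dB].
Qed.

Lemma Rstar_ball_open (x : X) (e : R) : open (ball x e).
Proof.
have -> : ball x e = (@Rstar_val R n) @^-1` (ball (Rstar_val x) e) by [].
have /continuousP := @Rstar_val_continuous R n; apply.
have [e0|e0] := ltP 0 e; first exact: ball_open.
rewrite [ball _ _](_ : _ = set0); first exact: open0.
by apply/seteqP; split=> // v [+ _]; rewrite ltNge e0.
Qed.

Lemma Rstar_exhaust (U : set X) : open U -> exists C : nat -> set X,
  [/\ forall m, compact (C m), forall m, closed (C m),
      {homo C : m k / (m <= k)%N >-> m `<=` k} & \bigcup_m C m = U].
Proof.
(* The points of a compact shell whose ball of radius [m.+1%:R^-1] stays in [U] form a closed set;
   these sets increase and exhaust [U] because [U] is open. *)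
move=> oU; pose C m := [set x : X | m.+1%:R^-1 <= l1norm x <= m.+1%:R] `&`
  [set x : X | ball x m.+1%:R^-1 `<=` U].
have inv_le m k : (m <= k)%N -> (k.+1%:R^-1 <= m.+1%:R^-1 :> R).
  by move=> mk; rewrite lef_pV2 ?posrE // ler_nat.
have shell m : compact [set x : X | m.+1%:R^-1 <= l1norm x <= m.+1%:R].
  by apply: Rstar_shell_compact; rewrite invr_gt0.
have clB m : closed [set x : X | ball x m.+1%:R^-1 `<=` U].
  rewrite -openC (_ : ~` _ = \bigcup_(y in ~` U) ball y m.+1%:R^-1).
    by apply: bigcup_open => y _; exact: Rstar_ball_open.
  apply/seteqP; split=> x /=.
    move=> /existsNP[y /not_implyP[xy nU]]; exists y => //; exact: ball_sym.
  by move=> [y nU yx] xU; apply: nU; apply: xU; exact: ball_sym.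
have clS m := compact_closed Rstar_hausdorff (shell m).
exists C; split.
- by move=> m; exact: compact_closedI.
- by move=> m; exact: closedI.
- move=> m k mk x [/= /andP[x1 x2] xU]; split=> /=.
    by rewrite (le_trans (inv_le _ _ mk) x1) (le_trans x2) // ler_nat.
  by apply: subset_trans xU; apply: le_ball; exact: inv_le.
- apply/seteqP; split=> [x [m _ [_ xU]]|x Ux].
    by apply: xU; apply: ballxx; rewrite invr_gt0.
  have /nbhs_ballP[e /= e0 eU] : nbhs x U by exact: open_nbhs_nbhs.
  near \oo => m; exists m => //; split.
    apply/andP; split.
      apply: ltW; near: m; exact: near_infty_natSinv_lt (PosNum (l1norm_gt0 x)).
    apply: (@le_trans _ _ m%:R); last by rewrite ler_nat.
    near: m; exact: nbhs_infty_ger.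
  apply: subset_trans eU; apply: le_ball; apply: ltW.
  near: m; exact: near_infty_natSinv_lt (PosNum e0).
Unshelve. all: by end_near. Qed.

Lemma Rstar_radon (f : {measure set (borel X) -> \bar R}) :
  (forall C : set X, compact C -> (f C < +oo)%E) -> radon f.
Proof.
move=> fC; pose O m := (@l1norm R n) @^-1` `]m.+1%:R^-1, m.+1%:R[%classic.
have oO m : open (O m).
  have /continuousP := @l1norm_continuous R n; apply; exact: interval_open.
apply: (radon_of_exhaustion Rstar_hausdorff Rstar_exhaust oO) => //.
  apply/seteqP; split=> // x _; near \oo => m; exists m => //; rewrite /O /= in_itv /=.
  apply/andP; split.
    near: m; exact: near_infty_natSinv_lt (PosNum (l1norm_gt0 x)).
  apply: (@lt_trans _ _ m%:R); last by rewrite ltr_nat.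
  near: m; exact: nbhs_infty_gtr.
move=> m; have cS := @Rstar_shell_compact R n m.+1%:R^-1 m.+1%:R.
apply: (@le_lt_trans _ _ (f [set x : X | m.+1%:R^-1 <= l1norm x <= m.+1%:R])).
  apply: le_measure; rewrite ?inE.
  - exact: open_borel.
  - apply: closed_borel; apply: (compact_closed Rstar_hausdorff).
    by apply: cS; rewrite invr_gt0.
  - by move=> x; rewrite /O /= in_itv /= => /andP[/ltW-> /ltW->].
by apply/fC/cS; rewrite invr_gt0.
Unshelve. all: by end_near. Qed.

End Rstar_regularity.

(** * Weak limits of lattice measures *)

Lemma dyadic_truncation (R : realType) (a l t : nat) :
  `|(a %/ 2 ^ t)%:R / 2 ^+ l - a%:R / 2 ^+ (l + t)| < (2 ^+ l)^-1 :> R.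
Proof.
have l0 : 0 < 2 ^+ l :> R by rewrite exprn_gt0.
have t0 : 0 < 2 ^+ t :> R by rewrite exprn_gt0.
have -> : (a %/ 2 ^ t)%:R / 2 ^+ l - a%:R / 2 ^+ (l + t) =
    - ((a %% 2 ^ t)%:R / (2 ^+ l * 2 ^+ t)) :> R.
  rewrite {2}(divn_eq a (2 ^ t)) natrD natrM natrX exprD.
  by field; rewrite !gt_eqF.
rewrite normrN ger0_norm ?divr_ge0 // ?mulr_ge0 ?exprn_ge0 //.
rewrite invfM mulrCA gtr_pMr ?invr_gt0 // ltr_pdivrMr // mul1r -natrX ltr_nat.
by rewrite ltn_mod expn_gt0.
Qed.

(* The data encode the measures [\sum_i h N i * delta_(p N i)] on [2^-N N^d]. *)
Section lattice_measures.
Variables (R : realType) (n : nat).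
Notation X := (Rstar R n).
Variables (I : nat -> finType) (k : forall N, I N -> 'I_n.+1 -> nat).
Variables (p : forall N, I N -> X) (h : forall N, I N -> R) (b C q : R).
Hypothesis k_inj : forall N (i j : I N), k i =1 k j -> i = j.
Hypothesis pE : forall N (i : I N) j, Rstar_val (p i) ord0 j = (k i j)%:R / 2 ^+ N.
Hypothesis p1 : forall N (i : I N), 1 <= l1norm (p i).
Hypothesis h0 : forall N (i : I N), 0 <= h i.
Hypothesis hb : forall N, \sum_(i : I N) h i <= b.
Hypothesis q01 : 0 < q < 1.
Hypothesis tail : forall N t, \sum_(i : I N | 2 ^+ t < l1norm (p i)) h i <= C * q ^+ t.

Local Notation D2 := #|{ffun 'I_n.+1 -> bool}|.
Let c N (i : I N) := code N (k i).

Lemma lattice_code_inj N : injective (@c N).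
Proof. by move=> i j /code_inj; exact: k_inj. Qed.

(** The region [|x| <= 2 ^+ t] meets finitely many cells of level 0, so their codes lie below one
    bound [B] for all [N]; larger codes carry only the tail. *)
Lemma lattice_tight (e : R) : 0 < e ->
  exists j, forall N, \sum_(i : I N | (j <= c i %/ D2 ^ N)%N) h i <= e.
Proof.
move=> e0; have /andP[q0 q1] := q01.
have [t tP] : exists t, C * q ^+ t <= e.
  have : C * q ^+ t @[t --> \oo] --> C * 0.
    by apply: cvgMr; apply: cvg_expr; rewrite ger0_norm // ltW.
  rewrite mulr0 => /cvgr_lt /(_ _ e0) [t _ /(_ t (leqnn t))] /= /ltW te.
  by exists t.
pose B := (\max_(v : {ffun 'I_n.+1 -> 'I_(2 ^ t).+1}) code 0 (fun j => v j : nat)).+1.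
exists B => N; apply: le_trans tP; apply: le_trans (tail N t).
apply: ler_sum_pred => // i; apply: contraTT; rewrite -leNgt -ltnNge => it.
have -> : (c i %/ D2 ^ N)%N = code 0 (fun j => k i j %/ 2 ^ N)%N by rewrite -code_div.
have kt j : (k i j %/ 2 ^ N < (2 ^ t).+1)%N.
  rewrite ltnS -(@leq_pmul2r (2 ^ N)) ?expn_gt0 //.
  apply: leq_trans (leq_trunc_div _ _) _.
  rewrite -(ler_nat R) natrM !natrX -ler_pdivrMr ?exprn_gt0 // -pE.
  exact: le_trans (coord_le_l1norm _ _) it.
rewrite ltnS (_ : code 0 _ = code 0 (fun j => [ffun j => Ordinal (kt j)] j : nat)).
  exact: (leq_bigmax [ffun j => Ordinal (kt j)]).
by apply: eq_code => j; rewrite ffunE.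
Qed.

(** Beyond the total mass the value is [point], whose coordinates are all 1, so bounds valid for
    norms at least 1 apply without exception. *)
Definition lattice_point N (s : R) : X := oapp (@p N) point (quantile (@c N) (@h N) s).

Lemma lattice_point_ge1 N s : 1 <= l1norm (lattice_point N s).
Proof.
rewrite /lattice_point; case: quantile => [i|] /=; first exact: p1.
have -> : l1norm (point : X) = \sum_(j < n.+1) 1.
  by apply: eq_bigr => j _; rewrite mxE.
by rewrite big_ord_recl lerDl sumr_ge0.
Qed.

Lemma lattice_subsequence : exists (sigma : nat -> nat) (H : R) (Z : set R) (Y : R -> X),
  [/\ forall m, (m <= sigma m)%N, 0 <= H <= b, countable Z & forall s, 0 <= s -> ~ Z s ->
    (s < H -> lattice_point (sigma m) s @[m --> \oo] --> Y s /\
       \forall m \near \oo, quantile (@c (sigma m)) (@h (sigma m)) s != None) /\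
    (H <= s -> \forall m \near \oo, quantile (@c (sigma m)) (@h (sigma m)) s = None)].
Proof.
have [sigma [sn [H [Z [H0 cH cZ ZH HP]]]]] :=
  quantile_cvg (code_base_gt0 'I_n.+1) lattice_code_inj h0 hb lattice_tight.
have Hb : H <= b.
  by rewrite -(cvg_lim _ cH) //; apply: limr_le; [exact: (cvgP _ cH)|exact: nearW].
have point_lim s : {y : X | 0 <= s < H -> ~ Z s ->
    lattice_point (sigma m) s @[m --> \oo] --> y}.
  apply: cid; have [/andP[s0 sH]|] := boolP (0 <= s < H); last by exists point.
  have [Zs|nZ] := pselect (Z s); first by exists point.
  suff cy j : cvgn (fun m => Rstar_val (lattice_point (sigma m) s) ord0 j).
    pose v : 'rV[R]_n.+1 := \row_j lim (Rstar_val (lattice_point (sigma m) s) ord0 j @[m --> \oo]).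
    have v1 : 1 <= \sum_j v ord0 j.
      have cv : \sum_j Rstar_val (lattice_point (sigma m) s) ord0 j @[m --> \oo] --> \sum_j v ord0 j.
        apply: (@cvg_big R 'I_n.+1 +%R 0 xpredT _ nat \oo (index_enum _)
          (fun j m => Rstar_val (lattice_point (sigma m) s) ord0 j) (fun j => v ord0 j)).
          exact: add_continuous.
        by move=> j _; rewrite mxE; exact: cy.
      rewrite -(cvg_lim _ cv) //; apply: limr_ge; first exact: (cvgP _ cv).
      by apply: nearW => m; exact: lattice_point_ge1.
    have vP : v \in orthant_star R n.+1.
      apply/mem_set; split=> [j|]; last first.
        by apply: contraTneq v1 => ->; rewrite big1 ?ler10 // => j _; rewrite mxE.
      by rewrite mxE; apply: limr_ge; [exact: cy|apply: nearW => m; exact: Rstar_ge0].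
    exists (exist _ v vP) => _ _; apply: Rstar_cvgP => j.
    by rewrite [X in _ --> X]mxE; exact: cy.
  (* Once the cell of level [l] has settled, all later coordinates lie within [2 ^- l] of those of
     its corner. *)
  apply/cauchy_cvgP/cauchy_exP => e /= e0.
  have [l le] : exists l, (2 ^+ l)^-1 < e :> R.
    have [l _ /(_ l (leqnn l)) /= le] := near_infty_natSinv_lt (PosNum e0).
    exists l; apply: le_lt_trans le.
    by rewrite lef_pV2 ?posrE ?exprn_gt0 // -natrX ler_nat ltn_expl.
  have [m mP] := HP s ltac:(by rewrite s0) nZ l.
  have {}mP : \forall r \near \oo, (l <= sigma r)%N /\ exists2 i,
      quantile (@c (sigma r)) (@h (sigma r)) s = Some i &
      code l (fun j => k i j %/ 2 ^ (sigma r - l))%N = m.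
    near=> r; have lr : (l <= sigma r)%N.
      by apply: leq_trans (sn r); near: r; exact: nbhs_infty_ge.
    split=> //; have [|i iq im] := near mP r; first by [].
    by exists i => //; rewrite -code_div subnKC.
  have [r0 [_ [i0 _ m0]]] := filter_ex mP.
  exists ((k i0 j %/ 2 ^ (sigma r0 - l))%:R / 2 ^+ l).
  apply: filterS mP => r [lr [i iq im]] /=.
  rewrite /lattice_point iq /= pE.
  have /code_inj/(_ j) -> := etrans m0 (esym im).
  by apply: lt_trans le; have := dyadic_truncation R (k i j) l (sigma r - l); rewrite subnKC.
pose Y s := sval (point_lim s).
exists sigma, H, Z, Y; split=> //; first by rewrite H0.
move=> s s0 nZ; split=> [sH|Hs]; last first.
  (* [H] belongs to [Z], so the inequality is strict and the total masses eventually fall below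
     [s]. *)
  have Hs' : H < s.
    by rewrite lt_neqAle Hs andbT; apply/eqP => Hse; apply: nZ; rewrite -Hse.
  have /cvgr_lt/(_ _ Hs') := cH; apply: filterS => m /ltW.
  exact: (quantile_none (@lattice_code_inj _) (@h0 _)).
split; first by apply: (svalP (point_lim s)) => //; rewrite s0.
have [m] := HP s ltac:(by rewrite s0) nZ 0%N.
by apply: filterS => r [i ->].
Unshelve. all: by end_near. Qed.

Section limit.
Variables (sigma : nat -> nat) (H : R) (Z : set R) (Y : R -> X).
Hypothesis Hb : 0 <= H <= b.
Hypothesis cZ : countable Z.
Hypothesis YP : forall s, 0 <= s -> ~ Z s ->
    (s < H -> lattice_point (sigma m) s @[m --> \oo] --> Y s /\
       \forall m \near \oo, quantile (@c (sigma m)) (@h (sigma m)) s != None) /\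
    (H <= s -> \forall m \near \oo, quantile (@c (sigma m)) (@h (sigma m)) s = None).

Local Notation quant m := (quantile (@c (sigma m)) (@h (sigma m))).
Local Notation D := (`[0, b] `\` Z).
Local Notation D' := (`[0, H[ `\` Z).

Let mZ : measurable Z. Proof. exact: countable_measurable. Qed.
Let mD : measurable D. Proof. by apply: measurableD => //; exact: measurable_itv. Qed.
Let mD' : measurable D'. Proof. by apply: measurableD => //; exact: measurable_itv. Qed.

Lemma limit_point_measurable : measurable_fun D' (Y : R -> borel X).
Proof.
apply: (@measurability _ _ _ (borel X) D' Y (@open X)) => //.
move=> _ [U oU <-].
(* [Y s] is in [U] exactly when balls of one fixed radius about all late atoms are in [U]; this is a
   countable combination of the sets [A r m]. *)
pose A r m := [set s | exists2 i, quant m s = Some i & ball (p i) r.+1%:R^-1 `<=` U].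
have mA r m : measurable (A r m).
  pose F (i : I (sigma m)) : R := if pselect (ball (p i) r.+1%:R^-1 `<=` U) then 1 else 0.
  have -> : A r m = setT `&` (oapp F 0 \o quant m) @^-1` [set 1].
    rewrite setTI; apply/seteqP; split=> s /=.
      by move=> [i -> iU] /=; rewrite /F; case: pselect.
    case E : (quant m s) => [i|] /=; last by move/esym/eqP; rewrite oner_eq0.
    rewrite /F; case: pselect => [iU _|_ /esym/eqP]; last by rewrite oner_eq0.
    by exists i.
  by apply: measurable_oapp_quantile => //; exact: lattice_code_inj.
have -> : D' `&` Y @^-1` U = D' `&` \bigcup_r \bigcup_N \bigcap_(m in [set m | (N <= m)%N]) A r m.
  apply/seteqP; split=> s [sD' /= sU]; split=> //.
    have [/= sH nZ] := sD'; move: sH; rewrite in_itv /= => /andP[s0 sH].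
    have [cY qN] := (YP s0 nZ).1 sH.
    have /nbhs_ballP[e /= e0 eU] : nbhs (Y s) U by exact: open_nbhs_nbhs.
    have e20 : 0 < e / 2 by rewrite divr_gt0.
    have [r _ /(_ r (leqnn r)) /= re] := near_infty_natSinv_lt (PosNum e20).
    move/cvg_ballP: cY => /(_ _ e20) cY.
    have [N _ NP] := filterI cY qN.
    exists r => //; exists N => // m /= Nm; have [/= cm] := NP m Nm.
    move: cm; rewrite /lattice_point; case E : (quant m s) => [i|] //= ci _.
    exists i => // y iy; apply: eU; rewrite (splitr e).
    apply: ball_triangle ci _; exact: le_ball (ltW re) _ iy.
  have [/= sH nZ] := sD'; move: sH; rewrite in_itv /= => /andP[s0 sH].
  have [cY qN] := (YP s0 nZ).1 sH.
  have [r _ [N _ NP]] := sU.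
  move/cvg_ballP: cY => /(_ r.+1%:R^-1 ltac:(by rewrite invr_gt0)) [N' _ N'P].
  have [i iq iU] := NP (maxn N N') (leq_maxl _ _); apply: iU.
  have := N'P (maxn N N') (leq_maxr _ _); rewrite /= /lattice_point iq /=.
  exact: ball_sym.
apply: measurableI => //; apply: bigcup_measurable => r _.
by apply: bigcup_measurable => N _; apply: bigcap_measurable => //; exists N => /=.
Qed.

(** On the fixed interval [[0, b]] one constant dominates although the total masses vary; the
    countable set [Z] is negligible. *)
Lemma quantile_dct (F : forall m, I (sigma m) -> R) (g : R -> R) (B : R) :
  (forall m i, `|F m i| <= B) ->
  (forall s, D s -> oapp (F m) 0 (quant m s) @[m --> \oo] --> g s) ->
  [/\ measurable_fun D g, lebesgue_measure.-integrable D (EFin \o g) &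
      (\sum_i h i * F m i)%:E @[m --> \oo] --> (\int[lebesgue_measure]_(s in D) (g s)%:E)%E].
Proof.
move=> FB cF; pose u m s := oapp (F m) 0 (quant m s).
have mu m : measurable_fun D (u m).
  by apply: measurable_oapp_quantile => //; exact: lattice_code_inj.
have mg : measurable_fun D g by apply: (measurable_fun_cvg mu).
(* The value 0 taken beyond the total mass must obey the bound as well. *)
have B0 : 0 <= Num.max B 0 by rewrite le_max lexx orbT.
have ub m s : `|u m s| <= Num.max B 0.
  rewrite /u; case: quantile => [i|] /=; last by rewrite normr0.
  by rewrite le_max FB.
have bfin : (lebesgue_measure `[0%R, b]%classic < +oo)%E.
  by rewrite lebesgue_measure_itv /=; case: ifP => _; rewrite -?EFinB ltry.
have Dfin : (lebesgue_measure D < +oo)%E.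
  apply: le_lt_trans bfin.
  by apply: le_measure; rewrite ?inE //; exact: measurable_itv.
have iB : lebesgue_measure.-integrable D (cst (Num.max B 0)%:E).
  apply/integrableP; split; first exact: measurable_cst.
  under eq_integral do rewrite /= ger0_norm //.
  by rewrite integral_cst // lte_mul_pinfty // lee_fin.
have [ig _ cg] := @dominated_convergence _ _ R lebesgue_measure D mD
  (fun m => EFin \o u m) (EFin \o g) (cst (Num.max B 0)%:E)
  ltac:(by move=> m; apply/measurable_EFinP; exact: mu) ltac:(by apply/measurable_EFinP)
  ltac:(by apply: aeW => s Ds; apply: cvg_EFin; [exact: nearW|exact: cF])
  iB ltac:(by apply: aeW => s m _; rewrite /= lee_fin).
split=> //; suff E m : (\sum_i h i * F m i)%:E = (\int[lebesgue_measure]_(s in D) (u m s)%:E)%E.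
  by under eq_fun do rewrite E.
have sub : `[0, \sum_(j : I (sigma m)) h j[%classic `<=` `[0, b]%classic.
  move=> s; rewrite /= !in_itv /= => /andP[-> /ltW sh].
  exact: le_trans sh (hb _).
rewrite -(integral_quantile (@lattice_code_inj _) (@h0 _) _ (measurable_itv _) sub).
rewrite (@negligible_integral _ _ _ lebesgue_measure _ Z) //.
- apply/integrableP; split; first by apply/measurable_EFinP; apply: measurable_oapp_quantile => //; exact: lattice_code_inj.
  apply: (@le_lt_trans _ _ (\int[lebesgue_measure]_(s in `[0%R, b]) (Num.max B 0)%:E)%E).
    apply: ge0_le_integral => //.
      apply: measurableT_comp => //; apply/measurable_EFinP.
      by apply: measurable_oapp_quantile => //; exact: lattice_code_inj.
    by move=> s _ /=; rewrite lee_fin; exact: ub.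
  by rewrite integral_cst //; apply: lte_mul_pinfty => //; rewrite ?lee_fin.
- exact: countable_lebesgue_measure0.
Qed.

Lemma limit_domainE : D `&` `[0, H[ = D' :> set R.
Proof.
have /andP[_ Hb'] := Hb; apply/seteqP; split=> [s [[_ nZ] sH]//|s [sH nZ]].
split=> //; split=> //; move: sH; rewrite /= !in_itv /= => /andP[-> sH].
by rewrite (le_trans (ltW sH)).
Qed.

Lemma quantile_eval_cvg (t : R) (F : forall m, I (sigma m) -> R) (Psi : nat -> X -> R) (l : R) :
  (forall m i, F m i = Psi m (p i)) -> D t -> t < H ->
  Psi m (lattice_point (sigma m) t) @[m --> \oo] --> l ->
  oapp (F m) 0 (quant m t) @[m --> \oo] --> l.
Proof.
move=> FE [/= ]; rewrite in_itv /= => /andP[t0 _] nZ tH cl.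
have [_ qN] := (YP t0 nZ).1 tH.
apply: cvg_trans cl; apply: near_eq_cvg; apply: filterS qN => m.
by rewrite /lattice_point; case: (quant m t) => [i|] //= _; rewrite FE.
Qed.

Lemma quantile_eval_cvg0 (t : R) (F : forall m, I (sigma m) -> R) :
  D t -> H <= t -> oapp (F m) 0 (quant m t) @[m --> \oo] --> (0 : R).
Proof.
move=> [/= ]; rewrite in_itv /= => /andP[t0 _] nZ Ht.
have qN := (YP t0 nZ).2 Ht.
by apply: cvg_near_cst; apply: filterS qN => m ->.
Qed.

Lemma limit_norm_ge1 (s : R) : D' s -> 1 <= l1norm (Y s).
Proof.
move=> [/= ]; rewrite in_itv /= => /andP[s0 sH] nZ.
have [cs _] := (YP s0 nZ).1 sH.
have cl : l1norm (lattice_point (sigma m) s) @[m --> \oo] --> l1norm (Y s).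
  exact: (cvg_comp _ _ cs (@l1norm_continuous R n (Y s))).
rewrite -(cvg_lim _ cl) //; apply: limr_ge; first exact: (cvgP _ cl).
by apply: nearW => m; exact: lattice_point_ge1.
Qed.

Lemma lattice_limit (psi : X -> R) (B : R) :
  (forall x, 1 <= l1norm x -> `|psi x| <= B) -> continuous psi ->
  (\sum_(i : I (sigma m)) h i * psi (p i))%:E @[m --> \oo] -->
  (\int[lebesgue_measure]_(s in D') (psi (Y s))%:E)%E.
Proof.
move=> pB pc; pose g s := if s < H then psi (Y s) else 0.
have [_ _] : [/\ measurable_fun D g, lebesgue_measure.-integrable D (EFin \o g) &
    (\sum_(i : I (sigma m)) h i * psi (p i))%:E @[m --> \oo] -->
    (\int[lebesgue_measure]_(s in D) (g s)%:E)%E].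
  apply: (@quantile_dct (fun m (i : I (sigma m)) => psi (p i)) g B).
    by move=> m i; exact: pB.
  move=> s Ds; rewrite /g; case: ltP => [sH|Hs]; last exact: quantile_eval_cvg0.
  apply: (@quantile_eval_cvg s _ (fun m x => psi x)) => //.
  have [/= + nZs] := Ds; rewrite in_itv /= => /andP[s0 _].
  have [cs _] := (YP s0 nZs).1 sH.
  exact: (cvg_comp _ _ cs (pc (Y s))).
rewrite -[in X in _ -> X]limit_domainE [X in _ -> _ --> X]integral_mkcondr.
rewrite [X in _ -> _ --> X](_ : _ = (\int[lebesgue_measure]_(s in D) (g s)%:E)%E) //.
apply: eq_integral => s; rewrite inE => Ds.
rewrite /patch mem_setE in_itv /= /g; have [/= + nZs] := Ds; rewrite in_itv /= => /andP[s0 _].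
by rewrite s0 /=; case: ifP.
Qed.

(** For fixed [t] the argument [lattice_point (sigma m) t] moves with [m], which the joint
    continuity of [Psi] permits. The inner limits then serve as pointwise limits in a second
    dominated convergence. *)
Lemma lattice_double_limit (Psi : X -> X -> R) (B : R) :
  (forall x y, 1 <= l1norm x -> 1 <= l1norm y -> `|Psi x y| <= B) ->
  continuous (fun z : X * X => Psi z.1 z.2) ->
  (\sum_(j : I (sigma m)) h j * (\sum_(i : I (sigma m)) h i * Psi (p i) (p j)))%:E @[m --> \oo] -->
  (\int[lebesgue_measure]_(t in D') \int[lebesgue_measure]_(s in D') (Psi (Y s) (Y t))%:E)%E.
Proof.
move=> PB Pc.
pose g t s := if s < H then Psi (Y s) (Y t) else 0.
have inner t : D t -> t < H ->
    lebesgue_measure.-integrable D (EFin \o g t) /\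
    (\sum_(i : I (sigma m)) h i * Psi (p i) (lattice_point (sigma m) t))%:E @[m --> \oo] -->
    (\int[lebesgue_measure]_(s in D) (g t s)%:E)%E.
  move=> Dt tH; have [_ ig cg] : [/\ measurable_fun D (g t),
      lebesgue_measure.-integrable D (EFin \o g t) &
      (\sum_(i : I (sigma m)) h i * Psi (p i) (lattice_point (sigma m) t))%:E @[m --> \oo] -->
      (\int[lebesgue_measure]_(s in D) (g t s)%:E)%E].
    apply: (@quantile_dct (fun m (i : I (sigma m)) => Psi (p i) (lattice_point (sigma m) t)) (g t) B).
      by move=> m i; apply: PB => //; exact: lattice_point_ge1.
    move=> s Ds; rewrite /g; case: ltP => [sH|Hs]; last exact: quantile_eval_cvg0.
    apply: (@quantile_eval_cvg s _ (fun m x => Psi x (lattice_point (sigma m) t))) => //.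
    have [/= + nZs] := Ds; rewrite in_itv /= => /andP[s0 _].
    have [/= + nZt] := Dt; rewrite in_itv /= => /andP[t0 _].
    have [cs _] := (YP s0 nZs).1 sH; have [ct _] := (YP t0 nZt).1 tH.
    have cp : (lattice_point (sigma m) s, lattice_point (sigma m) t) @[m --> \oo] --> (Y s, Y t).
      by have := cvg_pair cs ct; apply; exact: nbhs_filter.
    exact: (cvg_comp _ _ cp (Pc (Y s, Y t))).
  by [].
pose G t := if t < H then fine (\int[lebesgue_measure]_(s in D) (g t s)%:E)%E else 0.
have [_ _ cG] : [/\ measurable_fun D G,
      lebesgue_measure.-integrable D (EFin \o G) &
      (\sum_(j : I (sigma m)) h j * (\sum_(i : I (sigma m)) h i * Psi (p i) (p j)))%:E @[m --> \oo] -->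
      (\int[lebesgue_measure]_(t in D) (G t)%:E)%E].
  apply: (@quantile_dct (fun m (j : I (sigma m)) => \sum_(i : I (sigma m)) h i * Psi (p i) (p j)) G (b * B)).
    move=> m j; apply: le_trans (ler_norm_sum _ _ _) _.
    have B0 : 0 <= B by apply: le_trans (PB (p j) (p j) (p1 j) (p1 j)).
    apply: (@le_trans _ _ (\sum_(i : I (sigma m)) h i * B)).
      by apply: ler_sum => i _; rewrite normrM ger0_norm // ler_wpM2l // PB.
    by rewrite -mulr_suml ler_wpM2r.
  move=> t Dt; rewrite /G; case: ltP => [tH|Ht]; last exact: quantile_eval_cvg0.
  apply: (@quantile_eval_cvg t _ (fun m y => \sum_(i : I (sigma m)) h i * Psi (p i) y)) => //.
  have [ig cg] := inner t Dt tH.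
  have fg : (\int[lebesgue_measure]_(s in D) (g t s)%:E)%E \is a fin_num.
    exact: integrable_fin_num.
  by move: cg; rewrite -[X in _ --> X -> _](fineK fg) => /fine_cvg.
rewrite [X in _ --> X](_ : _ = (\int[lebesgue_measure]_(t in D) (G t)%:E)%E) //.
rewrite -[in LHS]limit_domainE [LHS]integral_mkcondr; apply: eq_integral => t; rewrite inE => Dt.
rewrite /patch mem_setE in_itv /= /G; have [/= + nZ] := Dt; rewrite in_itv /= => /andP[t0 _].
rewrite t0 /=; case: ifPn => // tH; rewrite fineK; last first.
  by have [ig _] := inner t Dt tH; exact: integrable_fin_num.
rewrite integral_mkcondr; apply: eq_integral => s; rewrite inE => Ds.
rewrite /patch mem_setE in_itv /= /g; have [/= + nZs] := Ds; rewrite in_itv /= => /andP[s0 _].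
by rewrite s0 /=; case: ifP.
Qed.

End limit.

Lemma lattice_weak_limit : exists (sigma : nat -> nat) (D : set R) (Y : R -> X),
  [/\ forall m, (m <= sigma m)%N, measurable D, (lebesgue_measure D < +oo)%E,
      measurable_fun D (Y : R -> borel X) & forall s, D s -> 1 <= l1norm (Y s)] /\
  (forall (psi : X -> R) (B : R), (forall x, 1 <= l1norm x -> `|psi x| <= B) -> continuous psi ->
    (\sum_(i : I (sigma m)) h i * psi (p i))%:E @[m --> \oo] -->
    (\int[lebesgue_measure]_(s in D) (psi (Y s))%:E)%E) /\
  (forall (Psi : X -> X -> R) (B : R),
    (forall x y, 1 <= l1norm x -> 1 <= l1norm y -> `|Psi x y| <= B) ->
    continuous (fun z : X * X => Psi z.1 z.2) ->
    (\sum_(j : I (sigma m)) h j * (\sum_(i : I (sigma m)) h i * Psi (p i) (p j)))%:E @[m --> \oo] -->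
    (\int[lebesgue_measure]_(t in D) \int[lebesgue_measure]_(s in D) (Psi (Y s) (Y t))%:E)%E).
Proof.
have [sigma [H [Z [Y [sm Hb cZ YP]]]]] := lattice_subsequence.
have mD : measurable (`[0, H[ `\` Z).
  by apply: measurableD; [exact: measurable_itv|exact: countable_measurable].
exists sigma, (`[0, H[ `\` Z), Y; split; split=> //.
- apply: (@le_lt_trans _ _ (lebesgue_measure (`[0%R, H[ : set R))).
    by apply: le_measure; rewrite ?inE //; exact: subDsetl.
  by rewrite lebesgue_measure_itv /=; case: ifP => _; rewrite ?sube0 ltry.
- exact: (limit_point_measurable cZ YP).
- exact: (limit_norm_ge1 YP).
- move=> psi B; exact: (lattice_limit Hb cZ YP).
- move=> Psi B; exact: (lattice_double_limit Hb cZ YP).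
Qed.

End lattice_measures.

(* [v] stands for the point [2^-N v], whose norm lies between [1] and [2^N]. *)
Definition lattice (n N : nat) : finType :=
  {v : {ffun 'I_n.+1 -> 'I_(4 ^ N).+1} | (2 ^ N <= \sum_j v j <= 4 ^ N)%N}.

(** * Lattice points and their truncated addition *)

Section lattice.
Variables (R : realType) (n N : nat).
Notation X := (Rstar R n).
Implicit Types v u : lattice n N.

Definition lattice_coord v (j : 'I_n.+1) : nat := val v j.

Lemma lattice_coord_inj v u : lattice_coord v =1 lattice_coord u -> v = u.
Proof. by move=> vu; apply/val_inj/ffunP => j; apply/val_inj/vu. Qed.

Let lrow v : 'rV[R]_n.+1 := \row_j ((lattice_coord v j)%:R / 2 ^+ N).

Let lrowE v j : lrow v ord0 j = (lattice_coord v j)%:R / 2 ^+ N.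
Proof. exact: mxE. Qed.

Let lrow_sum v : \sum_j lrow v ord0 j = (\sum_j lattice_coord v j)%:R / 2 ^+ N.
Proof. by rewrite (eq_bigr _ (fun j _ => lrowE v j)) -mulr_suml natr_sum. Qed.

Lemma lattice_norm_bounds v :
  (1 : R) <= (\sum_j lattice_coord v j)%:R / 2 ^+ N <= (2 : R) ^+ N.
Proof.
have /andP[v1 v2] := valP v.
rewrite ler_pdivlMr ?exprn_gt0 // ler_pdivrMr ?exprn_gt0 // mul1r -exprD addnn -mul2n exprM.
by rewrite -!natrX !ler_nat v1.
Qed.

Let lrow_mem v : lrow v \in orthant_star R n.+1.
Proof.
apply/mem_set; split=> [j|]; first by rewrite lrowE divr_ge0 // exprn_ge0.
apply: contraTneq (lattice_norm_bounds v) => v0.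
by rewrite -lrow_sum v0 big1 ?ler10 // => j _; rewrite mxE.
Qed.

Definition lattice_pt v : X := exist _ (lrow v) (lrow_mem v).

Lemma lattice_ptE v j : Rstar_val (lattice_pt v) ord0 j = (lattice_coord v j)%:R / 2 ^+ N.
Proof. exact: lrowE. Qed.

Lemma lattice_pt_norm v : 1 <= l1norm (lattice_pt v) <= 2 ^+ N.
Proof. by rewrite /l1norm lrow_sum lattice_norm_bounds. Qed.

Definition lattice_add v u : option (lattice n N) :=
  if (\sum_j (lattice_coord v j + lattice_coord u j) <= 4 ^ N)%N
  then insub [ffun j => inord (lattice_coord v j + lattice_coord u j)%N] else None.

Variant lattice_add_spec v u : option (lattice n N) -> Prop :=
  | LatticeAddSome w of lattice_pt w = Rstar_add (lattice_pt v) (lattice_pt u) :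
      lattice_add_spec v u (Some w)
  | LatticeAddNone of 2 ^+ N < l1norm (lattice_pt v) + l1norm (lattice_pt u) :
      lattice_add_spec v u None.

Lemma lattice_addP v u : lattice_add_spec v u (lattice_add v u).
Proof.
rewrite /lattice_add; case: ifPn => [vu|].
  have cE j : (lattice_coord v j + lattice_coord u j)%N =
      [ffun j => inord (lattice_coord v j + lattice_coord u j)%N : 'I_(4 ^ N).+1] j :> nat.
    rewrite ffunE inordK // ltnS; apply: leq_trans vu.
    by rewrite [leqRHS](bigD1 j) //= leq_addr.
  case: insubP => [w _ wE|].
    apply: LatticeAddSome; apply: Rstar_val_inj; apply/rowP => j.
    rewrite [RHS]mxE -/(Rstar_val _) !lattice_ptE -mulrDl -natrD; congr (_%:R / _).
    by rewrite cE -wE.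
  (* A sum cannot fall below the lower bound, which one summand already satisfies. *)
  case/negP; under eq_bigr do rewrite -cE; rewrite vu andbT.
  have /andP[v1 _] := valP v; apply: leq_trans v1 _.
  by apply: leq_sum => j _; exact: leq_addr.
rewrite -ltnNge big_split /= => vu; apply: LatticeAddNone.
rewrite /l1norm !lrow_sum -mulrDl ltr_pdivlMr ?exprn_gt0 // -exprD addnn -mul2n exprM.
by rewrite -!natrX -natrD ltr_nat.
Qed.

End lattice.

(** * Rounding up and the discretised source *)

Section rounding.
Variables (R : realType) (n : nat).
Notation X := (Rstar R n).

Lemma nat_ceil_ex (y : R) : 0 <= y -> exists m : nat, m%:R - 1 < y <= m%:R.
Proof.
move=> y0; have ex : exists m : nat, y <= m%:R.
  by have [m _ my] := nbhs_infty_ger y; exists m; apply: my => /=.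
case: (ex_minnP ex) => -[|m] my mmin.
  by exists 0%N; rewrite my andbT; lra.
exists m.+1; rewrite my andbT.
rewrite -natr1 addrK ltNge; apply/negP => /mmin; by rewrite ltnn.
Qed.

Variable N : nat.

(** Half-open cubes with the lattice point at the upper corner: rounding upwards never brings a norm
    below 1. *)
Definition ceil_cell (v : lattice n N) : set X :=
  [set x | forall j, (lattice_coord v j)%:R - 1 < 2 ^+ N * Rstar_val x ord0 j <= (lattice_coord v j)%:R].

Lemma ceil_cell_inj v u x : ceil_cell v x -> ceil_cell u x -> v = u.
Proof.
move=> vx ux; apply: lattice_coord_inj => j; apply/eqP.
have /andP[v1 v2] := vx j; have /andP[u1 u2] := ux j.
have A : (lattice_coord v j)%:R < (lattice_coord u j).+1%:R :> R by rewrite -natr1; lra.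
have B : (lattice_coord u j)%:R < (lattice_coord v j).+1%:R :> R by rewrite -natr1; lra.
by rewrite eqn_leq -ltnS -(ltr_nat R) A -ltnS -(ltr_nat R) B.
Qed.

Lemma measurable_ceil_cell v : measurable (ceil_cell v : set (borel X)).
Proof.
have -> : ceil_cell v = \bigcap_j ((fun x : X => 2 ^+ N * Rstar_val x ord0 j) @^-1`
    `]((lattice_coord v j)%:R - 1), (lattice_coord v j)%:R]).
  apply/seteqP; split=> x vx j; first by move=> _; rewrite /= in_itv /=; exact: vx.
  by have := vx j I; rewrite /= in_itv.
apply: fin_bigcap_measurable => // j _.
rewrite -[X in measurable X]setTI.
have mc : measurable_fun setT ((fun x : X => 2 ^+ N * Rstar_val x ord0 j) : borel X -> R).
  apply: continuous_borel_measurable; apply: continuous_mul; first exact: cst_continuous.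
  exact: Rstar_coord_continuous.
by apply: mc => //; exact: measurable_itv.
Qed.

Lemma ceil_cell_close v x j : ceil_cell v x ->
  0 <= Rstar_val (lattice_pt R v) ord0 j - Rstar_val x ord0 j <= 2 ^- N.
Proof.
move=> /(_ j) /andP[v1 v2]; rewrite lattice_ptE.
have N0 : 0 < 2 ^+ N :> R by rewrite exprn_gt0.
have -> : (lattice_coord v j)%:R / 2 ^+ N - Rstar_val x ord0 j =
    ((lattice_coord v j)%:R - 2 ^+ N * Rstar_val x ord0 j) / 2 ^+ N.
  by field; rewrite gt_eqF.
rewrite divr_ge0 ?subr_ge0 ?(ltW N0) //= ler_pdivrMr // mulVf ?gt_eqF //; lra.
Qed.

Lemma ceil_cell_norm v x : ceil_cell v x ->
  l1norm x <= l1norm (lattice_pt R v) <= l1norm x + n.+1%:R.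
Proof.
move=> vx; have N1 : 2 ^- N <= 1 :> R by rewrite invf_le1 ?exprn_gt0 // exprn_ege1 // ler1n.
have vj j := ceil_cell_close j vx.
apply/andP; split.
  by apply: ler_sum => j _; have /andP[] := vj j; rewrite subr_ge0.
rewrite -[X in _ + X%:R]card_ord -sum1_card natr_sum -big_split /=.
apply: ler_sum => j _; have /andP[_] := vj j; rewrite lerBlDl => H.
by apply: le_trans H _; rewrite lerD2l.
Qed.

(** Rounding raises each coordinate by at most [2 ^- N], hence the margin [n.+1%:R] under the upper
    cut-off. *)
Lemma ceil_cell_ex x : 1 <= l1norm x -> l1norm x + n.+1%:R <= 2 ^+ N ->
  exists v, ceil_cell v x.
Proof.
move=> x1 xN; have N0 : 0 < 2 ^+ N :> R by rewrite exprn_gt0.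
have N1 : 1 <= 2 ^+ N :> R by rewrite exprn_ege1 // ler1n.
pose m j : nat := xchoose (@nat_ceil_ex (2 ^+ N * Rstar_val x ord0 j)
  (mulr_ge0 (ltW N0) (Rstar_ge0 x j))).
have mP j : (m j)%:R - 1 < 2 ^+ N * Rstar_val x ord0 j <= (m j)%:R.
  exact: (xchooseP (@nat_ceil_ex (2 ^+ N * Rstar_val x ord0 j) (mulr_ge0 (ltW N0) (Rstar_ge0 x j)))).
have mlow : (2 ^ N <= \sum_j m j)%N.
  rewrite -(ler_nat R) natrX natr_sum; apply: (@le_trans _ _ (2 ^+ N * l1norm x)).
    by rewrite ler_peMr // ltW.
  by rewrite mulr_sumr; apply: ler_sum => j _; have /andP[] := mP j.
have mhigh : (\sum_j m j <= 4 ^ N)%N.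
  rewrite -(ler_nat R) natrX natr_sum.
  apply: (@le_trans _ _ (2 ^+ N * (l1norm x + n.+1%:R))); last first.
    rewrite (_ : 4%:R = 2 * 2 :> R); last by rewrite -natrM.
    by rewrite exprMn ler_wpM2l // ltW.
  rewrite -[X in _ + X%:R]card_ord -sum1_card natr_sum mulrDr !mulr_sumr -big_split /=.
  by apply: ler_sum => j _; have /andP[+ _] := mP j; rewrite mulr1; move: N1; lra.
have mB j : (m j < (4 ^ N).+1)%N.
  by rewrite ltnS; apply: leq_trans mhigh; rewrite (bigD1 j) //= leq_addr.
have wP : (2 ^ N <= \sum_j [ffun j => Ordinal (mB j)] j <= 4 ^ N)%N.
  by under eq_bigr do rewrite ffunE /=; rewrite mlow mhigh.
exists (exist (fun v : {ffun 'I_n.+1 -> 'I_(4 ^ N).+1} => (2 ^ N <= \sum_j v j <= 4 ^ N)%N)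
  [ffun j => Ordinal (mB j)] wP) => j.
by rewrite /lattice_coord /= ffunE /=; exact: mP.
Qed.

End rounding.

(** Inner regularity reduces this to compact subsets of [U], each covered by finitely many null open
    sets. *)
Lemma radon_support_null (R : realType) (T : ptopologicalType)
    (mu : {measure set (borel T) -> \bar R}) (U : set T) :
  hausdorff_space T -> radon mu -> open U -> U `&` support_measure mu = set0 -> mu U = 0%E.
Proof.
move=> hT [_ _ inner] oU US; rewrite inner //.
apply/eqP; rewrite eq_le; apply/andP; split; last first.
  apply: ereal_sup_ubound; exists set0; last exact: measure0.
  by split; [exact: compact0|].
apply: ge_ereal_sup => _ [C [cC CU] <-].
pose D := [set V : set T | open V /\ mu V = 0%E].
have CD : C `<=` \bigcup_(V in D) V.
  move=> x Cx; have : ~ support_measure mu x.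
    by move=> sx; suff : (set0 : set T) x by []; rewrite -US; split => //; exact: CU.
  move=> /existsNP[V /not_implyP[oV /not_implyP[Vx nV]]]; exists V => //; split=> //.
  by apply/eqP; rewrite -measure_le0 leNgt; apply/negP.
have mC : measurable (C : set (borel T)) by apply: closed_borel; exact: compact_closed.
move: cC; rewrite compact_cover => /(_ _ D id (fun V DV => DV.1) CD)[D' D'D CD'].
have [mD' D'0] : measurable (\bigcup_(V in [set` D']) V : set (borel T)) /\
    mu (\bigcup_(V in [set` D']) V) = 0%E.
  rewrite bigcup_fset big_seq; elim/big_rec: _ => [|V W /D'D]; first by rewrite measure0.
  rewrite inE => -[/open_borel mV V0] [mW W0]; have mVW := measurableU _ _ mV mW.
  have VW := measureU2 mu mV mW; split=> //; apply/eqP; rewrite -measure_le0.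
  by apply: le_trans VW _; rewrite [X in (X + _)%E](V0 : _ = 0%E) [X in (_ + X)%E](W0 : _ = 0%E) adde0.
rewrite -[leRHS]D'0; apply: le_measure; rewrite ?inE //.
Qed.

Section eta.
Variables (R : realType) (n : nat).
Notation X := (Rstar R n).
Variables (eta : {measure set (borel X) -> \bar R}) (L : R).
Hypothesis heta : bounded_radon eta.
Hypothesis eta_support : support_measure eta `<=` [set x | 1 <= l1norm x <= L].

Definition rounded_weight N (v : lattice n N) : R := fine (eta (ceil_cell v)).

Lemma rounded_weight_ge0 N (v : lattice n N) : 0 <= rounded_weight v.
Proof. by rewrite fine_ge0. Qed.

Let A := [set x : X | 1 <= l1norm x <= L].

Let closedA : closed A.
Proof.
have -> : A = @l1norm R n @^-1` `[1, L]%classic.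
  by apply/seteqP; split=> x; rewrite /A /= in_itv.
apply: preimage_closed; last exact: itv_closed.
by move=> x _; exact: l1norm_continuous.
Qed.

Let mAC : measurable (~` A : set (borel X)).
Proof. by apply: open_borel; apply: closed_openC; exact: closedA. Qed.

Lemma eta_null_compl : eta (~` A) = 0%E.
Proof.
apply: radon_support_null; [exact: Rstar_hausdorff|by case: heta|exact: closed_openC|].
by apply/seteqP; split=> // x [nA /eta_support].
Qed.

Let mcell N (v : lattice n N) := @measurable_ceil_cell R n N v.

Lemma eta_cell_fin N (v : lattice n N) : eta (ceil_cell v) \is a fin_num.
Proof.
rewrite ge0_fin_numE //; apply: le_lt_trans heta.2.
by apply: le_measure; rewrite ?inE.
Qed.

Lemma integral_rounded N (F : lattice n N -> R) :
  (\int[eta]_x (\sum_v F v * \1_(ceil_cell v) x)%:E = (\sum_v F v * rounded_weight v)%:E)%E.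
Proof.
under eq_integral do rewrite -sumEFin.
have ind v : eta.-integrable setT (fun x : X => (\1_(ceil_cell (v : lattice n N)) x)%:E).
  apply/integrableP; split.
    by apply/measurable_EFinP; exact: measurable_indic.
  under eq_integral do rewrite /= ger0_norm //.
  by rewrite integral_indic // setIT -ge0_fin_numE // eta_cell_fin.
rewrite integral_sum // => [|v]; last first.
  under eq_fun do rewrite EFinM.
  exact: integrableZl.
rewrite -sumEFin; apply: eq_bigr => v _.
under eq_integral do rewrite EFinM.
by rewrite integralZl // integral_indic // setIT EFinM fineK // eta_cell_fin.
Qed.

Lemma rounded_eval N (F : lattice n N -> R) v (x : X) : ceil_cell v x ->
  \sum_u F u * \1_(ceil_cell u) x = F v.
Proof.
move=> vx; rewrite (bigD1 v) //= indicE mem_set // mulr1 big1 ?addr0 // => u uv.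
by rewrite indicE memNset ?mulr0 // => ux; move/eqP: uv; apply; exact: ceil_cell_inj ux vx.
Qed.

Lemma rounded_eval_bound N (F : lattice n N -> R) (B : R) (x : X) : (forall v, `|F v| <= B) ->
  0 <= B -> `|\sum_u F u * \1_(ceil_cell u) x| <= B.
Proof.
move=> FB B0; have [[v vx]|nv] := pselect (exists v : lattice n N, ceil_cell v x).
  by rewrite (rounded_eval _ vx).
rewrite big1 ?normr0 // => v _; rewrite indicE memNset ?mulr0 // => vx.
by apply: nv; exists v.
Qed.

Lemma measurable_rounded N (F : lattice n N -> R) :
  measurable_fun setT ((fun x : X => \sum_v F v * \1_(ceil_cell v) x) : borel X -> R).
Proof.
apply: measurable_sum => v; apply: measurable_funM => //.
Qed.

Lemma rounded_mass N : \sum_(v : lattice n N) rounded_weight v <= fine (eta setT).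
Proof.
have etaT : eta setT \is a fin_num by rewrite ge0_fin_numE //; exact: heta.2.
rewrite -lee_fin fineK //.
have := integral_rounded (fun _ : lattice n N => 1).
under [in X in _ = X -> _]eq_bigr do rewrite mul1r.
move=> <-; rewrite -[leRHS]mul1e -integral_cst //.
apply: ge0_le_integral => //.
- by move=> x _; rewrite lee_fin sumr_ge0 // => v _; rewrite mulr_ge0.
- by apply/measurable_EFinP; exact: measurable_rounded.
- move=> x _; rewrite /= lee_fin; apply: le_trans (ler_norm _) _.
  by apply: rounded_eval_bound => // v; rewrite normr1.
Qed.

Lemma rounded_first_moment N : 0 <= L ->
  \sum_(v : lattice n N) l1norm (lattice_pt R v) * rounded_weight v <=
  (L + n.+1%:R) * fine (eta setT).
Proof.
move=> L0; apply: (@le_trans _ _ (\sum_(v : lattice n N) (L + n.+1%:R) * rounded_weight v)).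
  apply: ler_sum => v _; have [->|w0] := eqVneq (rounded_weight v) 0; first by rewrite !mulr0.
  rewrite ler_wpM2r ?rounded_weight_ge0 //.
  (* A cell that meets [A] has its corner at norm at most [L + n.+1%:R]; a cell that misses [A] is
     null. *)
  have [[x [vx Ax]]|nx] := pselect (exists x, ceil_cell v x /\ A x).
    have /andP[_ H] := ceil_cell_norm vx; apply: le_trans H _.
    by rewrite lerD2r; have /andP[] := Ax.
  case/negP: w0; rewrite /rounded_weight; suff -> : eta (ceil_cell v) = 0%E by [].
  apply/eqP; rewrite -measure_le0 -eta_null_compl.
  apply: le_measure; rewrite ?inE //.
  by move=> x vx Ax; apply: nx; exists x.
by rewrite -mulr_sumr ler_wpM2l ?addr_ge0 // rounded_mass.
Qed.

Lemma rounded_cvg (phi : X -> R) (B : R) : continuous phi -> (forall x, `|phi x| <= B) ->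
  (\sum_(v : lattice n N) phi (lattice_pt R v) * rounded_weight v)%:E @[N --> \oo] -->
  (\int[eta]_x (phi x)%:E)%E.
Proof.
move=> phic phiB; have B0 : 0 <= B by apply: le_trans (phiB point).
pose f N (x : borel X) := \sum_(v : lattice n N) phi (lattice_pt R v) * \1_(ceil_cell v) x.
have fcvg x : A x -> f N x @[N --> \oo] --> phi x.
  move=> /andP[x1 xL].
  (* [y N] is the rounded point, or [x] itself when no cell of the lattice contains [x]; either way
     it is close to [x]. *)
  pose y N := if pselect (exists v : lattice n N, ceil_cell v x) is left ex
    then lattice_pt R (sval (cid ex)) else x.
  have cy : y N @[N --> \oo] --> x.
    apply: Rstar_cvgP => j.
    suff : Rstar_val (y N) ord0 j @[N --> \oo] --> Rstar_val x ord0 j by [].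
    apply/cvgrPdist_lt => e e0; near=> N.
    have Ne : 2 ^- N < e.
      apply: le_lt_trans (_ : N.+1%:R^-1 < e); last first.
        by near: N; exact: near_infty_natSinv_lt (PosNum e0).
      by rewrite lef_pV2 ?posrE ?exprn_gt0 // -natrX ler_nat ltn_expl.
    rewrite /= /y; case: pselect => [ex|_]; last by rewrite subrr normr0.
    case: (cid ex) => v /= /(ceil_cell_close j) /andP[v1 v2].
    by rewrite distrC ger0_norm // (le_lt_trans v2).
  apply: cvg_trans (cvg_comp _ _ cy (phic x)); apply: near_eq_cvg; near=> N.
  have xN : l1norm x + n.+1%:R <= 2 ^+ N.
    apply: (@le_trans _ _ N%:R); last by rewrite -natrX ler_nat ltnW // ltn_expl.
    by near: N; exact: nbhs_infty_ger.
  rewrite /= /y; case: pselect => [ex|nex]; last by case: nex; exact: ceil_cell_ex.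
  by case: (cid ex) => v /= vx; rewrite /f (rounded_eval (fun v => phi (lattice_pt R v)) vx).
have iB : eta.-integrable setT (cst B%:E).
  apply/integrableP; split; first exact: measurable_cst.
  under eq_integral do rewrite /= ger0_norm //.
  by rewrite integral_cst // lte_mul_pinfty // ?lee_fin //; exact: heta.2.
have [_ _ cI] := @dominated_convergence _ _ R eta setT measurableT
  (fun N => EFin \o f N) (EFin \o phi) (cst B%:E)
  ltac:(by move=> N; apply/measurable_EFinP; exact: measurable_rounded)
  ltac:(by apply/measurable_EFinP; exact: continuous_borel_measurable)
  ltac:(by exists (~` A); split=> //; [exact: eta_null_compl|move=> x nx Ax; apply: nx => _; apply: cvg_EFin; [exact: nearW|exact: fcvg]])
  iB ltac:(by apply: aeW => x N _; rewrite /= lee_fin; apply: rounded_eval_bound).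
suff E N : (\sum_(v : lattice n N) phi (lattice_pt R v) * rounded_weight v)%:E =
    (\int[eta]_x (f N x)%:E)%E by under eq_fun do rewrite E.
by rewrite (integral_rounded (fun v : lattice n N => phi (lattice_pt R v))).
Unshelve. all: by end_near. Qed.

End eta.

(** * Test functions and the reduced kernel *)

Lemma powR_inv (R : realType) (x r : R) : 0 <= x -> x^-1 `^ r = x `^ (- r).
Proof. by move=> x0; rewrite -powR_inv1 // -powRrM mulN1r. Qed.

Lemma powR_between (R : realType) (a x y z : R) : 0 < x -> x <= y <= z ->
  y `^ a <= Num.max (x `^ a) (z `^ a).
Proof.
move=> x0 /andP[xy yz]; have y0 : 0 < y by exact: lt_le_trans xy.
have z0 : 0 < z by exact: lt_le_trans yz.
rewrite le_max; have [a0|a0] := leP 0 a; apply/orP.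
  by right; apply: ge0_ler_powR => //; rewrite nnegrE ltW.
left; rewrite -[a]opprK !(powRN _ (- a)) lef_pV2 ?posrE ?powR_gt0 //.
by apply: ge0_ler_powR => //; rewrite ?nnegrE ?oppr_ge0 ?ltW.
Qed.

Section C1c_facts.
Variables (R : realType) (n : nat) (phi : Rstar R n -> R).
Hypothesis phiC : C1c phi.

Lemma C1c_continuous : continuous phi.
Proof.
have [[U [g [oU sU gC pE]]] _] := phiC.
have -> : phi = g \o @Rstar_val R n by apply/funext => x; rewrite pE.
move=> x; apply: continuous_comp; first exact: Rstar_val_continuous.
apply: differentiable_continuous.
by have [] := gC (Rstar_val x) (sU _ (set_mem (valP x))).
Qed.

Lemma C1c_bound (g : Rstar R n -> R) : continuous g ->
  exists2 B, 0 <= B & forall x, phi x != 0 -> g x <= B.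
Proof.
move=> gc; have [_ cS] := phiC.
have : compact (g @` closure [set x | phi x != 0]).
  by apply: continuous_compact => //; exact: continuous_subspaceT.
move=> /compact_bounded[M [_ MP]]; exists (Num.max 0 (M + 1)); first by rewrite le_max lexx.
move=> x px; rewrite le_max; apply/orP; right; apply: le_trans (ler_norm _) _.
apply: (MP (M + 1)); first by rewrite ltrDl.
by exists x => //; exact: subset_closure.
Qed.

Lemma C1c_bounded : exists2 B, 0 <= B & forall x, `|phi x| <= B.
Proof.
have [|B B0 BP] := @C1c_bound (fun x => `|phi x|).
  by move=> x; apply: continuous_comp; [exact: C1c_continuous|exact: norm_continuous].
exists B => // x; have [->|/BP//] := eqVneq (phi x) 0; by rewrite normr0.
Qed.

Lemma C1c_support : exists2 B, 0 <= B & forall x, B < l1norm x -> phi x = 0.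
Proof.
have [B B0 BP] := C1c_bound (@l1norm_continuous R n); exists B => // x Bx.
by apply/eqP; apply: contraTT Bx => /BP; rewrite -leNgt.
Qed.

End C1c_facts.

Section kernel.
Variables (R : realType) (n : nat) (gamma p c1 c2 : R) (K : Rstar R n -> Rstar R n -> R).
Notation X := (Rstar R n).
Hypothesis c10 : 0 < c1.
Hypothesis c12 : c1 <= c2.
Hypothesis K_continuous : continuous (fun z : X * X => K z.1 z.2).
Hypothesis K_bounds : forall x y,
    let m := l1norm x + l1norm y in
    c1 * m `^ gamma * Phi p (l1norm x / m) <= K x y /\
    K x y <= c2 * m `^ gamma * Phi p (l1norm x / m).

Local Notation a := (gamma + 2 * p).

Definition kweight (x : X) : R := l1norm x `^ (- (gamma + p)).

(* Absorbing the weight [|x|^-(gamma+p)] turns [K] into a kernel comparable to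
   [(1/|x| + 1/|y|)^(gamma+2p)]. *)
Definition reduced_kernel (x y : X) : R := kweight x * kweight y * K x y.

Lemma kweight_gt0 x : 0 < kweight x.
Proof. by rewrite powR_gt0 // l1norm_gt0. Qed.

Lemma kweight_continuous : continuous kweight.
Proof.
have -> : kweight = fun x => expR (- (gamma + p) * ln (l1norm x)).
  by apply/funext => x; rewrite /kweight /powR gt_eqF // l1norm_gt0.
move=> x; apply: (@continuous_comp _ _ _ (fun x => - (gamma + p) * ln (l1norm x)) expR); last exact: continuous_expR.
apply: (@continuousM _ _ (fun=> - (gamma + p)) (fun x => ln (l1norm x))); first exact: cst_continuous.
apply: continuous_comp; first exact: l1norm_continuous.
by apply: continuous_ln; exact: l1norm_gt0.
Qed.

(** [Phi p (l1norm x / m)] is the power [- p] of [|x| |y| / m^2], so the left side is the power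
    [gamma + 2 * p] of [m / (|x| |y|)]. *)
Lemma kernel_profile x y : let m := l1norm x + l1norm y in
  kweight x * kweight y * (m `^ gamma * Phi p (l1norm x / m)) =
  ((l1norm x)^-1 + (l1norm y)^-1) `^ a.
Proof.
rewrite /= /Phi /kweight; set x' := l1norm x; set y' := l1norm y.
have x0 : 0 < x' := l1norm_gt0 x; have y0 : 0 < y' := l1norm_gt0 y.
have m0 : 0 < x' + y' by rewrite addr_gt0.
have -> : 1 - x' / (x' + y') = y' / (x' + y') by field; rewrite gt_eqF.
have -> : x'^-1 + y'^-1 = (x' + y') * (x'^-1 * y'^-1) by field; rewrite !gt_eqF.
rewrite !powRM ?mulr_ge0 ?invr_ge0 ?ltW // !powR_inv ?ltW // opprK.
have powD (t r s : R) : 0 < t -> t `^ r * t `^ s = t `^ (r + s).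
  by move=> t0; rewrite powRD // (gt_eqF t0) implybT.
have xE : x' `^ (- a) = x' `^ (- (gamma + p)) * x' `^ (- p).
  by rewrite powD //; congr (_ `^ _); ring.
have yE : y' `^ (- a) = y' `^ (- (gamma + p)) * y' `^ (- p).
  by rewrite powD //; congr (_ `^ _); ring.
have mE : (x' + y') `^ a = (x' + y') `^ gamma * (x' + y') `^ p * (x' + y') `^ p.
  by rewrite !powD //; congr (_ `^ _); ring.
by rewrite xE yE mE; ring.
Qed.

Lemma reduced_kernel_bounds x y :
  c1 * ((l1norm x)^-1 + (l1norm y)^-1) `^ a <= reduced_kernel x y <=
  c2 * ((l1norm x)^-1 + (l1norm y)^-1) `^ a.
Proof.
have [K1 K2] := K_bounds x y; have w0 : 0 < kweight x * kweight y by rewrite mulr_gt0 ?kweight_gt0.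
rewrite -kernel_profile /reduced_kernel !(mulrCA _ (kweight x * kweight y)) !ler_pM2l //.
by apply/andP; split; rewrite mulrA.
Qed.

Lemma reduced_kernel_gt0 x y : 0 < reduced_kernel x y.
Proof.
have /andP[H _] := reduced_kernel_bounds x y; apply: lt_le_trans H.
by rewrite mulr_gt0 // powR_gt0 // addr_gt0 // invr_gt0 l1norm_gt0.
Qed.

Lemma reduced_kernel_continuous : continuous (fun z : X * X => reduced_kernel z.1 z.2).
Proof.
apply: continuous_mul => //; apply: continuous_mul => z.
  exact: (@cvg_comp _ _ _ fst kweight _ _ _ cvg_fst (@kweight_continuous z.1)).
exact: (@cvg_comp _ _ _ snd kweight _ _ _ cvg_snd (@kweight_continuous z.2)).
Qed.

Section test.
Variable phi : X -> R.
Hypothesis phiC : C1c phi.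

Definition reduced_integrand (x y : X) : R :=
  reduced_kernel x y * (phi (Rstar_add x y) - phi x - phi y).

Lemma reduced_integrand_continuous : continuous (fun z : X * X => reduced_integrand z.1 z.2).
Proof.
have phic := C1c_continuous phiC.
apply: continuous_mul; first exact: reduced_kernel_continuous.
apply: continuous_sub; first apply: continuous_sub => z.
- exact: (@cvg_comp _ _ _ (fun z : X * X => Rstar_add z.1 z.2) phi _ _ _ (@Rstar_add_continuous R n z) (phic _)).
- exact: (@cvg_comp _ _ _ fst phi _ _ _ cvg_fst (phic z.1)).
- by move=> z; exact: (@cvg_comp _ _ _ snd phi _ _ _ cvg_snd (phic z.2)).
Qed.

Lemma reduced_integrand_bounded : exists B, forall x y,
  1 <= l1norm x -> 1 <= l1norm y -> `|reduced_integrand x y| <= B.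
Proof.
have [M M0 MP] := C1c_bounded phiC; have [r r0 rP] := C1c_support phiC.
(* Unless the bracket vanishes, one size is at most [r + 1], so the sum of reciprocals lies between
   [(r + 1)^-1] and 2, and one of the two powers bounds it whatever the sign of the exponent. *)
pose W := c2 * Num.max ((r + 1)^-1 `^ a) (2 `^ a).
have W0 : 0 <= W by rewrite mulr_ge0 ?le_max ?powR_ge0 // (le_trans (ltW c10)).
exists (W * (M *+ 3)) => x y x1 y1; rewrite /reduced_integrand.
have [z|nz] := eqVneq (phi (Rstar_add x y) - phi x - phi y) 0.
  by rewrite z mulr0 normr0 mulr_ge0 // mulrn_wge0.
rewrite normrM; apply: ler_pM => //.
  rewrite gtr0_norm ?reduced_kernel_gt0 //.
  have /andP[_ H] := reduced_kernel_bounds x y; apply: le_trans H _.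
  rewrite ler_wpM2l ?(le_trans (ltW c10)) //; apply: powR_between.
    by rewrite invr_gt0; lra.
  have ix : (l1norm x)^-1 <= 1 by rewrite invf_le1 // l1norm_gt0.
  have iy : (l1norm y)^-1 <= 1 by rewrite invf_le1 // l1norm_gt0.
  have ix0 : 0 < (l1norm x)^-1 by rewrite invr_gt0 l1norm_gt0.
  have iy0 : 0 < (l1norm y)^-1 by rewrite invr_gt0 l1norm_gt0.
  apply/andP; split; last by lra.
  have [xr|xr] := leP (l1norm x) (r + 1).
    have : (r + 1)^-1 <= (l1norm x)^-1 by rewrite lef_pV2 ?posrE ?l1norm_gt0 //; lra.
    lra.
  have [yr|yr] := leP (l1norm y) (r + 1).
    have : (r + 1)^-1 <= (l1norm y)^-1 by rewrite lef_pV2 ?posrE ?l1norm_gt0 //; lra.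
    lra.
  case/negP: nz; rewrite !rP ?subrr // ?l1norm_add; lra.
rewrite mulrSr mulr2n; apply: le_trans (ler_normB _ _) _; apply: lerD => //.
by apply: le_trans (ler_normB _ _) _; apply: lerD.
Qed.

(** Only the weight at [x] is present: this is what the inner integral against [f] becomes, the
    weight at [y] arriving with the outer one. *)
Definition weighted_integrand (y x : X) : R :=
  kweight x * (K x y * (phi (Rstar_add x y) - phi x - phi y)).

Lemma weighted_integrandE x y : kweight y * weighted_integrand y x = reduced_integrand x y.
Proof. by rewrite /weighted_integrand /reduced_integrand /reduced_kernel; ring. Qed.

Lemma integrand_continuous :
  continuous (fun z : X * X => K z.1 z.2 * (phi (Rstar_add z.1 z.2) - phi z.1 - phi z.2)).
Proof.
have phic := C1c_continuous phiC.
apply: continuous_mul; first exact: K_continuous.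
apply: continuous_sub; first apply: continuous_sub => z.
- exact: (@cvg_comp _ _ _ (fun z : X * X => Rstar_add z.1 z.2) phi _ _ _ (@Rstar_add_continuous R n z) (phic _)).
- exact: (@cvg_comp _ _ _ fst phi _ _ _ cvg_fst (phic z.1)).
- by move=> z; exact: (@cvg_comp _ _ _ snd phi _ _ _ cvg_snd (phic z.2)).
Qed.

Lemma integrand_continuousl (y : X) :
  continuous (fun x => K x y * (phi (Rstar_add x y) - phi x - phi y)).
Proof.
move=> x; have cp : (z, y) @[z --> x] --> (x, y).
  by have := cvg_pair (@cvg_id _ (nbhs x)) (@cvg_cst _ y _ (nbhs x) _); apply; exact: nbhs_filter.
exact: (cvg_comp _ _ cp (@integrand_continuous (x, y))).
Qed.

Lemma integrand_continuousr (x : X) :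
  continuous (fun y => K x y * (phi (Rstar_add x y) - phi x - phi y)).
Proof.
move=> y; have cp : (x, z) @[z --> y] --> (x, y).
  by have := cvg_pair (@cvg_cst _ x _ (nbhs y) _) (@cvg_id _ (nbhs y)); apply; exact: nbhs_filter.
exact: (cvg_comp _ _ cp (@integrand_continuous (x, y))).
Qed.

Lemma weighted_integrand_bounded (y : X) : exists B, forall x,
  1 <= l1norm x -> `|weighted_integrand y x| <= B.
Proof.
have [M M0 MP] := C1c_bounded phiC.
pose W := c2 * Num.max ((l1norm y)^-1 `^ a) ((1 + (l1norm y)^-1) `^ a).
exists ((kweight y)^-1 * (W * (M *+ 3))) => x x1.
have -> : weighted_integrand y x = (kweight y)^-1 * reduced_integrand x y.
  by rewrite -weighted_integrandE mulKf // gt_eqF // kweight_gt0.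
rewrite normrM gtr0_norm ?invr_gt0 ?kweight_gt0 // ler_pM2l ?invr_gt0 ?kweight_gt0 //.
rewrite normrM; apply: ler_pM => //.
  rewrite gtr0_norm ?reduced_kernel_gt0 //.
  have /andP[_ H] := reduced_kernel_bounds x y; apply: le_trans H _.
  rewrite ler_wpM2l ?(le_trans (ltW c10)) //; apply: powR_between.
    by rewrite invr_gt0 l1norm_gt0.
  rewrite lerDr invr_ge0 (ltW (l1norm_gt0 x)) /= lerD2r.
  by rewrite invf_le1 // l1norm_gt0.
rewrite mulrSr mulr2n; apply: le_trans (ler_normB _ _) _; apply: lerD => //.
by apply: le_trans (ler_normB _ _) _; apply: lerD.
Qed.

End test.

End kernel.

(** * Discrete solutions with uniform bounds *)

Section lattice_system.
Variables (R : realType) (n : nat) (k : Rstar R n -> Rstar R n -> R).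
Variables (eta : forall N, lattice n N -> R) (a c J : R).
Notation X := (Rstar R n).
Hypothesis a1 : a < 1.
Hypothesis c0 : 0 < c.
Hypothesis k_gt0 : forall x y, 0 < k x y.
Hypothesis k_sym : forall x y, k x y = k y x.
Hypothesis k_low : forall x y, c * ((l1norm x)^-1 + (l1norm y)^-1) `^ a <= k x y.
Hypothesis eta0 : forall N (v : lattice n N), 0 <= eta v.
Hypothesis etaJ : forall N, \sum_(v : lattice n N) l1norm (lattice_pt R v) * eta v <= J.

Local Notation pt := (lattice_pt R).

Lemma lattice_system : exists h : forall N, lattice n N -> R,
  [/\ forall N v, 0 <= h N v, forall N, \sum_v h N v <= tail_const a c J *+ 2,
      forall N t, \sum_(v | 2 ^+ t < l1norm (pt v)) h N v <= tail_const a c J * tail_ratio a ^+ t &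
      forall N (phi : X -> R) (r : R), r <= 2 ^+ N -> (forall x, r < l1norm x -> phi x = 0) ->
        2^-1 * (\sum_u h N u * (\sum_v h N v *
            (k (pt v) (pt u) * (phi (Rstar_add (pt v) (pt u)) - phi (pt v) - phi (pt u))))) +
        \sum_(v : lattice n N) phi (pt v) * eta v = 0].
Proof.
have J0 : 0 <= J.
  apply: le_trans (etaJ 0%N); apply: sumr_ge0 => v _.
  by rewrite mulr_ge0 // ltW // l1norm_gt0.
have sol N := @finite_stationary R (lattice n N) (fun v u => k (pt v) (pt u))
  (@lattice_add n N) (@eta N) (fun _ _ => k_gt0 _ _) (@eta0 N).
pose h N := s2val (cid2 (sol N)).
have h0 N : forall v, 0 <= h N v by rewrite /h; case: cid2.
have hP N : forall v, h N v * (\sum_u k (pt v) (pt u) * h N u) =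
    2^-1 * (\sum_u \sum_(w | lattice_add u w == Some v) k (pt u) (pt w) * h N u * h N w) + eta v.
  by rewrite /h; case: cid2.
have s_some N (u v w : lattice n N) : lattice_add u v = Some w ->
    l1norm (pt w) = l1norm (pt u) + l1norm (pt v).
  by case: (lattice_addP R u v) => // w' E [<-]; rewrite E l1norm_add.
have s_none N (u v : lattice n N) : lattice_add u v = None ->
    2 ^+ N < l1norm (pt u) + l1norm (pt v).
  by case: (lattice_addP R u v).
have r0 N (v : lattice n N) : 0 < l1norm (pt v) by exact: l1norm_gt0.
have k0 N (u v : lattice n N) : 0 <= k (pt u) (pt v) by rewrite ltW.
have ks N (u v : lattice n N) : k (pt u) (pt v) = k (pt v) (pt u) by [].
have kl N (u v : lattice n N) : c * ((l1norm (pt u))^-1 + (l1norm (pt v))^-1) `^ a <= k (pt u) (pt v) by [].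
have rM N (v : lattice n N) : l1norm (pt v) <= 2 ^+ N by have /andP[] := lattice_pt_norm R v.
have r1 N (v : lattice n N) : 1 <= l1norm (pt v) by have /andP[] := lattice_pt_norm R v.
exists h; split=> //.
- move=> N; exact: (@truncated_mass R _ (fun v : lattice n N => l1norm (pt v)) _ _ _ _ _
    (@r0 N) (@k0 N) (@ks N) (@s_some N) (@s_none N) (@eta0 N) (h0 N) (hP N) a c J N erefl a1 c0 J0 (@rM N) (etaJ N) (@kl N) (@r1 N)).
- move=> N t; exact: (@truncated_tail R _ (fun v : lattice n N => l1norm (pt v)) _ _ _ _ _
    (@r0 N) (@k0 N) (@ks N) (@s_some N) (@s_none N) (@eta0 N) (h0 N) (hP N) a c J N erefl a1 c0 J0 (@rM N) (etaJ N) (@kl N) t).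
move=> N phi r rN phir.
have W := truncated_weak (hP N) (fun v : lattice n N => phi (pt v)).
rewrite /= in W.
(* A merger lost by the truncation has norm above [2 ^+ N], hence above [r], where [phi] vanishes;
   for this [phi] the truncated equation is exact. *)
have AE : \sum_(i : lattice n N) \sum_j k (pt i) (pt j) * h N i * h N j * oapp (fun v : lattice n N => phi (pt v)) 0 (lattice_add i j) =
   \sum_(i : lattice n N) \sum_j k (pt i) (pt j) * h N i * h N j * phi (Rstar_add (pt i) (pt j)).
  apply: eq_bigr => i _; apply: eq_bigr => j _; congr (_ * _).
  case: (lattice_addP R i j) => [w /= -> //|ij] /=.
  by rewrite phir // l1norm_add; exact: le_lt_trans ij.
rewrite AE in W.
pose A := \sum_(i : lattice n N) \sum_j k (pt i) (pt j) * h N i * h N j * phi (Rstar_add (pt i) (pt j)).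
pose B := \sum_(i : lattice n N) \sum_j k (pt i) (pt j) * h N i * h N j * phi (pt i).
have TE : \sum_u h N u * (\sum_v h N v *
            (k (pt v) (pt u) * (phi (Rstar_add (pt v) (pt u)) - phi (pt v) - phi (pt u)))) = A - B - B.
  have BE : B = \sum_(u : lattice n N) \sum_v k (pt v) (pt u) * h N v * h N u * phi (pt u).
    apply: eq_bigr => i _; apply: eq_bigr => j _; rewrite k_sym /=; ring.
  rewrite {2}BE /B exchange_big /= /A exchange_big /= -!sumrB; apply: eq_bigr => u _.
  rewrite mulr_sumr -!sumrB; apply: eq_bigr => v _; ring.
have {}W : B = 2^-1 * A + \sum_v phi (pt v) * @eta N v by exact: W.
by rewrite TE W; field.
Qed.

End lattice_system.

(** * The limit measure and its weak equation *)

Section limit_measure.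
Variables (R : realType) (n : nat).
Notation X := (Rstar R n).
Variables (D : set R) (Y : R -> X) (w : X -> R) (nu : {measure set (borel X) -> \bar R}).
Hypothesis mD : measurable D.
Hypothesis Dfin : (lebesgue_measure D < +oo)%E.
Hypothesis mY : measurable_fun D (Y : R -> borel X).
Hypothesis Y1 : forall s, D s -> 1 <= l1norm (Y s).
Hypothesis w0 : forall x, 0 < w x.
Hypothesis wc : continuous w.
Hypothesis nuE : forall A, nu A = weighted_image lebesgue_measure D (Y : R -> borel X) (fun s => w (Y s)) A.

(** The continuous density is bounded on each compact set and [D] has finite length; [Rstar_radon]
    asks for no more. *)
Lemma limit_measure_radon : radon nu.
Proof.
apply: Rstar_radon => C cC; rewrite nuE /weighted_image.
have [->|/set0P C0] := eqVneq C set0.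
  by rewrite preimage_set0 setI0 integral_set0.
have [B BP] : exists B, forall x, C x -> w x <= B.
  have /compact_bounded[M [_ MP]] : compact (w @` C).
    by apply: continuous_compact => //; exact: continuous_subspaceT.
  exists (M + 1) => x Cx; apply: le_trans (ler_norm _) _.
  by apply: (MP (M + 1)); [rewrite ltrDl|exists x].
have mC : measurable (C : set (borel X)).
  by apply: closed_borel; exact: (compact_closed (@Rstar_hausdorff R n)).
have mDC : measurable (D `&` (Y : R -> borel X) @^-1` C) by exact: mY.
have mwY : measurable_fun D (fun s => w (Y s)).
  exact: (measurableT_comp (continuous_borel_measurable wc) mY).
apply: (@le_lt_trans _ _ (\int[lebesgue_measure]_(s in D `&` (Y : R -> borel X) @^-1` C) (cst B%:E s))%E).
  apply: ge0_le_integral => //.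
  - by move=> s _; rewrite lee_fin ltW.
  - by apply/measurable_EFinP; apply: measurable_funS mwY.
  - by move=> s [_ Cs] /=; rewrite lee_fin; exact: BP.
rewrite integral_cst //.
have [x Cx] := C0; have B0 : 0 <= B by apply: le_trans (BP x Cx); exact: ltW.
rewrite lte_mul_pinfty ?lee_fin //.
apply: le_lt_trans Dfin; apply: le_measure; rewrite ?inE //.
Qed.

Lemma limit_measure_support : support_measure nu `<=` [set x | 1 <= l1norm x].
Proof.
move=> x /= xS; rewrite leNgt; apply/negP => x1.
have oU : open ((@l1norm R n) @^-1` [set r | r < 1]).
  by have /continuousP := @l1norm_continuous R n; apply; exact: open_lt.
have := xS _ oU x1; rewrite nuE /weighted_image.
rewrite (_ : D `&` _ = set0) ?integral_set0 ?ltxx //.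
apply/seteqP; split=> // s [Ds /=]; rewrite ltNge; apply/negP; rewrite negbK; exact: Y1.
Qed.

End limit_measure.

Theorem theorem3p1 (R : realType) (n : nat) (gamma p : R)
  (hgp : gamma + 2 * p < 1)
  (c1 c2 : R) (hc1 : 0 < c1) (hc12 : c1 <= c2)
  (K : Rstar R n -> Rstar R n -> R)
  (K_ge0 : forall x y, 0 <= K x y)
  (K_continuous : continuous (fun z : Rstar R n * Rstar R n => K z.1 z.2))
  (K_sym : forall x y, K x y = K y x)
  (K_bounds : forall x y,
    let m := l1norm x + l1norm y in
    c1 * m `^ gamma * Phi p (l1norm x / m) <= K x y /\
    K x y <= c2 * m `^ gamma * Phi p (l1norm x / m))
  (eta : {measure set (borel (Rstar R n)) -> \bar R})
  (heta : bounded_radon eta)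
  (L : R) (hL : 1 < L)
  (eta_support : support_measure eta `<=` [set x | 1 <= l1norm x <= L]) :
  exists f : {measure set (borel (Rstar R n)) -> \bar R},
    stationary_injection_solution K gamma p eta f.
Proof.
pose X := Rstar R n.
have k_low (x y : X) : c1 * ((l1norm x)^-1 + (l1norm y)^-1) `^ (gamma + 2 * p) <= reduced_kernel gamma p K x y.
  by have /andP[] := reduced_kernel_bounds K_bounds x y.
have k_sym (x y : X) : reduced_kernel gamma p K x y = reduced_kernel gamma p K y x.
  by rewrite /reduced_kernel K_sym (mulrC (kweight _ _ x)).
have moment N : \sum_(v : lattice n N) l1norm (lattice_pt R v) * rounded_weight eta v <=
    (L + n.+1%:R) * fine (eta setT).
  by apply: (rounded_first_moment heta eta_support); lra.
have [h [h0 hb ht hW]] := lattice_system hgp hc1 (reduced_kernel_gt0 hc1 K_bounds) k_sym k_low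
  (fun N v => rounded_weight_ge0 eta v) moment.
have ptE N (v : lattice n N) := @lattice_ptE R n N v.
have pt1 N (v : lattice n N) : 1 <= l1norm (lattice_pt R v) by have /andP[] := lattice_pt_norm R v.
have [sigma [D [Y [[sm mD Dfin mY Y1] [limit1 limit2]]]]] :=
  lattice_weak_limit (@lattice_coord_inj n) ptE pt1 h0 hb (tail_ratio_bounds hgp) ht.
(* The density that turns the limit of the measures [h] back into [f]. *)
pose w : X -> R := kweight gamma p.
have w0 x : 0 < w x by exact: kweight_gt0.
have wc : continuous w by exact: kweight_continuous.
have mwY : measurable_fun D (fun s => w (Y s)).
  exact: (measurableT_comp (continuous_borel_measurable wc) mY).
have [nu nuE nu_int] := @weighted_image_measure _ _ _ _ R lebesgue_measure D (Y : R -> borel X)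
  (fun s => w (Y s)) mD mY mwY (fun s => ltW (w0 (Y s))).
exists nu; split.
- exact: (limit_measure_radon mD Dfin mY w0 wc nuE).
- exact: (limit_measure_support Y1 nuE).
- have cmoment : continuous (fun x : X => l1norm x `^ (gamma + p)).
    have := @kweight_continuous R n (- gamma) (- p).
    by rewrite /kweight -opprD opprK.
  rewrite (nu_int (fun x => (l1norm x `^ (gamma + p))%:E)); last first.
    by apply/measurable_EFinP; exact: continuous_borel_measurable.
  (* The density cancels the weight, so the moment is the length of [D]. *)
  suff -> : (\int[lebesgue_measure]_(s in D) ((w (Y s))%:E * (l1norm (Y s) `^ (gamma + p))%:E) =
      \int[lebesgue_measure]_(s in D) cst 1 s)%E by rewrite integral_cst // mul1e.
  apply: eq_integral => s _; rewrite /= -EFinM; congr _%:E.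
  by rewrite /w /kweight powRN mulVf // gt_eqF // powR_gt0 // l1norm_gt0.
move=> phi phiC.
have [B BP] := reduced_integrand_bounded hc1 hc12 K_bounds phiC.
have [r r0 rP] := C1c_support phiC; have [M M0 MP] := C1c_bounded phiC.
have phic := C1c_continuous phiC.
pose F (x y : X) := K x y * (phi (Rstar_add x y) - phi x - phi y).
pose G (y : X) := (\int[lebesgue_measure]_(s in D) (weighted_integrand gamma p K phi y (Y s))%:E)%E.
have wFc y : continuous (weighted_integrand gamma p K phi y).
  apply: continuous_mul => //; exact: integrand_continuousl.
have inner y : (\int[nu]_x (F x y)%:E = G y)%E.
  rewrite (nu_int (fun x => (F x y)%:E)).
    by apply: eq_integral => s _; rewrite /= -EFinM.
  apply/measurable_EFinP; apply: continuous_borel_measurable.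
  exact: (@integrand_continuousl _ _ _ K_continuous _ phiC y).
(* The inner integral is, by [limit1] at each [y], a pointwise limit of finite sums continuous in
   [y]. As [y] ranges over the whole space, the bound used here may depend on [y]. *)
have mG : measurable_fun setT (G : borel X -> \bar R).
  apply: (@emeasurable_fun_cvg _ _ _ _ (fun m (y : borel X) =>
    (\sum_(i : lattice n (sigma m)) h _ i * weighted_integrand gamma p K phi y (lattice_pt R i))%:E)).
    move=> m; apply/measurable_EFinP; apply: continuous_borel_measurable.
    apply: continuous_sum => i.
    apply: (@continuous_mul _ _ (fun=> h _ i)); first exact: cst_continuous.
    apply: (@continuous_mul _ _ (fun=> kweight gamma p (lattice_pt R i))); first exact: cst_continuous.
    exact: (@integrand_continuousr _ _ _ K_continuous _ phiC (lattice_pt R i)).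
  move=> y _; have [By ByP] := weighted_integrand_bounded hc1 hc12 K_bounds phiC y.
  exact: (limit1 _ _ ByP (wFc y)).
have GE : (\int[nu]_y \int[nu]_x (F x y)%:E = \int[lebesgue_measure]_(t in D)
    \int[lebesgue_measure]_(s in D) (reduced_integrand gamma p K phi (Y s) (Y t))%:E)%E.
  under eq_integral do rewrite inner.
  rewrite (nu_int _ mG); apply: eq_integral => t _; rewrite /G -integralZl //.
    by apply: eq_integral => s _; rewrite -EFinM weighted_integrandE.
  apply: measurable_bounded_integrable => //.
    exact: (measurableT_comp (continuous_borel_measurable (wFc (Y t))) mY).
  have [By ByP] := weighted_integrand_bounded hc1 hc12 K_bounds phiC (Y t).
  by exists By; split; [exact: num_real|move=> z Bz s Ds; apply: le_trans (ltW Bz); apply: ByP; exact: Y1].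
have etaphi : (\int[eta]_x (phi x)%:E)%E \is a fin_num.
  apply: integrable_fin_num => //; apply: measurable_bounded_integrable => //.
  - exact: heta.2.
  - exact: continuous_borel_measurable.
  - by exists M; split; [exact: num_real|move=> z Mz x _; apply: le_trans (ltW Mz)].
have limT := limit2 _ _ BP (reduced_integrand_continuous K_continuous phiC).
have limE : (\sum_(v : lattice n (sigma m)) phi (lattice_pt R v) * rounded_weight eta v)%:E @[m --> \oo] -->
    (\int[eta]_x (phi x)%:E)%E.
  have sigma_oo : sigma m @[m --> \oo] --> \oo.
    by apply/cvgnyPge => A; near=> m; apply: leq_trans (sm m); near: m; exact: nbhs_infty_ge.
  exact: (cvg_comp _ _ sigma_oo (rounded_cvg heta eta_support phic MP)).
have {}limE := cvgeZl (_ : (- 2)%:E \is a fin_num) limE.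
(* The discrete equation makes the double sum [-2] times the source sum as soon as
   [r <= 2 ^+ sigma m]; both converge, and limits are unique. *)
have TE : (\int[lebesgue_measure]_(t in D)
    \int[lebesgue_measure]_(s in D) (reduced_integrand gamma p K phi (Y s) (Y t))%:E =
    (- 2)%:E * \int[eta]_x (phi x)%:E)%E.
  apply: (cvg_unique (@ereal_hausdorff R) limT); apply: cvg_trans (limE isT).
  apply: near_eq_cvg; near=> m; rewrite /= -EFinM; congr _%:E.
  have rm : r <= 2 ^+ sigma m.
    apply: (@le_trans _ _ m%:R); first by near: m; exact: nbhs_infty_ger.
    by rewrite -natrX ler_nat; apply: leq_trans (sm m) _; rewrite ltnW // ltn_expl.
  have := hW _ _ _ rm rP; rewrite /reduced_integrand; lra.
rewrite GE TE -(fineK etaphi) -!EFinM -EFinD; congr _%:E; field.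
Unshelve. all: by end_near. Qed.
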